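(* Assume that all rational places of arbitrary algebraic function fields admit local uniformization. Then every large field $K$ satisfies the following condition (RP=EC): if an algebraic function field $F|K$ admits a rational place, then $K$ is existentially closed in $F$. Moreover, under the same assumption, the following three conditions are equivalent for an arbitrary field $K$: 1) $K$ is a large field; 2) $K$ is existentially closed in every power series field $K((G))$; 3) $K$ is existentially closed in every extension field $L$ which admits a $K$-rational place.
   Context: An algebraic function field $F|K$ is a finitely generated field extension of positive transcendence degree. A place $P$ of an extension field $L$ of $K$ is ($K$-)rational if it is trivial on $K$ and its residue field $LP$ equals $K$. A rational place $P$ of $F|K$ admits local uniformization if $F|K$ admits a model (a $K$-variety with function field $F$) on which $P$ is centered at a simple (i.e. regular) $K$-rational point. A field $K$ is large if for every smooth curve over $K$ the set of $K$-rational points is infinite if it is non-empty. For an ordered abelian group $G$, $K((G))$ is the field of generalized power series with coefficients in $K$, exponents in $G$ and well-ordered support (with trivial factor system); in 2), $G$ ranges over all ordered abelian groups. $K$ is existentially closed in an extension field $L$ if for all $m,n\in\mathbb N$ and all polynomials $f_1,\ldots,f_n,g\in K[X_1,\ldots,X_m]$, whenever $f_1,\ldots,f_n$ have a common zero in $L^m$ which is not a zero of $g$, they also have a common zero in $K^m$ which is not a zero of $g$. *)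

(* Defs.v *)
(* MathComp, with mathcomp-classical for sets of elements of a field and for
   classical logic, and multinomials for polynomials in several variables. *)
From HB Require Import structures.
From mathcomp Require Import all_boot all_order all_algebra.
From mathcomp Require Import mpoly.
From mathcomp Require Import finmap boolp classical_sets functions cardinality.
From mathcomp Require Import fsbigop.

Set Implicit Arguments.
Unset Strict Implicit.
Unset Printing Implicit Defensive.

Import Order.TTheory GRing.Theory Num.Theory.

Local Open Scope classical_set_scope.
Local Open Scope ring_scope.

(** * Extensions of fields

    An extension field [L] of [K] is given by a ring morphism
    [iota : {rmorphism K -> L}]; [mmap iota x p] is the value at the point [x]
    of [L^n] of a polynomial [p] over [K]. *)

Section Extensions.
Variables (K F : fieldType) (iota : {rmorphism K -> F}).

Definition existentially_closed : Prop :=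
  forall (m n : nat) (f : 'I_n -> {mpoly K[m]}) (g : {mpoly K[m]}),
    (exists x : 'I_m -> F,
        (forall i, mmap iota x (f i) = 0) /\ mmap iota x g <> 0) ->
    exists y : 'I_m -> K, (forall i, (f i).@[y] = 0) /\ g.@[y] <> 0.

Definition field_generates n (x : 'I_n -> F) : Prop :=
  forall z : F, exists p q : {mpoly K[n]},
    mmap iota x q <> 0 /\ z = mmap iota x p / mmap iota x q.

Definition finitely_generated : Prop :=
  exists n (x : 'I_n -> F), field_generates x.

Definition alg_independent d (x : 'I_d -> F) : Prop :=
  forall p : {mpoly K[d]}, mmap iota x p = 0 -> p = 0.

Definition has_trdeg (d : nat) : Prop :=
  (exists x : 'I_d -> F, alg_independent x) /\
  ~ (exists x : 'I_d.+1 -> F, alg_independent x).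

Definition function_field : Prop :=
  finitely_generated /\ (exists2 d, (0 < d)%N & has_trdeg d).

End Extensions.

(** * Places *)

(* [None] is the value "infinity". *)
Record place (L : fieldType) := Place {
  residue_field : fieldType;
  place_fun :> L -> option residue_field;
  place1 : place_fun 1 = Some 1;
  placeD : forall x y a b, place_fun x = Some a -> place_fun y = Some b ->
    place_fun (x + y) = Some (a + b);
  placeM : forall x y a b, place_fun x = Some a -> place_fun y = Some b ->
    place_fun (x * y) = Some (a * b);
  placeV : forall x, place_fun x = None -> place_fun x^-1 = Some 0;
  place_surj : forall a, exists x, place_fun x = Some a
}.

Section RationalPlaces.
Variables (K L : fieldType) (iota : {rmorphism K -> L}).

Definition trivial_on (P : place L) : Prop := forall c : K, P (iota c) <> None.

Definition rational_place (P : place L) : Prop :=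
  trivial_on P /\
  forall a : residue_field P, exists c : K, P (iota c) = Some a.

End RationalPlaces.

(** * Local rings inside a field

    Subrings of a field and their ideals are handled as sets of elements of
    that field. *)

Section LocalRings.
Variable F : fieldType.
Implicit Types A o p : set F.

Record prime_ideal A p : Prop := PrimeIdeal {
  prime_ideal_sub : p `<=` A;
  prime_ideal0 : p 0;
  prime_idealD : forall a b, p a -> p b -> p (a + b);
  prime_idealM : forall a b, A a -> p b -> p (a * b);
  prime_ideal_proper : ~ p 1;
  prime_ideal_prime : forall a b, A a -> A b -> p (a * b) -> p a \/ p b
}.

Definition localization A p : set F :=
  [set z | exists a b, [/\ A a, A b, ~ p b & z = a / b]].

(* The maximal ideal of [o], when [o] is a local ring. *)
Definition nonunits o : set F := [set z | o z /\ forall w, o w -> z * w <> 1].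

Definition prime_chain A (d : nat) : Prop :=
  exists p : nat -> set F,
    (forall i, (i <= d)%N -> prime_ideal A (p i)) /\
    (forall i, (i < d)%N -> p i `<` p i.+1).

Definition has_krull_dim A (d : nat) : Prop :=
  prime_chain A d /\ ~ prime_chain A d.+1.

Definition regular_local o : Prop :=
  exists2 d : nat, has_krull_dim o d &
    exists2 t : 'I_d -> F, (forall k, nonunits o (t k)) &
      forall z, nonunits o z -> exists2 c : 'I_d -> F,
        (forall k, o (c k)) & z = \sum_k c k * t k.

(* The valuation ring of [P] dominates the local ring [o]. *)
Definition dominates (P : place F) o : Prop :=
  (forall z, o z -> P z <> None) /\ (forall z, nonunits o z -> P z = Some 0).

End LocalRings.

(** * Models

    A [K]-variety with function field [F] is given in the language of Zariski,
    as the set of the local rings of its points, which are subrings of [F]. It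
    is the union of finitely many affine charts. The [i]-th chart is the
    spectrum of [K[chart i 0, ..., chart i (n - 1)]], and its points are the
    localizations of this ring at prime ideals. Points of different charts are
    identified when their local rings are equal. The valuative criterion, that
    every place of [F] is centered at no more than one point, expresses that
    the integral scheme obtained in this way is separated. *)

Section Models.
Variables (K F : fieldType) (iota : {rmorphism K -> F}).

Definition chart_ring n (x : 'I_n -> F) : set F := range (mmap iota x).

Definition chart_points n (x : 'I_n -> F) : set (set F) :=
  [set o | exists2 p, prime_ideal (chart_ring x) p &
                      o = localization (chart_ring x) p].

Record model := Model {
  nb_charts : nat;
  chart_dim : 'I_nb_charts -> nat;
  chart : forall i, 'I_(chart_dim i) -> F;
  model_neq0 : (0 < nb_charts)%N;
  model_function_field : forall i, field_generates iota (@chart i);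
  model_separated : forall (P : place F) (i j : 'I_nb_charts) o o',
    chart_points (@chart i) o -> chart_points (@chart j) o' ->
    dominates P o -> dominates P o' -> o = o'
}.

Definition points (M : model) : set (set F) :=
  [set o | exists i : 'I_(nb_charts M), chart_points (@chart M i) o].

(* The residue field of [o] is [K]. *)
Definition rational_point (o : set F) : Prop :=
  forall z, o z -> exists c : K, nonunits o (z - iota c).

Definition rational_points (M : model) : set (set F) :=
  [set o | points M o /\ rational_point o].

Definition admits_local_uniformization (P : place F) : Prop :=
  exists (M : model) (o : set F),
    [/\ rational_points M o, dominates P o & regular_local o].

(* The Jacobian criterion: the affine variety [Spec K[x]] of dimension [d] is
   smooth over [K] if at each of its points, with coordinates in an arbitrary
   extension field [Om] of [K], the ideal of the variety contains [n - d]
   polynomials whose Jacobian matrix has rank [n - d] at this point. *)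
Definition smooth_chart (d n : nat) (x : 'I_n -> F) : Prop :=
  forall (Om : fieldType) (j : {rmorphism K -> Om}) (a : 'I_n -> Om),
    (forall p, mmap iota x p = 0 -> mmap j a p = 0) ->
    exists2 h : 'I_(n - d) -> {mpoly K[n]},
      (forall k, mmap iota x (h k) = 0) &
      \rank (\matrix_(k < n - d, l < n) mmap j a (mderiv l (h k))) = (n - d)%N.

Definition smooth (d : nat) (M : model) : Prop :=
  forall i : 'I_(nb_charts M), smooth_chart d (@chart M i).

End Models.

Definition large (K : fieldType) : Prop :=
  forall (F : fieldType) (iota : {rmorphism K -> F}) (C : model iota),
    has_trdeg iota 1 -> smooth 1 C ->
    rational_points C !=set0 -> infinite_set (rational_points C).

Definition RP_EC (K : fieldType) : Prop :=
  forall (F : fieldType) (iota : {rmorphism K -> F}),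
    function_field iota ->
    (exists P : place F, rational_place iota P) ->
    existentially_closed iota.

(** * Fields of generalized power series *)

HB.mixin Record Zmodule_isOrderedGroup G of GRing.Zmodule G := {
  og_le : rel G;
  og_lexx : reflexive og_le;
  og_le_anti : antisymmetric og_le;
  og_le_trans : transitive og_le;
  og_le_total : total og_le;
  og_leD2r : forall z x y : G, og_le x y -> og_le (x + z) (y + z)
}.

#[short(type="orderedGroupType")]
HB.structure Definition OrderedGroup :=
  {G of GRing.Zmodule G & Zmodule_isOrderedGroup G}.

Definition og_lt (G : orderedGroupType) (x y : G) : bool := ~~ og_le y x.

Reserved Notation "x <=g y" (at level 70, no associativity).
Reserved Notation "x <g y" (at level 70, no associativity).
Local Notation "x <=g y" := (og_le x y).
Local Notation "x <g y" := (og_lt x y).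

Section WellOrdered.
Variable G : orderedGroupType.
Implicit Types A B C : set G.

Definition well_ordered A : Prop :=
  forall B, B `<=` A -> B !=set0 -> exists2 m, B m & forall b, B b -> m <=g b.

Implicit Types x y z t : G.

Lemma og_leNgt x y : (x <=g y) = ~~ (y <g x).
Proof. by rewrite /og_lt negbK. Qed.

Lemma og_ltNge x y : (x <g y) = ~~ (y <=g x).
Proof. by []. Qed.

Lemma og_ltW x y : x <g y -> x <=g y.
Proof. by rewrite /og_lt => /negbTE yx; have := og_le_total x y; rewrite yx orbF. Qed.

Lemma og_ltxx x : (x <g x) = false.
Proof. by rewrite /og_lt og_lexx. Qed.

Lemma og_le_lt_trans y x z : x <=g y -> y <g z -> x <g z.
Proof. by move=> xy; apply: contraNN => zx; apply: og_le_trans xy. Qed.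

Lemma og_lt_trans y x z : x <g y -> y <g z -> x <g z.
Proof. by move=> /og_ltW; apply: og_le_lt_trans. Qed.

Lemma og_le_eqVlt x y : (x <=g y) = (x == y) || (x <g y).
Proof.
apply/idP/idP => [xy|/orP[/eqP ->|/og_ltW //]]; last exact: og_lexx.
have [//|xNy /=] := eqVneq x y; apply: contraNN xNy => yx.
by apply/eqP/og_le_anti; rewrite xy.
Qed.

Lemma og_lt_neqAle x y : (x <g y) = (x != y) && (x <=g y).
Proof.
rewrite og_le_eqVlt; have [->|] := eqVneq x y; first by rewrite og_ltxx.
by [].
Qed.

Lemma og_lt_eqF x y : x <g y -> (x == y) = false.
Proof. by rewrite og_lt_neqAle => /andP[/negbTE]. Qed.

Lemma og_gt_eqF x y : y <g x -> (x == y) = false.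
Proof. by rewrite eq_sym; apply: og_lt_eqF. Qed.

Lemma og_leD2rE (z x y : G) : (x + z <=g y + z) = (x <=g y).
Proof.
apply/idP/idP; last exact: og_leD2r.
by move=> /(og_leD2r (- z)); rewrite !addrK.
Qed.

Lemma og_leD2lE (z x y : G) : (z + x <=g z + y) = (x <=g y).
Proof. by rewrite ![z + _]addrC og_leD2rE. Qed.

Lemma og_ltD2rE (z x y : G) : (x + z <g y + z) = (x <g y).
Proof. by rewrite !og_ltNge og_leD2rE. Qed.

Lemma og_ltD2lE (z x y : G) : (z + x <g z + y) = (x <g y).
Proof. by rewrite !og_ltNge og_leD2lE. Qed.

Lemma og_leD (x y z t : G) : x <=g y -> z <=g t -> x + z <=g y + t.
Proof.
by move=> xy zt; apply: (@og_le_trans _ (y + z)); rewrite ?og_leD2rE ?og_leD2lE.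
Qed.

Lemma well_orderedS A B : A `<=` B -> well_ordered B -> well_ordered A.
Proof. by move=> AB wB C CA; apply: wB; apply: subset_trans AB. Qed.

Lemma well_ordered0 : well_ordered set0.
Proof. by move=> B B0 [b /B0]. Qed.

Lemma well_ordered1 g : well_ordered [set g].
Proof.
move=> B Bg [b Bb]; exists b => // c /Bg ->.
by rewrite (Bg _ Bb) og_lexx.
Qed.

Lemma well_orderedU A B :
  well_ordered A -> well_ordered B -> well_ordered (A `|` B).
Proof.
move=> wA wB C CAB [c Cc].
have [nA|CA0] := pselect ((C `&` A) !=set0); last first.
  apply: wB; last by exists c.
  by move=> x Cx; case: (CAB _ Cx) => // Ax; case: CA0; exists x.
have [nB|CB0] := pselect ((C `&` B) !=set0); last first.
  apply: wA; last by exists c.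
  by move=> x Cx; case: (CAB _ Cx) => // Bx; case: CB0; exists x.
have [a [Ca Aa] amin] := wA _ (@subIsetr _ _ _) nA.
have [b [Cb Bb] bmin] := wB _ (@subIsetr _ _ _) nB.
have [ab|ba] := boolP (a <=g b).
  exists a => // x Cx; case: (CAB _ Cx) => [Ax|Bx]; first exact: amin.
  by apply: og_le_trans ab _; apply: bmin.
exists b => // x Cx; case: (CAB _ Cx) => [Ax|Bx]; last exact: bmin.
by apply: og_le_trans (og_ltW ba) _; apply: amin.
Qed.

Lemma well_orderedD A B :
  well_ordered A -> well_ordered B ->
  well_ordered [set g | exists a b, [/\ A a, B b & g = a + b]].
Proof.
move=> wA wB S SAB [s0 Ss0].
have [//|nomin] := pselect (exists2 m, S m & forall b, S b -> m <=g b).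
have next (T : set G) : T `<=` S -> T !=set0 ->
    exists a b, [/\ A a, B b, T (a + b) &
      forall a' b', A a' -> B b' -> T (a' + b') -> a <=g a'].
  move=> TS [t Tt].
  have := wA [set a | A a /\ exists2 b, B b & T (a + b)].
  case=> [a []//||a [Aa [b Bb Tab]] amin].
    have [a [b [Aa Bb tab]]] := SAB _ (TS _ Tt).
    by exists a; split=> //; exists b; rewrite -?tab.
  exists a, b; split=> // a' b' Aa' Bb' T'; apply: amin; split=> //.
  by exists b'.
pose E := [set b | B b /\ exists a, [/\ A a, S (a + b) &
  forall a' b', A a' -> B b' -> S (a' + b') -> a' + b' <=g a + b -> a <=g a']].
have [|b [Bb [a [Aa Sab amin]]] bmin] := wB E (fun _ => @proj1 _ _).
  have [|a [b [Aa Bb Sab amin]]] := next S (@subset_refl _ _); first by exists s0.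
  by exists b; split=> //; exists a; split=> // a' b' Aa' Bb' S' _; apply: amin S'.
have [|a' [b' [Aa' Bb' [S' lt'] amin']]] :=
    next [set s | S s /\ s <g a + b] (fun _ => @proj1 _ _).
  apply: contrapT => no; apply: nomin; exists (a + b) => // s Ss.
  by rewrite og_leNgt; apply/negP => lts; apply: no; exists s.
have aa' : a <=g a' by apply: (amin a' b') => //; apply: og_ltW.
have : b <=g b'.
  apply: bmin; split=> //; exists a'; split=> // a2 b2 Aa2 Bb2 S2 le2.
  by apply: (amin' a2 b2) => //; split=> //; apply: og_le_lt_trans lt'.
move=> bb'; have := og_leD aa' bb'.
by rewrite og_leNgt lt'.
Qed.

Lemma well_ordered_finite A : well_ordered A ->
  (forall B, B `<=` A -> B !=set0 -> exists2 m, B m & forall b, B b -> b <=g m) ->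
  finite_set A.
Proof.
move=> wA wA'.
have [->|/set0P A0] := eqVneq A set0; first exact: finite_set0.
pose D := [set c | A c /\ ~ finite_set (A `&` [set x | x <=g c])].
have [c Ac cmax] := wA' A (@subset_refl _ _) A0.
apply: contrapT => Ainf.
have [||m [Am minf] mmin] := wA D; first by move=> x [].
  exists c; split=> // fin; apply: Ainf; apply: sub_finite_set fin => x Ax.
  by split=> //; apply: cmax.
have [lt0|lt0] := pselect ((A `&` [set x | x <g m]) !=set0); last first.
  apply: minf; apply: (@sub_finite_set _ _ [set m]); last exact: finite_set1.
  move=> x [Ax /= xm]; apply: contrapT => /eqP xNm.
  by apply: lt0; exists x; split=> //=; rewrite og_lt_neqAle xNm.
have [m' [Am' /= m'm] m'max] := wA' _ (@subIsetl _ _ _) lt0.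
have : m <=g m'.
  apply: mmin; split=> // fin; apply: minf.
  apply: (@sub_finite_set _ _ ((A `&` [set x | x <=g m']) `|` [set m])).
    move=> x [Ax /= xm]; have [->|xNm] := eqVneq x m; first by right.
    by left; split=> //=; apply: m'max; split=> //=; rewrite og_lt_neqAle xNm.
  by rewrite finite_setU; split=> //; apply: finite_set1.
by rewrite og_leNgt m'm.
Qed.

Lemma well_ordered_fiber A B g : well_ordered A -> well_ordered B ->
  finite_set [set a | A a /\ B (g - a)].
Proof.
move=> wA wB; apply: well_ordered_finite.
  by apply: well_orderedS wA => a [].
move=> C CA [c Cc].
have [||_ [d Cd <-] dmin] := wB [set g - a | a in C].
- by move=> _ [a /CA[_ ?] <-].
- by exists (g - c), c.
exists d => // b Cb.
have := dmin (g - b); rewrite og_leD2lE => le.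
have : - d <=g - b by apply: le; exists b.
move=> /(og_leD2r (d + b)); by rewrite addrA addNr add0r addrCA addNr addr0.
Qed.

End WellOrdered.

Section Hahn.
Variables (K : fieldType) (G : orderedGroupType).

Record hahn := Hahn {
  hcoef :> G -> K;
  hahn_wo : well_ordered [set g | hcoef g <> 0]
}.
Arguments hahn_wo : clear implicits.

HB.instance Definition _ := gen_eqMixin hahn.
HB.instance Definition _ := gen_choiceMixin hahn.

Implicit Types (x y z : hahn) (g : G) (c : K).

Let supp (f : G -> K) : set G := [set g | f g <> 0].

Lemma hahnP x y : hcoef x =1 hcoef y -> x = y.
Proof.
case: x y => [f wf] [g wg] /= /funext fg; move: wf wg; rewrite fg => wf wg.
by congr Hahn; apply: Prop_irrelevance.
Qed.

Lemma hsum_supp (f : G -> K) (A : {fset G}) :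
  (forall a, f a <> 0 -> a \in A) ->
  \sum_(a \in [set: G]) f a = \sum_(a <- A) f a.
Proof.
move=> fA; apply: fsbigTE => a; apply: contraNeq => /eqP; exact: fA.
Qed.

Lemma hsingle_subproof g c : well_ordered (supp (fun h => if h == g then c else 0)).
Proof.
apply: well_orderedS (well_ordered1 (g := g)) => h /=.
by rewrite /supp /=; case: eqP.
Qed.

(* [hsingle g c] is the monomial [c t^g]. *)
Definition hsingle g c := Hahn (@hsingle_subproof g c).

Lemma hopp_subproof x : well_ordered (supp (fun g => - x g)).
Proof.
apply: well_orderedS (hahn_wo x) => g /= /eqP; rewrite oppr_eq0 => /eqP //.
Qed.

Lemma hadd_subproof x y : well_ordered (supp (fun g => x g + y g)).
Proof.
apply: well_orderedS (well_orderedU (hahn_wo x) (hahn_wo y)) => g /= xy0.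
have [x0|] := eqVneq (x g) 0; last by move=> /eqP; left.
by right=> y0; apply: xy0; rewrite x0 y0 addr0.
Qed.

(* Since supports are well-ordered, only finitely many terms are nonzero. *)
Definition hmul_fun x y : G -> K :=
  fun g => \sum_(a \in [set: G]) x a * y (g - a).

Lemma hmul_supp x y g : hmul_fun x y g <> 0 ->
  exists a b, [/\ x a <> 0, y b <> 0 & g = a + b].
Proof.
move=> xy0; apply: contrapT => no; apply: xy0; apply: fsbig1 => a _.
have [->|/eqP xa] := eqVneq (x a) 0; first by rewrite mul0r.
have [->|/eqP ya] := eqVneq (y (g - a)) 0; first by rewrite mulr0.
by case: no; exists a, (g - a); split=> //; rewrite addrC subrK.
Qed.

Lemma hmul_subproof x y : well_ordered (supp (hmul_fun x y)).
Proof.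
apply: well_orderedS (well_orderedD (hahn_wo x) (hahn_wo y)) => g.
exact: hmul_supp.
Qed.

Definition hzero := hsingle 0 0.
Definition hone := hsingle 0 1.
Definition hopp x := Hahn (@hopp_subproof x).
Definition hadd x y := Hahn (@hadd_subproof x y).
Definition hmul x y := Hahn (@hmul_subproof x y).

Lemma haddA : associative hadd.
Proof. by move=> x y z; apply: hahnP => g /=; rewrite addrA. Qed.

Lemma haddC : commutative hadd.
Proof. by move=> x y; apply: hahnP => g /=; rewrite addrC. Qed.

Lemma hadd0 : left_id hzero hadd.
Proof. by move=> x; apply: hahnP => g /=; rewrite if_same add0r. Qed.

Lemma haddN : left_inverse hzero hopp hadd.
Proof. by move=> x; apply: hahnP => g /=; rewrite if_same addNr. Qed.

HB.instance Definition _ := GRing.isZmodule.Build hahn haddA haddC hadd0 haddN.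

Lemma hfiber (A B : set G) g : well_ordered A -> well_ordered B ->
  exists S : {fset G}, forall a, (a \in S) <-> (A a /\ B (g - a)).
Proof.
move=> wA wB; have /finite_fsetP[S eS] := well_ordered_fiber g wA wB.
exists S => a; have : ([set a | A a /\ B (g - a)] a) = ([set` S] a) by rewrite eS.
by move=> /= ->.
Qed.

Lemma hmulE x y g : (hmul x y) g = \sum_(a \in [set: G]) x a * y (g - a).
Proof. by []. Qed.

Lemma mulKneq0 (a b : K) : a * b <> 0 -> a <> 0 /\ b <> 0.
Proof. by move=> ab; split=> e; apply: ab; rewrite e ?mul0r ?mulr0. Qed.

Lemma hmulC : commutative hmul.
Proof.
move=> x y; apply: hahnP => g; rewrite !hmulE.
rewrite (reindex_fsbigT (fun a => g - a)); last first.
  by exists (fun a => g - a) => a; rewrite subKr.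
by apply: eq_fsbigr => a _; rewrite subKr mulrC.
Qed.

Lemma hmulDl : left_distributive hmul hadd.
Proof.
move=> x y z; apply: hahnP => g; rewrite [RHS]/= /hmul_fun hmulE.
have [S hS] := hfiber g (well_orderedU (hahn_wo x) (hahn_wo y)) (hahn_wo z).
rewrite (@hsum_supp _ S) => [|a /mulKneq0[xyn zn]]; last first.
  apply/hS; split=> //.
  have [x0|/eqP] := eqVneq (x a) 0; last by left.
  by right=> y0; apply: xyn; rewrite /= x0 y0 addr0.
rewrite (@hsum_supp _ S) => [|a /mulKneq0[xn zn]]; last first.
  by apply/hS; split=> //; left.
rewrite (@hsum_supp _ S) => [|a /mulKneq0[yn zn]]; last first.
  by apply/hS; split=> //; right.
by rewrite -big_split; apply: eq_bigr => a _; rewrite mulrDl.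
Qed.

Lemma hsingle0_mul c y g : hmul (hsingle 0 c) y g = c * y g.
Proof.
rewrite hmulE (@hsum_supp _ [fset (0 : G)]%fset).
  by rewrite big_seq_fset1 /= eqxx subr0.
by move=> a /mulKneq0[/=]; case: eqP => [-> _|//]; rewrite inE eqxx.
Qed.

Lemma hmul1 : left_id hone hmul.
Proof. by move=> x; apply: hahnP => g; rewrite hsingle0_mul mul1r. Qed.

Lemma hmulA : associative hmul.
Proof.
move=> x y z; apply: hahnP => g; rewrite !hmulE.
have [Sa hSa] := hfiber g (well_orderedD (hahn_wo x) (hahn_wo y)) (hahn_wo z).
have [Sb hSb] := hfiber g (hahn_wo x) (well_orderedD (hahn_wo y) (hahn_wo z)).
rewrite (@hsum_supp _ Sb) => [|b /mulKneq0[xb yzb]]; last first.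
  by apply/hSb; split=> //; exact: (hmul_supp yzb).
rewrite (@hsum_supp _ Sa) => [|a /mulKneq0[xya za]]; last first.
  by apply/hSa; split=> //; exact: (hmul_supp xya).
have -> : \sum_(b <- Sb) x b * hmul y z (g - b) =
    \sum_(b <- Sb) \sum_(a <- Sa) x b * (y (a - b) * z (g - a)).
  apply: eq_big_seq => b /hSb[xb _]; rewrite -mulr_sumr; congr (_ * _).
  rewrite hmulE (reindex_fsbigT (fun a => a - b)); last first.
    by exists (fun a => a + b) => a; rewrite ?subrK ?addrK.
  have gE a : g - b - (a - b) = g - a by rewrite opprB addrA subrK.
  rewrite (@hsum_supp _ Sa) => [|a]; last first.
    rewrite gE => /mulKneq0[yn zn]; apply/hSa; split=> //.
    by exists b, (a - b); split=> //; rewrite addrC subrK.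
  by apply: eq_bigr => a _; rewrite gE.
rewrite exchange_big; apply: eq_big_seq => a /hSa[_ za].
rewrite hmulE (@hsum_supp _ Sb) => [|b /mulKneq0[xb yn]]; last first.
  apply/hSb; split=> //; exists (a - b), (g - a); split=> //.
  by rewrite [RHS]addrC addrA subrK.
by rewrite mulr_suml; apply: eq_bigr => b _; rewrite mulrA.
Qed.

Lemma hone_neq0 : hone != 0.
Proof.
apply/eqP => /(congr1 (fun x => hcoef x 0)) /= /eqP.
by rewrite !eqxx oner_eq0.
Qed.

HB.instance Definition _ := GRing.Zmodule_isComNzRing.Build hahn
  hmulA hmulC hmul1 hmulDl hone_neq0.

Lemma hcoef0 g : (0 : hahn) g = 0. Proof. by rewrite /= if_same. Qed.
Lemma hcoefD x y g : (x + y) g = x g + y g. Proof. by []. Qed.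
Lemma hcoefN x g : (- x) g = - x g. Proof. by []. Qed.

Lemma hahn_min x : x != 0 -> exists2 m, x m <> 0 & forall g, x g <> 0 -> m <=g g.
Proof.
move=> x0; apply: (hahn_wo x _ (@subset_refl _ _)).
apply: contrapT => no; move/eqP: x0; apply; apply: hahnP => g.
by rewrite hcoef0; apply: contrapT => xg; apply: no; exists g.
Qed.

Section Inverse.
Variables (x : hahn) (m : G).
Hypotheses (xm : x m <> 0) (m_min : forall g, x g <> 0 -> m <=g g).

Lemma hmul_lead (w : hahn) g : (forall b, b <g g -> w b = 0) ->
  (x * w) (m + g) = x m * w g.
Proof.
move=> w0; rewrite [LHS]hmulE (@hsum_supp _ [fset m]%fset).
  by rewrite big_seq_fset1 addrC addKr.
move=> a /mulKneq0[xa wa]; rewrite inE; apply/eqP/og_le_anti.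
rewrite (m_min xa) andbT og_leNgt; apply/negP => ma; apply: wa; apply: w0.
by rewrite -(og_ltD2rE a) subrK addrC og_ltD2lE.
Qed.

(* An approximate inverse of [x]: [x * z - 1] vanishes, up to the shift by [m],
   on the initial segment of [G] spanned by the support of [z]. *)
Let good (z : hahn) := forall a, z a <> 0 -> forall b, b <=g a ->
  (x * z) (m + b) = (1 : hahn) (m + b).

Let good_agree z z' a a' : good z -> good z' -> z a <> 0 -> z' a' <> 0 ->
  a <=g a' -> forall b, b <=g a -> z b = z' b.
Proof.
move=> gz gz' za za' aa' b ba; apply/eqP; rewrite -subr_eq0; apply/eqP.
apply: contrapT => wb; have w0 : z - z' != 0.
  by apply/eqP => e; apply: wb; rewrite -hcoefN -hcoefD e hcoef0.
have [g wg gmin] := hahn_min w0.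
have ga : g <=g a by apply: og_le_trans ba; apply: gmin.
have : (x * (z - z')) (m + g) = 0.
  by rewrite mulrBr hcoefD hcoefN (gz a) // (gz' a') ?subrr //; apply: og_le_trans aa'.
rewrite hmul_lead => [/eqP|h hg].
  by rewrite mulf_eq0 => /orP[] /eqP.
by apply: contrapT => /gmin; rewrite og_leNgt hg.
Qed.

Let zfun g : K :=
  if pselect (exists z, good z /\ z g <> 0) is left e then sval (cid e) g else 0.

Let zfunP z a : good z -> z a <> 0 -> forall b, b <=g a -> zfun b = z b.
Proof.
move=> gz za b ba; rewrite /zfun; case: pselect => [e|no].
  by case: (cid e) => z' [gz' z'b] /=; apply: (good_agree gz' gz z'b za ba); exact: og_lexx.
by apply: contrapT => zb; apply: no; exists z; split=> // e; apply: zb; rewrite e.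
Qed.

Let zfunN0 g : zfun g <> 0 -> exists2 z, good z & z g <> 0.
Proof. by rewrite /zfun; case: pselect => // -[z [gz zg]] _; exists z. Qed.

Let zfun_wo : well_ordered (supp zfun).
Proof.
move=> B BZ [b Bb]; have [z gz zb] := zfunN0 (BZ _ Bb).
have [||g [Bg /= gb] gmin] := hahn_wo z (B `&` [set a | a <=g b]).
- by move=> a [/BZ Ba /= ab] /=; rewrite -(zfunP gz zb ab); exact: Ba.
- by exists b; split=> /=; last exact: og_lexx.
exists g => // a Ba; have [ab|ba] := boolP (a <=g b); first by apply: gmin.
by apply: og_le_trans gb (og_ltW ba).
Qed.

Lemma hmul_inv_subproof : exists z, x * z = 1.
Proof.
pose Z := Hahn zfun_wo; have ZE g : Z g = zfun g by [].
have gZ : good Z.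
  move=> a; rewrite ZE => /zfunN0[z gz za] b ba.
  rewrite -(gz _ za _ ba); apply/eqP; rewrite -subr_eq0 -hcoefN -hcoefD -mulrBr.
  have w0 h : h <=g a -> (Z - z) h = 0.
    by move=> ha; rewrite hcoefD hcoefN ZE (zfunP gz za ha) subrr.
  rewrite hmul_lead => [|h hb]; first by rewrite w0 ?mulr0.
  by rewrite w0 //; apply: og_le_trans (og_ltW hb) ba.
exists Z; apply/eqP; apply: contrapT => /negP; rewrite -subr_eq0 => e0.
have [g' eg' g'min] := hahn_min e0; pose g := g' - m.
have mg : m + g = g' by rewrite /g addrC subrK.
pose c := (x m)^-1 * - ((x * Z - 1) g').
have c0 : c <> 0.
  move=> /eqP; rewrite mulf_eq0 invr_eq0 oppr_eq0 => /orP[] /eqP //.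
have Zlt a : Z a <> 0 -> a <g g.
  move=> Za; rewrite og_ltNge; apply/negP => ga; apply: eg'.
  by rewrite hcoefD hcoefN -mg (gZ _ Za _ ga) subrr.
have Zg : Z g = 0 by apply: contrapT => /Zlt; rewrite og_ltxx.
pose s := hsingle g c.
have sg : s g = c by rewrite /= eqxx.
have s0 h : h <g g -> s h = 0 by move=> hg; rewrite /= og_lt_eqF.
have gZs : good (Z + s).
  move=> a Zsa b ba.
  have ag : a <=g g.
    have [Za|Za] := pselect (Z a <> 0); first by apply/og_ltW/Zlt.
    rewrite og_leNgt; apply/negP => ga; apply: Zsa.
    by rewrite hcoefD (contrapT Za) add0r /= og_gt_eqF.
  have := og_le_trans _ _ _ ba ag; rewrite og_le_eqVlt => /orP[/eqP ->|bg].
    rewrite mulrDr hcoefD (hmul_lead s0) sg mulrA divff; last by apply/eqP.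
    by rewrite mul1r -mg !hcoefD !hcoefN opprD opprK addrA subrr add0r.
  rewrite mulrDr hcoefD (@hmul_lead s b) => [|h hb]; last by apply: s0; apply: og_lt_trans bg.
  rewrite (s0 _ bg) mulr0 addr0; apply/eqP; rewrite -subr_eq0 -hcoefN -hcoefD.
  apply/eqP; apply: contrapT => /g'min; rewrite -mg og_leD2lE og_leNgt.
  by rewrite bg.
have Zsg : (Z + s) g <> 0 by rewrite hcoefD Zg add0r sg.
by case: (Zsg); rewrite -(zfunP gZs Zsg (og_lexx _)) -ZE.
Qed.

End Inverse.

Lemma hahn_inv_ex x : exists z, (x != 0 -> z * x = 1) /\ (x = 0 -> z = 0).
Proof.
have [->|x0] := eqVneq x 0; first by exists 0.
have [m xm m_min] := hahn_min x0; have [z xz] := hmul_inv_subproof xm m_min.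
by exists z; split=> [_|e]; [rewrite mulrC | rewrite e eqxx in x0].
Qed.

Definition hinv x : hahn := sval (cid (hahn_inv_ex x)).

Lemma hmulV x : x != 0 -> hinv x * x = 1.
Proof. by rewrite /hinv; case: cid => z []. Qed.

Lemma hinv0 : hinv 0 = 0.
Proof. by rewrite /hinv; case: cid => z [_ z0] /=; exact: z0. Qed.

HB.instance Definition _ := GRing.ComNzRing_isField.Build hahn hmulV hinv0.

Definition hconst : K -> hahn := hsingle 0.

Lemma hconst_is_additive : zmod_morphism hconst.
Proof.
move=> c d; apply: hahnP => g; rewrite hcoefD hcoefN /=.
by case: eqP; rewrite ?subr0.
Qed.

Lemma hconst_is_multiplicative : monoid_morphism hconst.
Proof.
split=> // c d; apply: hahnP => g; rewrite [RHS]hsingle0_mul /=.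
by case: eqP; rewrite ?mulr0.
Qed.

HB.instance Definition _ :=
  GRing.isZmodMorphism.Build K hahn hconst hconst_is_additive.
HB.instance Definition _ :=
  GRing.isMonoidMorphism.Build K hahn hconst hconst_is_multiplicative.

End Hahn.

Arguments hahn_wo {K G} x : rename.
Arguments hsingle {K G} g c.
Arguments hconst : clear implicits.

Definition EC_in_power_series_fields (K : fieldType) : Prop :=
  forall G : orderedGroupType, existentially_closed (hconst K G).

Definition EC_if_rational_place (K : fieldType) : Prop :=
  forall (L : fieldType) (iota : {rmorphism K -> L}),
    (exists P : place L, rational_place iota P) -> existentially_closed iota.

(* Main.v *)
Require Import Defs.
From HB Require Import structures.
From mathcomp Require Import all_boot all_order all_algebra.
From mathcomp Require Import mpoly ring.
From mathcomp Require Import finmap boolp classical_sets functions cardinality.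
From mathcomp Require Import fsbigop.

(** Write 1), 2), 3) for largeness, for existential closedness in power series fields,
    and for existential closedness in extensions with a rational place. The
    implications are proved in a circle: local uniformization and 1) give (RP=EC),
    which gives 3), which gives 2), which gives 1).

    From (RP=EC) to 3): an existential sentence true in [L] is true in the subfield
    generated by its witnesses. The place restricts to it, and elements that are
    algebraic over [K] are in [K], because the place is injective on them. From 3) to
    2): the map to the coefficient of exponent [0] is a rational place of [K((G))].

    The geometric steps rest on formal arcs ([formal_arc]). Let [a] be a rational point
    of an affine variety with function field [F] and generic point [x], and let [d] be
    the transcendence degree of [F]. Suppose that [n - d] equations of the variety have
    at [a] a Jacobian matrix of rank [n - d]. The equations and the choice of a
    direction [c] in [K^d] determine a point of [K[[s]]^n] specializing to [a]
    ([implicit_function]). It has to be shown that it satisfies all relations of [x],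
    and that for a suitable [c] a given function [g] does not vanish on it. This is
    done for a generic direction first. A polynomial vanishing on the generic arc is,
    to all orders, in the ideal of the given equations ([taylor_coordinates]), and so it
    vanishes at [x] by Krull's theorem ([krull_intersection]). Conversely the ideal of
    [x] cannot be larger than that of the arc: the transcendence degree would drop
    ([specialization]), while that of the arc is at most [d] ([jacobian_criterion]).
    Taylor expansions do not depend on the direction, which carries these facts over to
    all directions outside a hypersurface, and [K] is infinite.

    From 2) to 1): on a smooth curve with a rational point, an arc avoids any finite set
    of rational points, and existential closedness in [K((s))] gives one more rational
    point ([EC_series_large]).

    From 1) to (RP=EC): let the place be centered at a regular rational point of
    dimension [d]. The [d] generators of its maximal ideal give [n - d] equations
    with independent gradients ([regular_equations]), and a chain of [d] strict
    inclusions of primes shows that [F] has transcendence degree at least [d]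
    ([localization_chain_independent]). So there are arcs through the center on which
    a given function does not vanish. Such an arc traces a curve that is nonsingular at
    the center, and largeness of [K] gives rational points of this curve outside the
    zeros of the function ([large_arc]). *)

Set Implicit Arguments.
Unset Strict Implicit.
Unset Printing Implicit Defensive.

Import Order.TTheory GRing.Theory Num.Theory.

Local Open Scope classical_set_scope.
Local Open Scope ring_scope.

(** * Evaluation of polynomials *)

(** Polynomials are generated as a ring by constants and variables, so ring
    morphisms and derivations are determined there. *)
Lemma mpoly_gen_ind (R : comNzRingType) n (P : {mpoly R[n]} -> Prop) :
  (forall c, P c%:MP) -> (forall i, P 'X_i) ->
  (forall p q, P p -> P q -> P (p + q)) ->
  (forall p q, P p -> P q -> P (p * q)) -> forall p, P p.
Proof.
move=> PC PX PD PM; elim/mpolyind => [|c m p _ _ Pp]; first exact: PC.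
apply: PD => //; rewrite -mul_mpolyC; apply: (PM) => //.
rewrite mpolyXE_id; elim/big_rec: _ => [|i q _ Pq]; first exact: PC.
by apply: (PM) => //; elim: (m i) => [|k IHk]; [exact: PC | rewrite exprS; apply: (PM)].
Qed.

Lemma mmap_XU (K S : nzRingType) (j : {rmorphism K -> S}) n
  (y : 'I_n -> S) i : mmap j y 'X_i = y i.
Proof. by rewrite mmapX mmap1U. Qed.

Lemma mmap_morph (K S T : comNzRingType) (j : {rmorphism K -> S})
    (j' : {rmorphism K -> T}) (h : {rmorphism S -> T}) n (y : 'I_n -> S) p :
  (forall c, h (j c) = j' c) -> h (mmap j y p) = mmap j' (h \o y) p.
Proof.
move=> hj; elim/mpoly_gen_ind: p => [c|i|p q IHp IHq|p q IHp IHq].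
- by rewrite !mmapC hj.
- by rewrite !mmap_XU.
- by rewrite !rmorphD /= IHp IHq.
- by rewrite !rmorphM /= IHp IHq.
Qed.

Lemma mmap_comp (K S : comNzRingType) (j : {rmorphism K -> S}) n k
    (y : 'I_n -> S) (z : 'I_k -> {mpoly K[n]}) p :
  mmap j y (mmap (mpolyC n (R := K)) z p) = mmap j (fun i => mmap j y (z i)) p.
Proof. by apply: (mmap_morph (h := mmap j y)) => c; rewrite /= mmapC. Qed.

Lemma mmap_meval (K S : comNzRingType) (j : {rmorphism K -> S}) n (a : 'I_n -> K) p :
  mmap j (fun i => j (a i)) p = j p.@[a].
Proof. by rewrite /meval (mmap_morph (j' := j) (h := j)). Qed.

Lemma mmap_ext (K S : nzRingType) (j : {rmorphism K -> S}) n (y z : 'I_n -> S) p :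
  y =1 z -> mmap j y p = mmap j z p.
Proof. by move/funext => ->. Qed.

Lemma exists_min (T : Type) (size : T -> nat) (P : T -> Prop) : (exists t, P t) ->
  exists t, P t /\ forall u, P u -> (size t <= size u)%N.
Proof.
move=> [t0 Pt0]; have ex : exists m, `[< exists2 t, P t & size t = m >].
  by exists (size t0); apply/asboolP; exists t0.
case: (ex_minnP ex) => m /asboolP[t Pt <-] mmin; exists t; split=> // u Pu.
by apply: mmin; apply/asboolP; exists u.
Qed.

Lemma roots_in_seq (K : fieldType) (p : {poly K}) : p != 0 ->
  exists s : seq K, forall z, root p z -> z \in s.
Proof.
elim: {p}(size p) {-2}p (leqnn (size p)) => [|k IHk] p.
  by rewrite leqn0 size_poly_eq0 => ->.
move=> pk p0; have [[z pz]|no] := pselect (exists z, root p z); last first.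
  by exists [::] => z pz; case: no; exists z.
have /factor_theorem[q pE] := pz.
have q0 : q != 0 by apply: contraNneq p0 => q0; rewrite pE q0 mul0r.
have [|s sP] := IHk q _ q0.
  by move: pk; rewrite pE size_Mmonic ?monicXsubC // size_XsubC addn2.
exists (z :: s) => t; rewrite pE rootM root_XsubC inE => /orP[/sP ->|->] //.
by rewrite orbT.
Qed.

(** * First-order expansions in a filtered ring *)

(** Abstracts the powers of the maximal ideal of a rational point, and the orders of
    vanishing of power series. *)
Record filtration (K S : comNzRingType) (j : {rmorphism K -> S})
    (V : nat -> set S) : Prop := Filtration {
  filt0 : forall k, V k 0;
  filtD : forall k x y, V k x -> V k y -> V k (x + y);
  filtM : forall k l x y, V k x -> V l y -> V (k + l)%N (x * y);
  filtC : forall c, V 0 (j c);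
  filtS : forall k x, V k.+1 x -> V k x
}.

Section Filtration.
Variables (K S : comNzRingType) (j : {rmorphism K -> S}) (V : nat -> set S).
Hypothesis FV : filtration j V.

Lemma filtMl k x y : V 0 x -> V k y -> V k (x * y).
Proof. by move=> Vx Vy; have := filtM FV Vx Vy. Qed.

Lemma filtMr k x y : V k x -> V 0 y -> V k (x * y).
Proof. by rewrite mulrC => Vx Vy; apply: filtMl. Qed.

Lemma filtN k x : V k x -> V k (- x).
Proof.
by move=> Vx; rewrite -mulN1r -(rmorph1 j) -rmorphN; apply: filtMl (filtC FV _) Vx.
Qed.

Lemma filt_le k l x : (k <= l)%N -> V l x -> V k x.
Proof. by move=> /subnK <-; elim: (l - k)%N => // d IHd; rewrite addSn => /(filtS FV). Qed.

Lemma filt_sum k (I : Type) (r : seq I) (P : pred I) (E : I -> S) :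
  (forall i, P i -> V k (E i)) -> V k (\sum_(i <- r | P i) E i).
Proof. by apply: big_ind; [exact: (filt0 FV) | exact: (filtD FV)]. Qed.

Variables (n : nat) (a : 'I_n -> K).

Lemma filt_meval y p : (forall i, V 1 (y i - j (a i))) ->
  V 1 (mmap j y p - j p.@[a]).
Proof.
move=> Vy; elim/mpoly_gen_ind: p => [c|i|p q IHp IHq|p q IHp IHq].
- by rewrite mmapC mevalC subrr; exact: (filt0 FV).
- by rewrite mmap_XU mevalXU.
- by rewrite mevalD !rmorphD /= opprD addrACA; apply: (filtD FV).
rewrite mevalM !rmorphM /=.
have -> : mmap j y p * mmap j y q - j p.@[a] * j q.@[a] =
  (mmap j y p - j p.@[a]) * (mmap j y q - j q.@[a]) +
  ((mmap j y p - j p.@[a]) * j q.@[a] + j p.@[a] * (mmap j y q - j q.@[a])) by ring.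
apply: (filtD FV) => //; first exact: (filtS FV (filtM FV IHp IHq)).
by apply: (filtD FV) => //; [apply: filtMr | apply: filtMl] => //; apply: (filtC FV).
Qed.

Lemma filt_mmap y p : (forall i, V 1 (y i - j (a i))) -> V 0 (mmap j y p).
Proof.
move=> /(filt_meval p) /(filtS FV) Vp.
by rewrite -[mmap _ _ _](subrK (j p.@[a])); apply: (filtD FV) => //; apply: (filtC FV).
Qed.

(** The linear part of [p] at [a] controls the variation of [p] between two
    points that are both infinitely close to [a], and not only the variation
    from [a] itself; this is what makes the iteration below converge. *)
Lemma filt_taylor N y z p :
  (forall i, V 1 (y i - j (a i))) -> (forall i, V 1 (z i - j (a i))) ->
  (forall i, V N (z i - y i)) ->
  V N.+1 (mmap j z p - mmap j y p - \sum_i j (p^`M(i)).@[a] * (z i - y i)).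
Proof.
move=> Vy Vz Vyz; elim/mpoly_gen_ind: p => [c|i|p q IHp IHq|p q IHp IHq].
- rewrite !mmapC subrr big1 ?subrr ?filt0 //; first exact: (filt0 FV).
  by move=> i _; rewrite mderivC meval0 rmorph0 mul0r.
- rewrite !mmap_XU (bigD1 i) //= mderivX mnm1E eqxx.
  have -> : (U_(i) - U_(i))%MM = 0%MM by apply/mnmP => k; rewrite mnmBE subnn mnm0E.
  rewrite mpolyX0 scale1r meval1 rmorph1 mul1r big1 ?addr0 ?subrr; first exact: (filt0 FV).
  move=> k ki; rewrite mderivX mnm1E eq_sym (negbTE ki) scale0r meval0.
  by rewrite rmorph0 mul0r.
- set s := \sum_i _; have -> : s = \sum_i j (p^`M(i)).@[a] * (z i - y i) +
      \sum_i j (q^`M(i)).@[a] * (z i - y i).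
    rewrite -big_split; apply: eq_bigr => i _ /=.
    by rewrite mderivD mevalD rmorphD mulrDl.
  rewrite !rmorphD /=; set dp := \sum_i _; set dq := \sum_i _.
  have -> : forall u v w x : S, u + v - (w + x) - (dp + dq) = u - w - dp + (v - x - dq).
    by move=> *; ring.
  exact: (filtD FV).
- set s := \sum_i _; have -> : s = (\sum_i j (p^`M(i)).@[a] * (z i - y i)) * j q.@[a] +
      j p.@[a] * \sum_i j (q^`M(i)).@[a] * (z i - y i).
    rewrite mulr_suml mulr_sumr -big_split; apply: eq_bigr => i _ /=.
    by rewrite mderivM mevalD !mevalM rmorphD !rmorphM /=; ring.
  move: IHp IHq; rewrite !rmorphM /=; set dp := \sum_i _; set dq := \sum_i _.
  move=> IHp IHq.
  have Vdp : V N dp by apply: filt_sum => i _; apply: filtMl => //; apply: (filtC FV).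
  have Vdq : V N dq by apply: filt_sum => i _; apply: filtMl => //; apply: (filtC FV).
  have -> : mmap j z p * mmap j z q - mmap j y p * mmap j y q -
       (dp * j q.@[a] + j p.@[a] * dq) =
     (mmap j z p - j p.@[a]) * dq + mmap j z p * (mmap j z q - mmap j y q - dq) +
     (dp * (mmap j y q - j q.@[a]) + (mmap j z p - mmap j y p - dp) * mmap j y q).
    by ring.
  apply: (filtD FV) => //; apply: (filtD FV) => //.
  + by apply: (filtM FV (k := 1) (l := N)) => //; apply: filt_meval.
  + by apply: filtMl => //; apply: filt_mmap.
  + by rewrite mulrC; apply: (filtM FV (k := 1) (l := N)) => //; apply: filt_meval.
  + by apply: filtMr => //; apply: filt_mmap.
Qed.

End Filtration.

(** * Formal power series and the implicit function theorem *)

(** Series with exponents in the ordered group [int] are the Laurent series. *)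
Definition int_le (x y : int) : bool := x <= y.

Lemma int_le_refl : reflexive int_le. Proof. exact: lexx. Qed.
Lemma int_le_anti : antisymmetric int_le. Proof. exact: le_anti. Qed.
Lemma int_le_trans : transitive int_le. Proof. exact: le_trans. Qed.
Lemma int_le_total : total int_le. Proof. exact: le_total. Qed.
Lemma int_leD2r (z x y : int) : int_le x y -> int_le (x + z) (y + z).
Proof. by rewrite /int_le lerD2r. Qed.

HB.instance Definition _ := Zmodule_isOrderedGroup.Build int
  int_le_refl int_le_anti int_le_trans int_le_total int_leD2r.

Section Laurent.
Variable K : fieldType.

Local Notation laurent := (hahn K int).

Definition ser_ge (k : nat) : set laurent := [set z | forall g : int, g < k%:Z -> z g = 0].

Lemma laurent_mul0 (x y : laurent) (g : int) :
  (forall a : int, x a = 0 \/ y (g - a) = 0) -> (x * y) g = 0.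
Proof.
move=> xy0; rewrite [LHS]hmulE; apply: fsbig1 => a _.
by case: (xy0 a) => ->; rewrite ?mul0r ?mulr0.
Qed.

Lemma ser_ge_filtration : filtration (hconst K int) ser_ge.
Proof.
split.
- by move=> k g _; rewrite hcoef0.
- by move=> k x y Vx Vy g gk; rewrite hcoefD Vx ?Vy ?addr0 //.
- move=> k l x y Vx Vy g; rewrite PoszD => gkl; apply: laurent_mul0 => a.
  have [ak|ka] := ltP a k%:Z; first by left; apply: Vx.
  right; apply: Vy; rewrite ltrBlDr addrC.
  by apply: (lt_le_trans gkl); rewrite lerD2r.
- by move=> c g g0 /=; case: eqP => // e; move: g0; rewrite e ltxx.
- by move=> k x Vx g gk; apply: Vx; apply: (lt_trans gk); rewrite ltz_nat.
Qed.

Lemma series_subproof (c : nat -> K) :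
  well_ordered [set g : int | (if g is Posz n then c n else 0) <> 0].
Proof.
move=> B BP [b Bb].
have Bnat g : B g -> exists n, g = Posz n by case: g => [n|n] /BP //; exists n.
have exB : exists n : nat, `[< B (Posz n) >].
  by have [n bn] := Bnat _ Bb; exists n; apply/asboolP; rewrite -bn.
case: (ex_minnP exB) => m /asboolP Bm mmin; exists (Posz m) => // g Bg.
have [n gn] := Bnat _ Bg; rewrite gn in Bg *; rewrite /og_le /= /int_le lez_nat.
by apply: mmin; apply/asboolP.
Qed.

Definition series (c : nat -> K) : laurent := Hahn (@series_subproof c).

Lemma ser_eq0 (z : laurent) : (forall k, ser_ge k z) -> z = 0.
Proof.
move=> Vz; apply: hahnP => g; rewrite hcoef0; apply: (Vz `|g|.+1%N).
by case: g => [g|g] //; rewrite ltz_nat absz_nat.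
Qed.

Definition svar : laurent := hsingle (1 : int) 1.

Lemma svar_ge : ser_ge 1 svar.
Proof. by move=> g g1 /=; case: eqP => // e; move: g1; rewrite e ltxx. Qed.

Lemma ser_limit (z : nat -> laurent) : (forall N, ser_ge 0 (z N)) ->
  (forall N, ser_ge N.+1 (z N.+1 - z N)) ->
  exists x, forall N, ser_ge N.+1 (x - z N).
Proof.
move=> z0 zN.
have zM M N : (M <= N)%N -> ser_ge M.+1 (z N - z M).
  move=> /subnK <-; elim: (N - M)%N => [|d IHd].
    by rewrite subrr => g _; rewrite hcoef0.
  rewrite addSn -[z _](subrK (z (d + M)%N)) -addrA.
  apply: (filtD ser_ge_filtration) => //.
  by apply: (filt_le ser_ge_filtration) (zN _); rewrite ltnS leq_addl.
exists (series (fun n => z n (Posz n))) => N [g|g] gN; rewrite hcoefD hcoefN; last first.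
  by rewrite (z0 N) // subrr.
rewrite /=; have gN' : (g <= N)%N by move: gN; rewrite ltz_nat ltnS.
have := zM _ _ gN' (Posz g); rewrite ltz_nat ltnSn hcoefD hcoefN => /(_ isT) e.
by rewrite -opprB e oppr0.
Qed.

End Laurent.

Arguments ser_ge {K} k _.
Arguments svar {K}.

Section ImplicitFunctions.
Variables (K L : fieldType) (j : {rmorphism K -> L}) (n : nat).

Definition lconst : {rmorphism K -> hahn L int} := (hconst L int : {rmorphism L -> hahn L int}) \o j.

Lemma ser_ge_filtrationK : filtration lconst (@ser_ge L).
Proof.
by have [V0 VD VM VC VS] := ser_ge_filtration L; split=> // c; apply: VC.
Qed.

Definition jacobian_at m (h : 'I_m -> {mpoly K[n]}) (a : 'I_n -> K) : 'M[K]_(m, n) :=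
  \matrix_(k, l) ((h k)^`M(l)).@[a].

Variables (h : 'I_n -> {mpoly K[n]}) (a : 'I_n -> K).
Hypotheses (ha : forall i, (h i).@[a] = 0) (Ja : jacobian_at h a \in unitmx).

(** Newton iteration with the Jacobian matrix frozen at [a]. Its inverse is only
    right to first order, so that each step gains one order instead of doubling
    it, but this makes the iteration linear and is enough for convergence. *)
Lemma implicit_function (b : 'I_n -> hahn L int) : (forall i, ser_ge 1 (b i)) ->
  exists x : 'I_n -> hahn L int,
    (forall i, ser_ge 1 (x i - lconst (a i))) /\ (forall i, mmap lconst x (h i) = b i).
Proof.
move=> Vb; have FV := ser_ge_filtrationK.
pose J := invmx (jacobian_at h a).
pose err (x : 'I_n -> hahn L int) i := mmap lconst x (h i) - b i.
pose next (x : 'I_n -> hahn L int) i := x i - \sum_l lconst (J i l) * err x l.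
pose x N := iter N next (fun i => lconst (a i)).
have main N : (forall i, ser_ge 1 (x N i - lconst (a i))) /\
              (forall i, ser_ge N.+1 (err (x N) i)).
  elim: N => [|N [IHx IHe]].
    split=> i; first by rewrite subrr; apply: (filt0 FV).
    by rewrite /err /x /= mmap_meval ha rmorph0 sub0r; apply: (filtN FV).
  have Vd i : ser_ge N.+1 (x N.+1 i - x N i).
    rewrite /x /= -/(x N) /next addrC addKr; apply: (filtN FV).
    apply: (filt_sum FV) => l _; apply: (filtMl FV) => //; exact: (filtC FV).
  have Vx i : ser_ge 1 (x N.+1 i - lconst (a i)).
    rewrite -[x N.+1 i](subrK (x N i)) -addrA; apply: (filtD FV) => //.
    by apply: (filt_le FV) (Vd i).
  split=> // i; have := filt_taylor FV (h i) IHx Vx Vd.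
  suff -> : err (x N.+1) i = mmap lconst (x N.+1) (h i) - mmap lconst (x N) (h i) -
      \sum_l lconst (((h i)^`M(l)).@[a]) * (x N.+1 l - x N l) by [].
  have -> : \sum_l lconst (((h i)^`M(l)).@[a]) * (x N.+1 l - x N l) = - err (x N) i.
    transitivity (- \sum_l \sum_k lconst (jacobian_at h a i l * J l k) * err (x N) k).
      rewrite -sumrN; apply: eq_bigr => l _.
      rewrite /x /= -/(x N) /next [_ - \sum_l _]addrC addrK mulrN mulr_sumr; congr (- _).
      by apply: eq_bigr => k _; rewrite mxE !rmorphM mulrA.
    rewrite exchange_big /=; congr (- _).
    under eq_bigr => k _ do rewrite -mulr_suml -(rmorph_sum lconst).
    rewrite (bigD1 i) //= [X in _ + X]big1 ?addr0 => [|k ki].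
      have := congr1 (fun A : 'M_n => A i i) (mulmxV Ja); rewrite !mxE eqxx => ->.
      by rewrite rmorph1 mul1r.
    have := congr1 (fun A : 'M_n => A i k) (mulmxV Ja); rewrite !mxE eq_sym (negbTE ki) => ->.
    by rewrite rmorph0 mul0r.
  by rewrite /err; ring.
have Vstep N i : ser_ge N.+1 (x N.+1 i - x N i).
  rewrite /x /= -/(x N) /next addrC addKr; apply: (filtN FV).
  by apply: (filt_sum FV) => l _; apply: (filtMl FV); [exact: (filtC FV) | case: (main N)].
have Vx0 N i : ser_ge 0 (x N i).
  rewrite -[x N i](subrK (lconst (a i))); apply: (filtD FV); last exact: (filtC FV).
  by apply: (filtS FV); case: (main N).
have lim i : exists y, forall N, ser_ge N.+1 (y - x N i).
  by apply: (ser_limit (z := fun N => x N i)) => N; [exact: Vx0 | exact: Vstep].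
pose y i := sval (cid (lim i)).
have yP i N : ser_ge N.+1 (y i - x N i) by rewrite /y; case: cid.
have Vy i : ser_ge 1 (y i - lconst (a i)) by exact: (yP i 0%N).
exists y; split=> // i; apply/eqP; rewrite -subr_eq0; apply/eqP/ser_eq0 => N.
apply: (filtS FV); rewrite -[mmap _ _ _](subrK (mmap lconst (x N) (h i))) -addrA.
apply: (filtD FV); last exact: (main N).2.
have [Vx _] := main N.
rewrite -[_ - _](subrK (\sum_l lconst ((h i)^`M(l)).@[a] * (y l - x N l))).
apply: (filtD FV); last first.
  by apply: (filt_sum FV) => l _; apply: (filtMl FV); [exact: (filtC FV) | exact: yP].
by apply: (filtS FV); apply: (filt_taylor FV).
Qed.

End ImplicitFunctions.

(** * Noetherianity and the Krull intersection theorem *)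

(** Choose successively the place of a minimal value among the remaining terms. *)
Lemma nondecreasing_subseq (u : nat -> nat) :
  exists s : nat -> nat, forall i, (s i < s i.+1)%N /\ (u (s i) <= u (s i.+1))%N.
Proof.
have next m : exists k, (m <= k)%N /\ forall l, (m <= l)%N -> (u k <= u l)%N.
  have ex : exists v, `[< exists2 k, (m <= k)%N & u k = v >].
    by exists (u m); apply/asboolP; exists m.
  case: (ex_minnP ex) => v /asboolP[k mk <-] vmin; exists k; split=> // l ml.
  by apply: vmin; apply/asboolP; exists l.
pose f m := sval (cid (next m)).
have fP m : (m <= f m)%N /\ forall l, (m <= l)%N -> (u (f m) <= u l)%N.
  by rewrite /f; case: cid.
pose s := fix s i := if i is i'.+1 then f (s i').+1 else f 0%N.
have s_lt i : (s i < s i.+1)%N by case: (fP (s i).+1).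
exists s => i; split=> //; case: i (s_lt i) => [|i] lti /=.
  by apply: (fP 0%N).2.
by apply: (fP _).2; apply: leq_trans (ltnW lti); case: (fP (s i).+1).
Qed.

(** Passing to nondecreasing subsequences of one coordinate after the other leaves a
    sequence any two terms of which are comparable. *)
Lemma dickson n (w : nat -> 'X_{1..n}) : exists i k, (i < k)%N /\ (w i <= w k)%MM.
Proof.
suff /(_ n (leqnn n))[s sP] : forall m, (m <= n)%N -> exists s : nat -> nat,
    forall i, (s i < s i.+1)%N /\
      (forall c : 'I_n, (c < m)%N -> (w (s i) c <= w (s i.+1) c)%N).
  exists (s 0%N), (s 1%N); have [? wP] := sP 0%N; split=> //.
  by apply/mnm_lepP => c; apply: wP.
elim=> [|k IHk] kn; first by exists id.
have [s sP] := IHk (ltnW kn); pose c0 := Ordinal kn.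
have [t tP] := nondecreasing_subseq (fun i => w (s i) c0).
have s_mono i l : (i <= l)%N -> (s i <= s l)%N /\
    forall c : 'I_n, (c < k)%N -> (w (s i) c <= w (s l) c)%N.
  move=> /subnK <-; elim: (l - i)%N => [|m [IHm1 IHm2]] //; rewrite addSn.
  have [s1 s2] := sP (m + i)%N; split; first exact: leq_trans (ltnW s1).
  by move=> c ck; apply: leq_trans (s2 _ ck); apply: IHm2.
exists (s \o t) => i; have [t1 t2] := tP i; split=> [|c].
  by apply: leq_trans (s_mono _ _ t1).1; case: (sP (t i)).
rewrite ltnS leq_eqVlt => /orP[/eqP ck|ck]; last exact: (s_mono _ _ (ltnW t1)).2.
by have -> : c = c0 by exact: val_inj.
Qed.

Definition ideal_span (R : comNzRingType) N (P : nat -> R) : set R :=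
  [set f | exists c : nat -> R, f = \sum_(i < N) c i * P i].

Record is_ideal (R : comNzRingType) (I : set R) : Prop := IsIdeal {
  ideal0 : I 0;
  idealD : forall x y, I x -> I y -> I (x + y);
  idealM : forall x y, I y -> I (x * y)
}.

Section Ideals.
Variables (R : comNzRingType) (I : set R).
Hypothesis idI : is_ideal I.

Lemma idealN x : I x -> I (- x).
Proof. by rewrite -mulN1r; apply: (idealM idI). Qed.

Lemma idealB x y : I x -> I y -> I (x - y).
Proof. by move=> Ix /idealN; apply: (idealD idI). Qed.

Lemma ideal_sum (T : Type) (r : seq T) (P : pred T) (E : T -> R) :
  (forall i, P i -> I (E i)) -> I (\sum_(i <- r | P i) E i).
Proof. by apply: big_ind; [exact: (ideal0 idI) | exact: (idealD idI)]. Qed.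

End Ideals.

(** Leading monomials: if no finite family generates [I], choosing repeatedly
    an element of [I] of least leading monomial outside the ideal of the
    previous ones contradicts Dickson's lemma. *)
Theorem hilbert_basis (K : fieldType) n (I : set {mpoly K[n]}) : is_ideal I ->
  exists N P, (forall i, I (P i)) /\ I `<=` ideal_span N P.
Proof.
move=> idI; apply: contrapT => nofin.
pose gen (s : seq {mpoly K[n]}) := ideal_span (size s) (fun i => s`_i).
have next (s : seq {mpoly K[n]}) : (forall i, I s`_i) ->
    exists f, [/\ I f, ~ gen s f &
      forall g, I g -> ~ gen s g -> ~ (mlead g < mlead f)%O].
  move=> Is; apply: contrapT => nomin; apply: nofin.
  exists (size s), (fun i => s`_i); split=> // f.
  move: {2}(mlead f) (erefl (mlead f)) => m; elim/(@ltmwf n): m f => m IHm f fm If.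
  apply: contrapT => nf; apply: nomin; exists f; split=> // g Ig ng; rewrite fm => gm.
  by apply: ng; apply: (IHm (mlead g)) Ig.
pose nxt s := if pselect (forall i, I s`_i) is left e then sval (cid (next s e)) else 0.
have nxtP (s : seq {mpoly K[n]}) : (forall i, I s`_i) -> [/\ I (nxt s), ~ gen s (nxt s) &
    forall g, I g -> ~ gen s g -> ~ (mlead g < mlead (nxt s))%O].
  by move=> Is; rewrite /nxt; case: pselect => // e; case: cid.
pose s := fix s N := if N is N'.+1 then rcons (s N') (nxt (s N')) else [::].
have sz N : size (s N) = N by elim: N => //= N IHN; rewrite size_rcons IHN.
have Is N i : I (s N)`_i.
  elim: N i => [|N IHN] i /=; first by rewrite nth_nil; exact: (ideal0 idI).
  rewrite nth_rcons; case: ifP => // _; case: ifP => _; last exact: (ideal0 idI).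
  by have [] := nxtP (s N) IHN.
have sE k N : (k < N)%N -> (s N)`_k = nxt (s k).
  elim: N => // N IHN; rewrite ltnS leq_eqVlt /= nth_rcons sz => /orP[/eqP ->|kN].
    by rewrite ltnn eqxx.
  by rewrite kN IHN.
have [i [k [ik wik]]] := dickson (fun N => mlead (nxt (s N))).
have [Ii ni _] := nxtP (s i) (Is i); have [Ik nk kmin] := nxtP (s k) (Is k).
set f := nxt (s i) in wik Ii ni *; set g := nxt (s k) in wik Ik nk kmin *.
have f0 : f != 0.
  by apply/eqP => f0; apply: ni; rewrite f0; exists (fun=> 0); rewrite big1 // => l _; rewrite mul0r.
have g0 : g != 0.
  by apply/eqP => g0; apply: nk; rewrite g0; exists (fun=> 0); rewrite big1 // => l _; rewrite mul0r.
pose q : {mpoly K[n]} := (mleadc g / mleadc f) *: 'X_[mlead g - mlead f].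
have lf0 : mleadc f != 0 by rewrite mleadc_eq0.
have lg0 : mleadc g != 0 by rewrite mleadc_eq0.
have q0 : q != 0 by rewrite mscalerI -mleadc_eq0 mleadXm mcoeffX eqxx oner_eq0 orbF mulf_neq0 ?invr_neq0.
have Ih : I (g - q * f) by apply: (idealB idI) => //; exact: (idealM idI).
have nh : ~ gen (s k) (g - q * f).
  move=> [c e]; apply: nk; exists (fun l => c l + (if l == i then q else 0)).
  rewrite -[LHS](subrK (q * f)) e.
  under [RHS]eq_bigr => l _ do rewrite mulrDl.
  rewrite big_split /=; congr (_ + _).
  have ik' : (i < size (s k))%N by rewrite sz.
  rewrite (bigD1 (Ordinal ik')) //= eqxx sE // big1 ?addr0 // => l li.
  by rewrite -val_eqE /= in li; rewrite (negbTE li) mul0r.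
apply: (kmin _ Ih nh).
have lqf : mlead (q * f) = mlead g.
  rewrite mleadM // mleadZ ?mleadXm ?submK // mulf_neq0 ?invr_neq0 //.
have h0 : g - q * f != 0.
  apply/eqP => e; apply: nh; rewrite e; exists (fun=> 0).
  by rewrite big1 // => l _; rewrite mul0r.
rewrite lt_neqAle; apply/andP; split; last first.
  by apply: le_trans (mleadB_le _ _) _; rewrite lqf joinxx.
apply/eqP => e; have := mleadc_eq0 (g - q * f); rewrite (negbTE h0) e mcoeffB.
suff -> : (q * f)@_(mlead g) = mleadc g by rewrite subrr eqxx.
rewrite -{1}(submK wik) -scalerAl mcoeffZ mulrC [_ * f]mulrC mcoeffMX.
by rewrite mulrC divfK.
Qed.

Corollary noetherian_sequence (K : fieldType) n (P : nat -> {mpoly K[n]}) :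
  exists N, ideal_span N P (P N).
Proof.
pose I := [set f | exists N, ideal_span N P f].
have spanS M N : (M <= N)%N -> ideal_span M P `<=` ideal_span N P.
  move=> MN f [c ->]; exists (fun i => if (i < M)%N then c i else 0).
  rewrite (big_ord_widen _ (fun i => c i * P i) MN) big_mkcond /=.
  by apply: eq_bigr => i _; case: ifP => // _; rewrite mul0r.
have idI : is_ideal I.
  split.
  - by exists 0%N; exists (fun=> 0); rewrite big_ord0.
  - move=> x y [M Ix] [N Iy]; exists (maxn M N).
    have [c ->] := spanS _ _ (leq_maxl M N) _ Ix.
    have [d ->] := spanS _ _ (leq_maxr M N) _ Iy.
    exists (fun i => c i + d i); rewrite -big_split; apply: eq_bigr => i _ /=.
    by rewrite mulrDl.
  - move=> x y [M [c ->]]; exists M; exists (fun i => x * c i).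
    by rewrite mulr_sumr; apply: eq_bigr => i _; rewrite mulrA.
have [M [Q [IQ genQ]]] := hilbert_basis idI.
pose b i := sval (cid (IQ i)); have bP i : ideal_span (b i) P (Q i) by rewrite /b; case: cid.
pose N := (\max_(i < M) b i)%N; exists N.
have IN : I (P N).
  by exists N.+1; exists (fun i => (i == N)%:R); rewrite (bigD1 ord_max) //= eqxx mul1r
    big1 ?addr0 // => i; rewrite -val_eqE /= => /negbTE ->; rewrite mul0r.
have [c ->] := genQ _ IN.
have bN (i : 'I_M) : ideal_span N P (Q i).
  by apply: spanS (bP i); rewrite /N (bigmaxD1 i) ?leq_maxl //; apply: leq_bigmax.
pose e i := if pselect (ideal_span N P (Q i)) is left h then sval (cid h) else fun=> 0.
have eP (i : 'I_M) : Q i = \sum_(k < N) e i k * P k.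
  by rewrite /e; case: pselect => [h|/(_ (bN i))//]; case: cid.
exists (fun k => \sum_(i < M) c i * e i k).
under eq_bigr => i _ do rewrite eP mulr_sumr.
rewrite exchange_big; apply: eq_bigr => k _ /=.
by rewrite mulr_suml; apply: eq_bigr => i _; rewrite mulrA.
Qed.

Section PointIdeal.
Variables (K : fieldType) (n : nat) (a : 'I_n -> K).
Local Notation R := {mpoly K[n]}.

(** The powers of the maximal ideal of the point [a]. *)
Fixpoint point_pow (k : nat) : set R :=
  if k is k'.+1 then
    [set f | exists r : 'I_n -> R, (forall i, point_pow k' (r i)) /\
                                   f = \sum_i r i * ('X_i - (a i)%:MP)]
  else setT.

Lemma point_pow_filtration : filtration (mpolyC n (R := K)) point_pow.
Proof.
split=> //.
- elim=> //= k IHk; exists (fun=> 0); split=> //.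
  by rewrite big1 // => i _; rewrite mul0r.
- elim=> //= k IHk _ _ [r [Vr ->]] [s [Vs ->]].
  exists (fun i => r i + s i); split=> [i|]; first exact: IHk.
  by rewrite -big_split; apply: eq_bigr => i _; rewrite /= mulrDl.
- elim=> [|k IHk] l x y.
    move=> _; elim: l x y => //= l IHl x y [r [Vr ->]].
    exists (fun i => x * r i); split=> [i|]; first exact: IHl.
    by rewrite mulr_sumr; apply: eq_bigr => i _; rewrite mulrA.
  move=> [r [Vr ->]] Vy; exists (fun i => r i * y); split=> [i|]; first exact: (IHk _ _ _ (Vr i) Vy).
  by rewrite mulr_suml; apply: eq_bigr => i _; rewrite mulrAC.
- elim=> //= k IHk _ [r [Vr ->]]; exists r; split=> // i; exact: IHk (Vr i).
Qed.

Arguments point_pow : simpl never.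

Let FV := point_pow_filtration.

Lemma point_pow_X i : point_pow 1 ('X_i - (a i)%:MP).
Proof.
exists (fun k => (k == i)%:R); split=> //; rewrite (bigD1 i) //= eqxx mul1r.
by rewrite big1 ?addr0 // => k /negbTE ->; rewrite mul0r.
Qed.

Lemma point_pow1_eval f : point_pow 1 f -> f.@[a] = 0.
Proof.
move=> [r [_ ->]]; rewrite raddf_sum big1 // => i _ /=.
by rewrite mevalM mevalB mevalXU mevalC subrr mulr0.
Qed.

Lemma mmap_mpolyC_X (f : R) : mmap (mpolyC n (R := K)) (fun i => 'X_i) f = f.
Proof.
elim/mpoly_gen_ind: f => [c|i|p q IHp IHq|p q IHp IHq].
- by rewrite mmapC.
- by rewrite mmap_XU.
- by rewrite rmorphD /= IHp IHq.
- by rewrite rmorphM /= IHp IHq.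
Qed.

(** The Rees algebra of the ideal of [a] is the image of this morphism, hence
   ideals of it are finitely generated. *)
Let rees_gen (i : 'I_(n + n)) : {poly R} :=
  match fintype.split i with
  | inl i => ('X_i)%:P
  | inr i => ('X_i - (a i)%:MP)%:P * 'X
  end.
Let rees : {rmorphism {mpoly K[n + n]} -> {poly R}} :=
  mmap (polyC \o mpolyC n (R := K)) rees_gen.

Let reesE p : rees p = mmap (polyC \o mpolyC n (R := K)) rees_gen p. Proof. by []. Qed.

Let rees_coef p k : point_pow k (rees p)`_k.
Proof.
elim/mpoly_gen_ind: p k => [c|i|p q IHp IHq|p q IHp IHq] k.
- rewrite reesE mmapC coefC; case: eqP => [->|_] //; exact: (filt0 FV).
- rewrite reesE mmap_XU /rees_gen; case: (fintype.split i) => l.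
    rewrite coefC; case: eqP => [->|_] //; exact: (filt0 FV).
  rewrite coefMX coefC; case: eqP => [->|k0] //.
  case: eqP => [k1|_]; last exact: (filt0 FV).
  have -> : k = 1%N by case: k k0 k1 => [|[|k]].
  exact: point_pow_X.
- by rewrite (rmorphD rees) coefD; apply: (filtD FV (IHp _) (IHq _)).
- rewrite (rmorphM rees) coefM; apply: (filt_sum FV) => i _.
  have ik : (i <= k)%N by rewrite -ltnS.
  by have := filtM FV (IHp i) (IHq (k - i)%N); rewrite subnKC.
Qed.

Let rees_surj k m : point_pow k m -> exists p, rees p = m%:P * 'X^k.
Proof.
elim: k m => [|k IHk] m.
  move=> _; exists (mmap (mpolyC _ (R := K)) (fun i => 'X_(lshift n i)) m).
  rewrite expr0 mulr1 reesE mmap_comp -{2}[m]mmap_mpolyC_X.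
  rewrite (mmap_morph (j' := polyC \o mpolyC n (R := K)) (h := polyC)) //.
  apply: mmap_ext => i; rewrite mmap_XU /rees_gen.
  by rewrite -[lshift n i]/(unsplit (inl i)) unsplitK.
move=> [r [Vr ->]]; have ex i := IHk _ (Vr i).
exists (\sum_i sval (cid (ex i)) * 'X_(rshift n i)).
rewrite (rmorph_sum rees) [in RHS]rmorph_sum mulr_suml; apply: eq_bigr => i _.
rewrite (rmorphM rees) (svalP (cid (ex i))) reesE mmap_XU.
rewrite /rees_gen -[rshift n i]/(unsplit (inr i)) unsplitK.
by rewrite rmorphM exprS /=; ring.
Qed.

(** Perdry's argument: in the Rees algebra, the elements [(f - g k) 'X^k] generate
    a finitely generated ideal, and comparing coefficients in a relation
    expressing one of them by the previous ones gives [s]. *)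
Lemma krull_intersection (I : set R) f : is_ideal I ->
  (forall k, exists2 g, I g & point_pow k (f - g)) ->
  exists2 s, s.@[a] = 1 & I (s * f).
Proof.
move=> idI fI; pose g k := sval (cid2 (fI k)).
have gP k : I (g k) /\ point_pow k (f - g k) by rewrite /g; case: cid2.
have exP k : exists p, rees p = (f - g k)%:P * 'X^k by apply: rees_surj; case: (gP k).
pose P k := sval (cid (exP k)); have PE k : rees (P k) = (f - g k)%:P * 'X^k.
  by rewrite /P; case: cid.
have [N [c eqN]] := noetherian_sequence P.
pose m (i : nat) := (rees (c i))`_(N - i).
have eqf : f - g N = \sum_(i < N) m i * (f - g i).
  have := congr1 (fun p => (rees p)`_N) eqN.
  rewrite PE coefMXn ltnn subnn coefC eqxx => ->.
  rewrite (rmorph_sum rees) coef_sum; apply: eq_bigr => i _.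
  by rewrite (rmorphM rees) PE mulrA coefMXn ltnNge ltnW //= coefMC.
exists (1 - \sum_(i < N) m i).
  rewrite mevalB meval1 (point_pow1_eval (f := \sum_(i < N) m i)) ?subr0 //.
  apply: (filt_sum FV) => i _; apply: (filt_le FV (l := N - i)); last exact: rees_coef.
  by rewrite subn_gt0.
have -> : (1 - \sum_(i < N) m i) * f = g N - \sum_(i < N) m i * g i.
  rewrite mulrBl mul1r -[in LHS](subrK (g N) f) {1}eqf mulr_suml.
  under eq_bigr => i _ do rewrite mulrBr.
  by rewrite sumrB subrK; ring.
apply: (idealB idI); first by case: (gP N).
by apply: (ideal_sum idI) => i _; apply: (idealM idI); case: (gP i).
Qed.

End PointIdeal.

Arguments point_pow {K n} a k : simpl never.

(** * Local coordinates at a nonsingular point *)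

Definition stack m d (K : fieldType) n (h : 'I_m -> {mpoly K[n]}) (l : 'I_d -> {mpoly K[n]}) :
    'I_(m + d) -> {mpoly K[n]} :=
  fun i => match fintype.split i with inl k => h k | inr k => l k end.

Lemma stack_l m d (K : fieldType) n (h : 'I_m -> {mpoly K[n]}) (l : 'I_d -> {mpoly K[n]}) k :
  stack h l (lshift d k) = h k.
Proof. by rewrite /stack -[lshift _ _]/(unsplit (inl k)) unsplitK. Qed.

Lemma stack_r m d (K : fieldType) n (h : 'I_m -> {mpoly K[n]}) (l : 'I_d -> {mpoly K[n]}) k :
  stack h l (rshift m k) = l k.
Proof. by rewrite /stack -[rshift _ _]/(unsplit (inr k)) unsplitK. Qed.

Section LocalCoordinates.
Variables (K : fieldType) (m d : nat).
Local Notation n := (m + d)%N.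
Local Notation R := {mpoly K[n]}.
Variables (a : 'I_n -> K) (h : 'I_m -> R) (l : 'I_d -> R).
Hypotheses (ha : forall k, (h k).@[a] = 0) (la : forall k, (l k).@[a] = 0).
Hypothesis Ja : jacobian_at (stack h l) a \in unitmx.

Let FV := point_pow_filtration a.
Let hspan : set R := [set f | exists r : 'I_m -> R, f = \sum_k r k * h k].

Lemma hspan_ideal : is_ideal hspan.
Proof.
split.
- by exists (fun=> 0); rewrite big1 // => k _; rewrite mul0r.
- move=> _ _ [r ->] [s ->]; exists (fun k => r k + s k).
  by rewrite -big_split; apply: eq_bigr => k _; rewrite /= mulrDl.
- move=> x _ [r ->]; exists (fun k => x * r k).
  by rewrite mulr_sumr; apply: eq_bigr => k _; rewrite mulrA.
Qed.

Lemma hspan_h k : hspan (h k).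
Proof.
exists (fun i => (i == k)%:R); rewrite (bigD1 k) //= eqxx mul1r.
by rewrite big1 ?addr0 // => i /negbTE ->; rewrite mul0r.
Qed.

(** Inverting the Jacobian matrix expresses the variables through [h] and [l], up to
    second order. *)
Lemma linear_coordinates i : exists (c : 'I_d -> K),
  exists2 g, hspan g & point_pow a 2 ('X_i - (a i)%:MP - \sum_k (c k)%:MP * l k - g).
Proof.
pose J := invmx (jacobian_at (stack h l) a).
exists (fun k => J i (rshift m k)), (\sum_k (J i (lshift d k))%:MP * h k).
  by apply: (ideal_sum hspan_ideal) => k _; apply: (idealM hspan_ideal); exact: hspan_h.
have V1 k : point_pow a 1 ('X_k - (mpolyC n (R := K)) (a k)) by exact: point_pow_X.
have tay k : point_pow a 2 (stack h l k - \sum_q ((jacobian_at (stack h l) a) k q)%:MP *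
    ('X_q - (a q)%:MP)).
  have V0 q : point_pow a 1 ((a q)%:MP - (mpolyC n (R := K)) (a q)).
    by rewrite subrr; exact: (filt0 FV 1).
  have := filt_taylor FV (N := 1) (stack h l k) V0 V1 V1.
  rewrite mmap_mpolyC_X mmap_meval.
  have -> : (stack h l k).@[a] = 0 by rewrite /stack; case: (fintype.split k).
  rewrite rmorph0 subr0; congr (point_pow _ _ (_ - _)).
  by apply: eq_bigr => q _; rewrite mxE.
have Xi : 'X_i - (a i)%:MP = \sum_k (J i k)%:MP * \sum_q ((jacobian_at (stack h l) a) k q)%:MP *
    ('X_q - (a q)%:MP).
  under eq_bigr => k _ do rewrite mulr_sumr.
  rewrite exchange_big /= (bigD1 i) //= [X in _ = _ + X]big1 ?addr0 => [|q qi].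
    under eq_bigr => k _ do rewrite mulrA -mpolyCM.
    rewrite -mulr_suml -(rmorph_sum (mpolyC n (R := K))).
    have := congr1 (fun A : 'M_n => A i i) (mulVmx Ja).
    by rewrite [in LHS]mxE [in RHS]mxE eqxx => ->; rewrite rmorph1 mul1r.
  under eq_bigr => k _ do rewrite mulrA -mpolyCM.
  rewrite -mulr_suml -(rmorph_sum (mpolyC n (R := K))).
  have := congr1 (fun A : 'M_n => A i q) (mulVmx Ja).
  by rewrite [in LHS]mxE [in RHS]mxE eq_sym (negbTE qi) => ->; rewrite rmorph0 mul0r.
have -> : 'X_i - (a i)%:MP - \sum_k (J i (rshift m k))%:MP * l k -
    \sum_k (J i (lshift d k))%:MP * h k =
  - \sum_k (J i k)%:MP * (stack h l k - \sum_q ((jacobian_at (stack h l) a) k q)%:MP *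
    ('X_q - (a q)%:MP)).
  under [in RHS]eq_bigr => k _ do rewrite mulrBr.
  rewrite sumrB -Xi big_split_ord /=.
  under [X in _ = - (X + _ - _)]eq_bigr => k _ do rewrite stack_l.
  under [X in _ = - (_ + X - _)]eq_bigr => k _ do rewrite stack_r.
  by ring.
apply: (filtN FV); apply: (filt_sum FV) => k _; apply: (filtMl FV) => //.
Qed.

Definition sub_coords (u : {mpoly K[d]}) : R := mmap (mpolyC n (R := K)) l u.

Let sub_coordsE : sub_coords = mmap (mpolyC n (R := K)) l. Proof. by []. Qed.

(** The maximal ideal is generated by [l] and [h] modulo its square, hence its
    [k]-th power by the forms of degree [k] in [l], modulo [h] and the next power. *)
Lemma homog_coordinates k f : point_pow a k f ->
  exists2 u : {mpoly K[d]}, u \is k.-homog &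
  exists2 g, hspan g & point_pow a k.+1 (f - sub_coords u - g).
Proof.
elim: k f => [|k IHk] f.
  move=> _; exists (f.@[a])%:MP.
    by rewrite -alg_mpolyC; apply: dhomogZ; exact: dhomog1.
  exists 0; first exact: (ideal0 hspan_ideal).
  rewrite subr0 /sub_coords mmapC -{1}[f]mmap_mpolyC_X.
  by apply: (filt_meval FV) => i; exact: point_pow_X.
move=> [r [Vr ->]].
have exu i : exists ug : {mpoly K[d]} * R, [/\ ug.1 \is k.-homog, hspan ug.2 &
    point_pow a k.+1 (r i - sub_coords ug.1 - ug.2)].
  by have [u uk [g gh Vg]] := IHk _ (Vr i); exists (u, g).
pose u i := (sval (cid (exu i))).1; pose g i := (sval (cid (exu i))).2.
have uP i : [/\ u i \is k.-homog, hspan (g i) & point_pow a k.+1 (r i - sub_coords (u i) - g i)].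
  by rewrite /u /g; case: cid.
pose c i := sval (cid (linear_coordinates i)).
have cP i : exists2 g, hspan g & point_pow a 2 ('X_i - (a i)%:MP - \sum_k (c i k)%:MP * l k - g).
  by rewrite /c; case: cid.
pose e i := sval (cid2 (cP i)).
have eP i : hspan (e i) /\ point_pow a 2 ('X_i - (a i)%:MP - \sum_k (c i k)%:MP * l k - e i).
  by rewrite /e; case: cid2.
pose lam i : {mpoly K[d]} := \sum_k (c i k)%:MP * 'X_k.
have lamE i : sub_coords (lam i) = \sum_k (c i k)%:MP * l k.
  rewrite /sub_coords rmorph_sum; apply: eq_bigr => q _.
  by rewrite rmorphM /= mmapC mmap_XU.
have lam1 i : lam i \is 1.-homog.
  apply: rpred_sum => q _; rewrite mul_mpolyC; apply: dhomogZ.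
  by rewrite dhomogX; apply/eqP/mdeg1.
have Vl k' : point_pow a 1 (l k').
  rewrite -[l k']mmap_mpolyC_X -[mmap _ _ _]subr0 -(mpolyC0 n K) -(la k').
  by apply: (filt_meval FV) => i; exact: point_pow_X.
have Vlam i : point_pow a 1 (\sum_k (c i k)%:MP * l k).
  by apply: (filt_sum FV) => q _; apply: (filtMl FV).
exists (\sum_i u i * lam i).
  apply: rpred_sum => i _; rewrite -addn1; apply: dhomogM => //.
  by case: (uP i).
exists (\sum_i (g i * (\sum_k (c i k)%:MP * l k) + r i * e i)).
  apply: (ideal_sum hspan_ideal) => i _; apply: (idealD hspan_ideal).
    by rewrite mulrC; apply: (idealM hspan_ideal); case: (uP i).
  by apply: (idealM hspan_ideal); case: (eP i).
rewrite /sub_coords rmorph_sum -!sumrB; apply: (filt_sum FV) => i _.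
rewrite rmorphM /= -!sub_coordsE lamE; set L := \sum_k _.
have -> : r i * ('X_i - (a i)%:MP) - sub_coords (u i) * L - (g i * L + r i * e i) =
  (r i - sub_coords (u i) - g i) * L + r i * ('X_i - (a i)%:MP - L - e i) by ring.
apply: (filtD FV).
  by have [_ _ Vu] := uP i; have := filtM FV Vu (Vlam i); rewrite addn1.
by have [_ Ve] := eP i; have := filtM FV (Vr i) Ve; rewrite addn2.
Qed.

(** The Taylor expansion in the local coordinates [l] of the restriction to the
    variety [h = 0]: the remainder at order [N] is a form of degree [N] in [l] up to
    order [N.+1]. *)
Lemma taylor_coordinates f N : exists2 u : nat -> {mpoly K[d]},
  (forall k, u k \is k.-homog) &
  exists2 g, hspan g & point_pow a N (f - \sum_(k < N) sub_coords (u k) - g).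
Proof.
elim: N => [|N [u uk [g gh Vg]]].
  exists (fun=> 0) => [k|]; first exact: rpred0.
  by exists 0 => //; exact: (ideal0 hspan_ideal).
have [v vN [e eh Ve]] := homog_coordinates Vg.
exists (fun k => if (k < N)%N then u k else if k == N then v else 0) => [k|].
  by case: ifP => // _; case: eqP => [->|] //; rewrite rpred0.
exists (g + e); first exact: (idealD hspan_ideal).
rewrite big_ord_recr /= ltnn eqxx; under eq_bigr => i _ do rewrite ltn_ord.
move: Ve; congr (point_pow _ _ _); ring.
Qed.

End LocalCoordinates.

(** * Algebraic closure inside a field, and the exchange property *)

Section Subfields.
Variable F : fieldType.
Implicit Types (A B : set F) (x y z w : F) (s : seq F).

Record is_subfield B : Prop := IsSubfield {
  subfield1 : B 1;
  subfieldB : forall x y, B x -> B y -> B (x - y);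
  subfieldV : forall x y, B x -> B y -> B (x / y)
}.

Definition subfield_pred B : {pred F} := fun x => `[< B x >].

(** [sB] is a parameter of the type for the sake of its field structure. *)
Record subfield_type B (sB : is_subfield B) :=
  SubfieldElt { subfield_val :> F; _ : subfield_val \in subfield_pred B }.

Section SubfieldType.
Variables (B : set F) (sB : is_subfield B).

HB.instance Definition _ := [isSub for @subfield_val B sB].
HB.instance Definition _ := [Choice of subfield_type sB by <:].

Lemma subfield_divring_closed : divring_closed (subfield_pred B).
Proof.
split=> [|x y /asboolP Bx /asboolP By|x y /asboolP Bx /asboolP By]; apply/asboolP.
- exact: subfield1 sB.
- exact: (subfieldB sB).
- exact: (subfieldV sB).
Qed.

HB.instance Definition _ := GRing.isDivringClosed.Build F (subfield_pred B) subfield_divring_closed.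
HB.instance Definition _ := [SubChoice_isSubComUnitRing of subfield_type sB by <:].
HB.instance Definition _ := [SubComUnitRing_isSubIntegralDomain of subfield_type sB by <:].
HB.instance Definition _ := [SubIntegralDomain_isSubField of subfield_type sB by <:].

Definition subfield_incl : {rmorphism subfield_type sB -> F} := val.

End SubfieldType.
End Subfields.

Section AlgebraicClosure.
Variable F : fieldType.
Implicit Types (A B : set F) (x y z w : F) (s : seq F).

Lemma subfield0 B : is_subfield B -> B 0.
Proof. by move=> sB; rewrite -(subrr (1 : F)); apply: (subfieldB sB); exact: (subfield1 sB). Qed.

Lemma subfieldD B x y : is_subfield B -> B x -> B y -> B (x + y).
Proof.
move=> sB Bx By; rewrite -[y]opprK; apply: (subfieldB sB) => //.
by rewrite -sub0r; apply: (subfieldB sB) => //; exact: (subfield0 sB).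
Qed.

Lemma subfieldM B x y : is_subfield B -> B x -> B y -> B (x * y).
Proof.
move=> sB Bx By; rewrite -[y]invrK; apply: (subfieldV sB) => //.
by rewrite -div1r; apply: (subfieldV sB) => //; exact: (subfield1 sB).
Qed.

Lemma subfieldX B (sB : is_subfield B) x n : B x -> B (x ^+ n).
Proof.
move=> Bx; elim: n => [|n IHn]; first exact: (subfield1 sB).
by rewrite exprS; apply: (subfieldM sB).
Qed.

Lemma subfield_sum B (sB : is_subfield B) (I : Type) (r : seq I) (P : pred I) (E : I -> F) :
  (forall i, P i -> B (E i)) -> B (\sum_(i <- r | P i) E i).
Proof. by apply: big_ind => [|x y]; [exact: subfield0 | exact: subfieldD].
Qed.

Definition fgen A : set F := [set z | forall B, is_subfield B -> A `<=` B -> B z].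

Lemma fgen_subfield A : is_subfield (fgen A).
Proof.
split=> [B sB _|x y Ax Ay B sB AB|x y Ax Ay B sB AB]; first exact: (subfield1 sB).
- by apply: (subfieldB sB); [apply: Ax | apply: Ay].
- by apply: (subfieldV sB); [apply: Ax | apply: Ay].
Qed.

Lemma sub_fgen A : A `<=` fgen A.
Proof. by move=> x Ax B _; apply. Qed.

Lemma fgen_min A B : is_subfield B -> A `<=` B -> fgen A `<=` B.
Proof. by move=> sB AB z; apply. Qed.

Definition algebraic_over B z : Prop :=
  exists p : {poly F}, [/\ p != 0, forall i, B p`_i & root p z].

Lemma algebraic_overP B (sB : is_subfield B) z : algebraic_over B z <->
  algebraicOver (subfield_incl sB) z.
Proof.
split=> [[p [p0 Bp pz]]|[p p0 pz]].
  pose c i := @SubfieldElt F B sB _ (introT (asboolP _) (Bp i)).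
  have pE : p = map_poly (subfield_incl sB) (\poly_(i < size p) c i).
    apply/polyP => i; rewrite coef_map coef_poly /=; case: ltnP => //= ip.
    by rewrite nth_default.
  exists (\poly_(i < size p) c i); last by rewrite -pE.
  by apply: contraNneq p0 => e; rewrite pE e rmorph0.
exists (map_poly (subfield_incl sB) p); split=> //.
  by rewrite map_poly_eq0.
by move=> i; rewrite coef_map; apply/asboolP; exact: (valP p`_i).
Qed.

(** The algebraic closure in [F] of the subfield generated by [A]: the closure
    operator of a matroid. *)
Definition cl A : set F := algebraic_over (fgen A).

Lemma fgen_cl A : fgen A `<=` cl A.
Proof.
move=> z Az; exists ('X - z%:P); split; last by rewrite root_XsubC.
  by rewrite polyXsubC_eq0.
have sA := fgen_subfield A; move=> i; rewrite coefB coefX coefC.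
have B01 (b : bool) : fgen A b%:R.
  by case: b; [exact: (subfield1 sA) | exact: (subfield0 sA)].
by apply: (subfieldB sA) => //; case: (i == 0%N) => //; exact: (B01 false).
Qed.

Lemma sub_cl A : A `<=` cl A.
Proof. by move=> z /sub_fgen/fgen_cl. Qed.

Lemma cl_subfield A : is_subfield (cl A).
Proof.
have aP := algebraic_overP (fgen_subfield A).
split=> [|x y /aP Ax /aP Ay|x y /aP Ax /aP Ay]; apply/aP.
- exact: algebraic1.
- exact: algebraic_sub.
- exact: algebraic_div.
Qed.

Lemma algebraic_over_mono B B' z : B `<=` B' -> algebraic_over B z -> algebraic_over B' z.
Proof. by move=> BB' [p [p0 Bp pz]]; exists p; split=> // i; apply: BB'. Qed.

Lemma algebraic_over_cl A z : algebraic_over (cl A) z -> cl A z.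
Proof.
have aP := algebraic_overP (fgen_subfield A).
move=> [p [p0 Bp pz]]; apply/aP/integral_algebraic.
apply: (integral_root p0 pz); apply/integral_poly => i.
by apply/integral_algebraic/aP; exact: Bp.
Qed.

Lemma cl_cl A A' : A' `<=` cl A -> cl A' `<=` cl A.
Proof.
move=> A'A z A'z; apply: algebraic_over_cl; apply: algebraic_over_mono A'z.
by apply: fgen_min => //; exact: cl_subfield.
Qed.

Lemma cl_mono A A' : A `<=` A' -> cl A `<=` cl A'.
Proof. by move=> AA'; apply: cl_cl => z /AA'/sub_cl. Qed.

Lemma common_denominator (C : set F) N (b : nat -> F) : C 1 ->
  (forall x y, C x -> C y -> C (x * y)) ->
  (forall i, (i < N)%N -> exists c d, [/\ C c, C d, d != 0 & b i = c / d]) ->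
  exists q, [/\ C q, q != 0 & forall i, (i < N)%N -> C (q * b i)].
Proof.
move=> C1 CM; elim: N => [|N IHN] bE; first by exists 1; split=> //; exact: oner_neq0.
have [q [Cq q0 qb]] := IHN (fun i iN => bE i (ltnW iN)).
have [c [d [Cc Cd d0 bN]]] := bE _ (ltnSn N).
exists (q * d); split=> [||i]; [exact: CM | exact: mulf_neq0|].
rewrite ltnS leq_eqVlt => /orP[/eqP ->|iN]; last by rewrite mulrAC; apply: CM => //; exact: qb.
by rewrite bN -mulrA [d * _]mulrC divfK //; apply: CM.
Qed.

Lemma fgen_adjoin A w z : fgen (A `|` [set w]) z ->
  exists p q : {poly F}, [/\ forall i, fgen A p`_i, forall i, fgen A q`_i,
    q.[w] != 0 & z = p.[w] / q.[w]].
Proof.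
have sA := fgen_subfield A.
pose C := [set x | exists2 p : {poly F}, (forall i, fgen A p`_i) & x = p.[w]].
have CB x y : C x -> C y -> C (x - y).
  move=> [p Ap ->] [q Aq ->]; exists (p - q); last by rewrite hornerD hornerN.
  by move=> i; rewrite coefB; apply: (subfieldB sA).
have CM x y : C x -> C y -> C (x * y).
  move=> [p Ap ->] [q Aq ->]; exists (p * q); last by rewrite hornerM.
  by move=> i; rewrite coefM; apply: (subfield_sum sA) => // k _; apply: (subfieldM sA).
have Cc x : fgen A x -> C x.
  move=> Ax; exists x%:P; last by rewrite hornerC.
  by move=> i; rewrite coefC; case: eqP => // _; exact: (subfield0 sA).
have C1 : C 1 by apply: Cc; exact: (subfield1 sA).
suff sE : is_subfield [set x | exists c d, [/\ C c, C d, d != 0 & x = c / d]].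
  move=> /(_ _ sE)[x|c [d [[p Ap ->] [q Aq ->] q0 ->]]]; last by exists p, q.
  move=> Awx; exists x, 1; rewrite oner_neq0 divr1; split=> //.
  case: Awx => [Ax|->]; first by apply: Cc; exact: sub_fgen.
  exists 'X => [i|]; last by rewrite hornerX.
  by rewrite coefX; case: eqP => _; [exact: (subfield1 sA) | exact: subfield0].
have C0 : C 0 by apply: Cc; exact: (subfield0 sA).
split.
- by exists 1, 1; rewrite oner_neq0 divr1.
- move=> _ _ [c [d [Cc' Cd d0 ->]]] [c' [d' [Cc'' Cd' d0' ->]]].
  exists (c * d' - c' * d), (d * d'); split; [|exact: CM|exact: mulf_neq0|].
    by apply: CB; exact: CM.
  by field; rewrite d0 d0'.
- move=> _ _ [c [d [Cc' Cd d0 ->]]] [c' [d' [Cc'' Cd' d0' ->]]].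
  have [->|c0] := eqVneq c' 0.
    by exists 0, 1; rewrite oner_neq0 !(mul0r, invr0, mulr0).
  exists (c * d'), (c' * d); split; [exact: CM|exact: CM|exact: mulf_neq0|].
  by field; rewrite d0 d0' c0.
Qed.

(** Clearing denominators, an equation of [z] over [A] and [w] is a polynomial in
    [w] and [z] with coefficients in the field generated by [A]. Read as an equation
    of [w], it could only be trivial if each of its coefficients, a polynomial in
    [z], were. *)
Lemma exchange A w z : cl (A `|` [set w]) z -> ~ cl A z -> cl (A `|` [set z]) w.
Proof.
move=> [r [r0 Br rz]] Nz; have sA := fgen_subfield A.
pose C := [set x | exists2 p : {poly F}, (forall i, fgen A p`_i) & x = p.[w]].
have [||i _|q [Cq q0 qr]] := common_denominator (C := C) (N := size r) (b := fun i => r`_i).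
- exists 1; last by rewrite hornerC.
  by move=> i; rewrite coefC; case: eqP => _; [exact: (subfield1 sA) | exact: subfield0].
- move=> x y [p Ap ->] [q Aq ->]; exists (p * q); last by rewrite hornerM.
  by move=> i; rewrite coefM; apply: (subfield_sum sA) => // k _; apply: (subfieldM sA).
- have [p [q [Ap Aq q0 ->]]] := fgen_adjoin (Br i).
  by exists p.[w], q.[w]; split=> //; [exists p | exists q].
have exP i : exists p : {poly F}, (forall k, fgen A p`_k) /\ ((i < size r)%N -> q * r`_i = p.[w]).
  have [ir|_] := ltnP i (size r); first by have [p Ap ->] := qr _ ir; exists p.
  by exists 0; split=> // k; rewrite coef0; exact: (subfield0 sA).
pose P i := sval (cid (exP i)).
have PA i k : fgen A (P i)`_k by rewrite /P; case: cid => p [].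
have Pw i : (i < size r)%N -> q * r`_i = (P i).[w] by rewrite /P; case: cid => p [].
have eq0 : \sum_(i < size r) (P i).[w] * z ^+ i = 0.
  under eq_bigr => i _ do rewrite -Pw // -mulrA.
  by rewrite -mulr_sumr -horner_coef (eqP rz) mulr0.
pose Q := \sum_(i < size r) z ^+ i *: P i.
have Aw x : fgen A x -> fgen (A `|` [set z]) x.
  by move=> Ax; apply: (fgen_min (A := A)) Ax; [exact: fgen_subfield | move=> t At; apply: sub_fgen; left].
exists Q; split.
- apply/eqP => Q0; case/negP: q0; apply/eqP.
  have Pik (i : 'I_(size r)) k : (P i)`_k = 0.
    apply: contrapT => /eqP Pik; apply: Nz.
    exists (\poly_(i < size r) (P i)`_k); split.
    + apply: contraNneq Pik => /(congr1 (fun p : {poly F} => p`_i)).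
      by rewrite coef_poly ltn_ord coef0 => ->.
    + by move=> l; rewrite coef_poly; case: ifP => // _; exact: (subfield0 sA).
    + apply/rootP; rewrite horner_poly; have := congr1 (fun p : {poly F} => p`_k) Q0.
      rewrite coef_sum coef0 => e; rewrite -[RHS]e.
      by apply: eq_bigr => l _; rewrite coefZ mulrC.
  have sr : (0 < size r)%N by rewrite size_poly_gt0.
  have sr' : ((size r).-1 < size r)%N by rewrite prednK.
  have : q * lead_coef r = 0.
    rewrite lead_coefE Pw //; have -> : P (size r).-1 = 0; last by rewrite horner0.
    by apply/polyP => k; rewrite coef0 (Pik (Ordinal sr')).
  by move=> /eqP; rewrite mulf_eq0 lead_coef_eq0 (negbTE r0) orbF => /eqP.
- move=> k; rewrite coef_sum; have sz := fgen_subfield (A `|` [set z]).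
  apply: (subfield_sum sz) => i _; rewrite coefZ; apply: (subfieldM sz); last by apply: Aw; exact: PA.
  by apply: (subfieldX sz); apply: sub_fgen; right.
- apply/rootP; rewrite horner_sum -[RHS]eq0; apply: eq_bigr => i _.
  by rewrite hornerZ mulrC.
Qed.

(** Algebraic independence of [s] over [A], tested one element at a time. *)
Fixpoint free_over A s : Prop :=
  if s is z :: s' then ~ cl A z /\ free_over (A `|` [set z]) s' else True.

Lemma free_over_anti A A' s : A' `<=` cl A -> free_over A s -> free_over A' s.
Proof.
elim: s A A' => //= z s IHs A A' A'A [Nz fs]; split; first by move/(cl_cl A'A).
apply: IHs fs => x [/A'A|->]; first by apply: cl_mono => y; left.
by apply: sub_cl; right.
Qed.

(** If [z] is the first element of [s] that becomes algebraic when [y] is adjoined,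
    then by exchange [y] is algebraic over the elements up to [z], so that the
    following ones remain independent. *)
Lemma free_over_adjoin A y s : free_over A s ->
  exists s', [/\ {subset s' <= s}, free_over (A `|` [set y]) s' & (size s <= (size s').+1)%N].
Proof.
elim: s A => [|z s IHs] A /=; first by move=> _; exists [::].
move=> [Nz fs]; have [yz|Nyz] := pselect (cl (A `|` [set y]) z).
  exists s; split=> //; first by move=> x xs; rewrite inE xs orbT.
  apply: free_over_anti fs => x [Ax|->]; first by apply: sub_cl; left.
  exact: exchange.
have [s' [ss' fs' sz]] := IHs _ fs; exists (z :: s'); split=> //=.
  by move=> x; rewrite !inE => /orP[->|/ss' ->] //; rewrite orbT.
by split=> //; rewrite -setUA [_ `|` [set z]]setUC setUA.
Qed.

(** Steinitz: adjoining the elements of [t] to [A] one by one loses at most one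
    element of the independent family [s] at each step. *)
Lemma steinitz A s t : free_over A s -> (forall z, z \in s -> cl (A `|` [set` t]) z) ->
  (size s <= size t)%N.
Proof.
elim: t A s => [|y t IHt] A s fs st.
  case: s fs st => //= z s [Nz _] /(_ z (mem_head _ _)) clz; case: Nz.
  by apply: cl_mono clz => x [//|]; rewrite /= in_nil.
have [s' [ss' fs' sz]] := free_over_adjoin y fs.
apply: (leq_trans sz); rewrite ltnS; apply: (IHt (A `|` [set y])) => // z /ss'/st.
apply: cl_mono => x [Ax|]; first by left; left.
by rewrite /= inE => /orP[/eqP ->|xt]; [left; right | right].
Qed.

Lemma free_over_rcons A s z :
  free_over A (rcons s z) <-> free_over A s /\ ~ cl (A `|` [set` s]) z.
Proof.
elim: s A => [|y s IHs] A /=.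
  have -> : [set` [::]] = set0 :> set F by apply/seteqP; split=> x //=; rewrite in_nil.
  by rewrite setU0; split=> [[]|[]].
have -> : A `|` [set` y :: s] = A `|` [set y] `|` [set` s].
  apply/seteqP; split=> x /=; rewrite inE.
    by move=> [|/orP[/eqP|]]; [left; left | left; right | right].
  by move=> [[Ax|->]|xs]; [left | right; rewrite eqxx | right; rewrite xs orbT].
by split=> [[Ny /IHs[fs Nz]]|[[Ny fs] Nz]]; do ?split=> //; apply/IHs.
Qed.

End AlgebraicClosure.

Section PolynomialRelations.
Variables (K F : fieldType) (iota : {rmorphism K -> F}).

Lemma is_subfield_field_range n (x : 'I_n -> F) :
  is_subfield [set z | exists p q, mmap iota x q <> 0 /\ z = mmap iota x p / mmap iota x q].
Proof.
split.
- by exists 1, 1; rewrite !rmorph1 divr1; split=> //; apply/eqP; exact: oner_neq0.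
- move=> _ _ [p [q [/eqP q0 ->]]] [p' [q' [/eqP q0' ->]]].
  exists (p * q' - p' * q), (q * q'); rewrite rmorphB !rmorphM /=; split.
    by apply/eqP; exact: mulf_neq0.
  by field; rewrite q0 q0'.
- move=> _ _ [p [q [/eqP q0 ->]]] [p' [q' [/eqP q0' ->]]].
  have [->|p0] := eqVneq (mmap iota x p') 0.
    by exists 0, 1; rewrite rmorph0 rmorph1 !(mul0r, invr0, mulr0); split=> //; apply/eqP; exact: oner_neq0.
  exists (p * q'), (p' * q); rewrite !rmorphM /=; split.
    by apply/eqP; exact: mulf_neq0.
  by field; rewrite q0 q0' p0.
Qed.

Lemma fgen_range n (x : 'I_n -> F) z : fgen (range iota `|` range x) z <->
  exists p q, mmap iota x q <> 0 /\ z = mmap iota x p / mmap iota x q.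
Proof.
split=> [|[p [q [q0 ->]]]].
  move=> /(_ _ (is_subfield_field_range x)); apply.
  move=> _ [[c _ <-]|[i _ <-]]; [exists c%:MP, 1 | exists 'X_i, 1];
    rewrite rmorph1 divr1 ?mmapC ?mmap_XU; split=> //; apply/eqP; exact: oner_neq0.
have sA := fgen_subfield (range iota `|` range x).
have Ap r : fgen (range iota `|` range x) (mmap iota x r).
  elim/mpoly_gen_ind: r => [c|i|r s IHr IHs|r s IHr IHs].
  - by rewrite mmapC; apply: sub_fgen; left; exists c.
  - by rewrite mmap_XU; apply: sub_fgen; right; exists i.
  - by rewrite rmorphD; apply: (subfieldD sA).
  - by rewrite rmorphM; apply: (subfieldM sA).
exact: (subfieldV sA).
Qed.

Lemma field_generatesP n (x : 'I_n -> F) : field_generates iota x <->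
  fgen (range iota `|` range x) = setT.
Proof.
split=> [gx|e z]; last by apply/fgen_range; rewrite e.
by apply/seteqP; split=> // z _; apply/fgen_range; exact: gx.
Qed.

(** Relations with coefficients in the generated field, with denominators cleared. *)
Lemma clP n (x : 'I_n -> F) z : cl (range iota `|` range x) z <->
  exists Q : {poly {mpoly K[n]}}, map_poly (mmap iota x) Q != 0 /\ root (map_poly (mmap iota x) Q) z.
Proof.
split=> [[P [P0 AP Pz]]|[Q [Q0 Qz]]]; last first.
  exists (map_poly (mmap iota x) Q); split=> // i; rewrite coef_map; apply/fgen_range.
  by exists Q`_i, 1; rewrite rmorph1 divr1; split=> //; apply/eqP; exact: oner_neq0.
have [||i _|q [Cq q0 qb]] := common_denominator (C := range (mmap iota x)) (N := size P)
    (b := fun i => P`_i).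
- by exists 1; rewrite ?rmorph1.
- by move=> _ _ [p _ <-] [p' _ <-]; exists (p * p'); rewrite ?rmorphM.
- have /fgen_range[p [q [/eqP q0 ->]]] := AP i.
  by exists (mmap iota x p), (mmap iota x q); split.
have ex i : exists c, (i < size P)%N -> mmap iota x c = q * P`_i.
  by have [/qb[c _ cE]|_] := ltnP i (size P); [exists c | exists 0].
pose c i := sval (cid (ex i)).
have cE i : (i < size P)%N -> mmap iota x (c i) = q * P`_i by rewrite /c; case: cid.
exists (\poly_(i < size P) c i).
have -> : map_poly (mmap iota x) (\poly_(i < size P) c i) = q *: P.
  apply/polyP => i; rewrite coef_map coef_poly coefZ /=.
  by case: ltnP => iP; [exact: cE | rewrite rmorph0 nth_default // mulr0].
by rewrite scaler_eq0 negb_or q0 P0 rootZ.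
Qed.

End PolynomialRelations.

Definition extend (T : Type) n (x : 'I_n -> T) (t : T) : 'I_n.+1 -> T :=
  fun i => if unlift ord_max i is Some i' then x i' else t.

Lemma extend_max (T : Type) n (x : 'I_n -> T) t : extend x t ord_max = t.
Proof. by rewrite /extend unlift_none. Qed.

Lemma extend_widen (T : Type) n (x : 'I_n -> T) t :
  extend x t \o widen_ord (leqnSn n) = x.
Proof.
apply/funext => k /=; have -> : widen_ord (leqnSn n) k = lift ord_max k.
  by apply: val_inj; rewrite /= /bump leqNgt ltn_ord.
by rewrite /extend liftK.
Qed.

Lemma extendE (T : Type) n (x : 'I_n -> T) t i : extend x t (widen_ord (leqnSn n) i) = x i.
Proof. by rewrite -[LHS]/((extend x t \o widen_ord (leqnSn n)) i) extend_widen. Qed.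

(** The last variable as the variable of a polynomial in one variable. *)
Section LastVariable.
Variables (R : comNzRingType) (n : nat).

Definition last_horner (P : {poly {mpoly R[n]}}) : {mpoly R[n.+1]} :=
  (map_poly (@mwiden n R) P).['X_ord_max].

Lemma last_horner0 : last_horner 0 = 0.
Proof. by rewrite /last_horner rmorph0 horner0. Qed.

Lemma last_hornerD : {morph last_horner : P Q / P + Q}.
Proof. by move=> P Q; rewrite /last_horner rmorphD hornerD. Qed.

Lemma last_hornerM : {morph last_horner : P Q / P * Q}.
Proof. by move=> P Q; rewrite /last_horner rmorphM hornerM. Qed.

Local Notation widen := (widen_ord (leqnSn n)).

Lemma ord_last_ind (P : 'I_n.+1 -> Prop) : P ord_max -> (forall i, P (widen i)) -> forall i, P i.
Proof.
move=> Pm Pw i; have [ni|lt] := leqP n i.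
  suff -> : i = ord_max by [].
  by apply/val_inj/eqP; rewrite /= eqn_leq ni -ltnS ltn_ord.
by have -> : i = widen (Ordinal lt) by exact: val_inj.
Qed.

Lemma widen_neq_max (i : 'I_n) : (widen i == ord_max) = false.
Proof. by apply/negbTE; rewrite -val_eqE /= ltn_eqF. Qed.

Lemma widen_eq (i k : 'I_n) : (widen i == widen k) = (i == k).
Proof. by rewrite -!val_eqE. Qed.

Lemma mwiden_XU (i : 'I_n) : mwiden ('X_i : {mpoly R[n]}) = 'X_(widen i).
Proof. by rewrite mwidenX mnmwiden1. Qed.

Lemma muni_XU_widen (i : 'I_n) : muni ('X_(widen i) : {mpoly R[n.+1]}) = ('X_i)%:P.
Proof.
rewrite muniE msuppX big_seq1 mcoeffX eqxx scale1r mnm1E widen_neq_max expr0 alg_polyC.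
congr (_%:P); congr 'X_[_]; apply/mnmP => k; rewrite mnmE !mnm1E.
by rewrite widen_eq.
Qed.

Lemma muni_XU_max : muni ('X_ord_max : {mpoly R[n.+1]}) = 'X.
Proof.
rewrite muniE msuppX big_seq1 mcoeffX eqxx scale1r mnm1E eqxx expr1.
have -> : [multinom U_(ord_max)%MM (widen i) | i < n] = 0%MM.
  by apply/mnmP => k; rewrite mnmE mnm1E eq_sym widen_neq_max mnm0E.
by rewrite mpolyX0 scale1r.
Qed.

Lemma last_hornerC c : last_horner c%:P = mwiden c.
Proof. by rewrite /last_horner map_polyC hornerC. Qed.

Lemma last_hornerX : last_horner 'X = 'X_ord_max.
Proof. by rewrite /last_horner map_polyX hornerX. Qed.

Lemma muniK f : last_horner (muni f) = f.
Proof.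
elim/mpoly_gen_ind: f => [c|i|p q IHp IHq|p q IHp IHq].
- by rewrite muniC last_hornerC mwidenC.
- move: i; apply: ord_last_ind => [|i].
    by rewrite muni_XU_max last_hornerX.
  by rewrite muni_XU_widen last_hornerC mwiden_XU.
- by rewrite muniD last_hornerD; congr (_ + _).
- by rewrite muniM last_hornerM; congr (_ * _).
Qed.

Lemma muni_mwiden p : muni (mwiden p : {mpoly R[n.+1]}) = p%:P.
Proof.
elim/mpoly_gen_ind: p => [c|i|p q IHp IHq|p q IHp IHq].
- by rewrite mwidenC muniC.
- by rewrite mwiden_XU muni_XU_widen.
- by rewrite mwidenD muniD polyCD; congr (_ + _).
- by rewrite mwidenM muniM polyCM; congr (_ * _).
Qed.

Lemma last_hornerK P : muni (last_horner P) = P.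
Proof.
elim/poly_ind: P => [|P c IHP]; first by rewrite last_horner0 muni0.
rewrite last_hornerD last_hornerM last_hornerX last_hornerC.
rewrite muniD muniM IHP muni_XU_max.
by rewrite muni_mwiden.
Qed.

Lemma mmap_mwiden (S : comNzRingType) (j : {rmorphism R -> S}) (y : 'I_n.+1 -> S) p :
  mmap j y (mwiden p) = mmap j (y \o widen) p.
Proof.
elim/mpoly_gen_ind: p => [c|i|p q IHp IHq|p q IHp IHq].
- by rewrite mwidenC !mmapC.
- by rewrite mwiden_XU !mmap_XU.
- by rewrite mwidenD !rmorphD /= IHp IHq.
- by rewrite mwidenM !rmorphM /= IHp IHq.
Qed.

Lemma mmap_last_horner (S : comNzRingType) (j : {rmorphism R -> S}) (y : 'I_n.+1 -> S) P :
  mmap j y (last_horner P) = (map_poly (mmap j (y \o widen)) P).[y ord_max].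
Proof.
elim/poly_ind: P => [|P c IHP]; first by rewrite last_horner0 !rmorph0 horner0.
rewrite last_hornerD last_hornerM last_hornerX last_hornerC.
rewrite rmorphD rmorphM /= IHP mmap_XU mmap_mwiden.
by rewrite rmorphD rmorphM /= map_polyX map_polyC hornerMXaddC.
Qed.

Lemma mderiv_XU m (i k : 'I_m) : ('X_i : {mpoly R[m]})^`M(k) = (i == k)%:R%:MP.
Proof.
rewrite mderivX mnm1E; case: eqP => [->|_]; last by rewrite scale0r mpolyC0.
have -> : (U_(k) - U_(k))%MM = 0%MM by apply/mnmP => l; rewrite mnmBE subnn mnm0E.
by rewrite mpolyX0 scale1r mpolyC1.
Qed.

Lemma mderiv_mwiden p k : (mwiden p : {mpoly R[n.+1]})^`M(widen k) = mwiden (p^`M(k)).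
Proof.
elim/mpoly_gen_ind: p => [c|i|p q IHp IHq|p q IHp IHq].
- by rewrite mwidenC !mderivC mwiden0.
- by rewrite mwiden_XU !mderiv_XU mwidenC widen_eq.
- by rewrite mwidenD !mderivD IHp IHq mwidenD.
- by rewrite mwidenM !mderivM IHp IHq mwidenD !mwidenM.
Qed.

Lemma mderiv_mwiden_max p : (mwiden p : {mpoly R[n.+1]})^`M(ord_max) = 0.
Proof.
elim/mpoly_gen_ind: p => [c|i|p q IHp IHq|p q IHp IHq].
- by rewrite mwidenC !mderivC.
- by rewrite mwiden_XU !mderiv_XU widen_neq_max mpolyC0.
- by rewrite mwidenD !mderivD IHp IHq addr0.
- by rewrite mwidenM !mderivM IHp IHq mulr0 mul0r addr0.
Qed.

End LastVariable.

Section AlgIndependent.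
Variables (K F : fieldType) (iota : {rmorphism K -> F}).

Lemma alg_independentS d (x : 'I_d.+1 -> F) :
  let x' := x \o widen_ord (leqnSn d) in
  alg_independent iota x <->
  alg_independent iota x' /\ ~ cl (range iota `|` range x') (x ord_max).
Proof.
move=> x'; split=> [ix|[ix' Nx] p px].
  split=> [p px|/clP[Q [Q0 Qx]]].
    have := ix (mwiden p); rewrite mmap_mwiden => /(_ px) w0.
    by apply: (@inj_mwiden d K); rewrite w0 mwiden0.
  have := ix (last_horner Q); rewrite mmap_last_horner (eqP Qx) => /(_ erefl) e.
  by move: Q0; rewrite -[Q]last_hornerK e muni0 rmorph0 eqxx.
have pE := muniK p; have m0 : map_poly (mmap iota x') (muni p) = 0.
  apply: contrapT => /eqP m0; apply: Nx; apply/clP; exists (muni p); split=> //.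
  by apply/rootP; rewrite -mmap_last_horner pE.
suff -> : p = 0 by []; rewrite -pE; suff -> : muni p = 0 by rewrite last_horner0.
apply/polyP => i; rewrite coef0; apply: ix'.
by have := congr1 (fun q : {poly F} => q`_i) m0; rewrite coef_map coef0.
Qed.

Lemma alg_independent_free d (x : 'I_d -> F) :
  alg_independent iota x <-> free_over (range iota) [seq x i | i <- enum 'I_d].
Proof.
elim: d x => [|d IHd] x.
  rewrite (size0nil (s := enum 'I_0)) ?size_enum_ord //; split=> // _ p.
  by rewrite [p]nvar0_mpolyC mmapC => /eqP; rewrite fmorph_eq0 => /eqP ->; rewrite mpolyC0.
rewrite alg_independentS IHd enum_ordSr map_rcons free_over_rcons -map_comp.
suff -> : [set` [seq (x \o widen_ord (leqnSn d)) i | i <- enum 'I_d]] =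
    range (x \o widen_ord (leqnSn d)) by [].
apply/seteqP; split=> z /=; first by move=> /mapP[i _ ->]; exists i.
by move=> [i _ <-]; apply/mapP; exists i; rewrite // mem_enum.
Qed.

Lemma alg_independent_le d (x : 'I_d -> F) (t : seq F) : alg_independent iota x ->
  (forall i, cl (range iota `|` [set` t]) (x i)) -> (d <= size t)%N.
Proof.
move=> /alg_independent_free fx clx; rewrite -(size_enum_ord d) -(size_map x).
by apply: (steinitz fx) => z /mapP[i _ ->].
Qed.

Lemma alg_independent_inj d n (x : 'I_n -> F) (s : 'I_d -> 'I_n) :
  alg_independent iota (x \o s) -> injective s.
Proof.
move=> ix i k sik; apply: contrapT => /eqP ik.
have := ix ('X_i - 'X_k); rewrite rmorphB /= !mmap_XU /= sik subrr => /(_ erefl).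
move=> /(congr1 (mcoeff U_(i)%MM)) /eqP; rewrite mcoeffB !mcoeffXU eqxx mcoeff0.
by rewrite [k == i]eq_sym (negbTE ik) subr0 oner_eq0.
Qed.

End AlgIndependent.

(** * The Jacobian criterion for algebraic dependence *)

Section Jacobian.
Variables (K F : fieldType) (iota : {rmorphism K -> F}).

Definition grad n (y : 'I_n -> F) (f : {mpoly K[n]}) : 'rV[F]_n :=
  \row_k mmap iota y (f^`M(k)).

Lemma gradD n (y : 'I_n -> F) f g : grad y (f + g) = grad y f + grad y g.
Proof. by apply/rowP => k; rewrite !mxE mderivD rmorphD. Qed.

Lemma gradM n (y : 'I_n -> F) f g :
  grad y (f * g) = mmap iota y f *: grad y g + mmap iota y g *: grad y f.
Proof. by apply/rowP => k; rewrite !mxE mderivM rmorphD !rmorphM /=; ring. Qed.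

Lemma grad_sum n (y : 'I_n -> F) (I : Type) (r : seq I) (E : I -> {mpoly K[n]}) :
  grad y (\sum_(i <- r) E i) = \sum_(i <- r) grad y (E i).
Proof.
apply: (big_morph _ (gradD y)); apply/rowP => k.
by rewrite !mxE mderiv0 rmorph0.
Qed.

(** By induction on [n]. The rows of [G] are the gradients of one relation for each
    coordinate of [y] that is algebraic over the preceding ones; the other
    coordinates form [t]. In characteristic [p] such a relation may be inseparable, so that [G]
    can have smaller rank, but not greater. Such a relation [Q] of least degree in
    the last variable accounts for all others: dividing a relation by [Q] leaves a
    remainder whose coefficients are relations between the preceding coordinates,
    and the quotient contributes a multiple of the gradient of [Q]. *)
Theorem jacobian_criterion n (y : 'I_n -> F) : exists (G : 'M[F]_n) (t : seq F),
  [/\ forall f, mmap iota y f = 0 -> (grad y f <= G)%MS,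
      forall i, cl (range iota `|` [set` t]) (y i) & (\rank G + size t <= n)%N].
Proof.
elim: n y => [|n IHn] y.
  exists 0, [::]; split=> [f _|[]//|]; last by rewrite mxrank0.
  by rewrite [grad y f]thinmx0 sub0mx.
pose w := widen_ord (leqnSn n); have [G [t [Gf tc rt]]] := IHn (y \o w).
pose W : 'M[F]_(n, n.+1) := \matrix_(i, k) (w i == k)%:R.
have gradw p : grad y (mwiden p) = grad (y \o w) p *m W.
  apply/rowP; apply: ord_last_ind => [|k]; rewrite !mxE.
    rewrite mderiv_mwiden_max rmorph0 big1 // => i _.
    by rewrite !mxE widen_neq_max mulr0.
  rewrite mderiv_mwiden mmap_mwiden (bigD1 k) //= !mxE widen_eq eqxx mulr1.
  by rewrite big1 ?addr0 // => i ik; rewrite !mxE widen_eq (negbTE ik) mulr0.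
have gradI (P : {poly {mpoly K[n]}}) : (forall i, mmap iota (y \o w) P`_i = 0) ->
    (grad y (last_horner P) <= G *m W)%MS.
  move=> P0; rewrite /last_horner horner_coef grad_sum; apply: summx_sub => i _.
  rewrite gradM coef_map /= mmap_mwiden P0 scale0r add0r; apply: scalemx_sub.
  by rewrite gradw; apply: submxMr; exact: Gf.
have tw i : cl (range iota `|` [set` t]) (y (w i)) by exact: tc.
have rGW : (\rank (G *m W) <= \rank G)%N by exact: mxrankM_maxl.
have [ya|Nya] := pselect (cl (range iota `|` range (y \o w)) (y ord_max)); last first.
  exists <<G *m W>>%MS, (y ord_max :: t); split.
  - move=> f fy; rewrite genmxE -[f]muniK; apply: gradI => i.
    have m0 : map_poly (mmap iota (y \o w)) (muni f) = 0.
      apply: contrapT => /eqP m0; apply: Nya; apply/clP; exists (muni f); split=> //.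
      by apply/rootP; rewrite -mmap_last_horner muniK.
    by have := congr1 (fun q : {poly F} => q`_i) m0; rewrite coef_map coef0.
  - apply: ord_last_ind => [|i]; first by apply: sub_cl; right; rewrite /= mem_head.
    apply: cl_mono (tw i) => z [|zt]; first by left.
    by right; rewrite /= inE [z \in t]zt orbT.
  - by rewrite genmxE /= addnS ltnS; apply: leq_trans rt; rewrite leq_add2r.
pose ann (Q : {poly {mpoly K[n]}}) := map_poly (mmap iota (y \o w)) Q != 0 /\
  root (map_poly (mmap iota (y \o w)) Q) (y ord_max).
have [Q [[Q0 Qy] Qmin]] : exists Q, ann Q /\ forall Q', ann Q' -> (size Q <= size Q')%N.
  by apply: exists_min; have [Q0 annQ0] := (clP _ _ _).1 ya; exists Q0.
have Qn0 : Q != 0 by apply: contraNneq Q0 => ->; rewrite rmorph0.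
have lcQ : mmap iota (y \o w) (lead_coef Q) != 0.
  apply/negP => /eqP lc0; pose Q' := Q - lead_coef Q *: 'X^((size Q).-1).
  have Q'E : map_poly (mmap iota (y \o w)) Q' = map_poly (mmap iota (y \o w)) Q.
    by rewrite rmorphB /= map_polyZ /= lc0 scale0r subr0.
  have : (size Q <= size Q')%N by apply: Qmin; rewrite /ann Q'E.
  apply/negP; rewrite -ltnNge (polySpred Qn0) ltnS; apply/leq_sizeP => i.
  rewrite leq_eqVlt coefB coefZ coefXn => /orP[/eqP <-|lti].
    by rewrite eqxx mulr1 lead_coefE subrr.
  by rewrite gtn_eqF // mulr0 subr0 nth_default // (polySpred Qn0).
exists (G *m W + grad y (last_horner Q))%MS, t; split.
- move=> f fy; pose P := muni f.
  have := Pdiv.Idomain.divp_eq P Q; set k := scalp P Q => eqP'.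
  have lck : mmap iota (y \o w) (lead_coef Q ^+ k) != 0 by rewrite rmorphXn expf_neq0.
  have Py : (map_poly (mmap iota (y \o w)) P).[y ord_max] = 0.
    by rewrite -mmap_last_horner muniK.
  have mody : map_poly (mmap iota (y \o w)) (P %% Q) = 0.
    apply: contrapT => /eqP m0; have : (size Q <= size (P %% Q)%R)%N.
      apply: Qmin; split=> //; apply/rootP.
      have := congr1 (fun A => (map_poly (mmap iota (y \o w)) A).[y ord_max]) eqP'.
      rewrite /= map_polyZ /= hornerZ Py mulr0 rmorphD rmorphM hornerD hornerM.
      by rewrite (rootP Qy) mulr0 add0r => <-.
    by rewrite leqNgt ltn_modp Qn0.
  have := congr1 (fun A => grad y (last_horner A)) eqP'.
  rewrite -mul_polyC last_hornerM gradM [last_horner P]muniK fy scale0r addr0.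
  rewrite last_hornerC mmap_mwiden => gradE.
  have -> : grad y f = (mmap iota (y \o w) (lead_coef Q ^+ k))^-1 *:
      (mmap iota (y \o w) (lead_coef Q ^+ k) *: grad y f).
    by rewrite scalerA mulVf ?scale1r.
  rewrite gradE; apply: scalemx_sub.
  rewrite last_hornerD last_hornerM gradD gradM addmx_sub //.
    rewrite mmap_last_horner [in X in _ + X]mmap_last_horner (rootP Qy) scale0r addr0.
    by apply: scalemx_sub; exact: addsmxSr.
  apply: submx_trans (addsmxSl _ _); apply: gradI => i.
  by have := congr1 (fun q : {poly F} => q`_i) mody; rewrite coef_map coef0.
- apply: ord_last_ind => [|i]; last exact: tw.
  apply: cl_cl ya => z [zK|[i _ <-]]; last exact: tw.
  by apply: sub_cl; left.
- have : (\rank (G *m W + grad y (last_horner Q))%MS <= \rank G + 1)%N.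
    apply: leq_trans (mxrank_adds_leqif _ _) _.
    by apply: leq_add => //; exact: rank_leq_row.
  move=> le1; apply: leq_trans (_ : (\rank G + 1 + size t <= n.+1)%N); first by rewrite leq_add2r.
  by rewrite addn1 addSn ltnS.
Qed.

End Jacobian.

Lemma properEPn (T : Type) (A B : set T) : A `<` B <-> A `<=` B /\ exists x, B x /\ ~ A x.
Proof.
split=> [[AB NBA]|[AB [x [Bx Ax]]]]; last by split=> // BA; apply: Ax; apply: BA.
split=> //; apply: contrapT => no; apply: NBA => x Bx.
by apply: contrapT => Ax; apply: no; exists x.
Qed.

(** * Specializations and chains of primes *)

Section PrimeQuotient.
Variables (R : comNzRingType) (I : prime_idealr R).

Definition prime_quot := {ideal_quot I}.
HB.instance Definition _ := GRing.ComNzRing.on prime_quot.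

Let unitq : pred prime_quot := fun x => `[< exists y, y * x = 1 >].
Let invq (x : prime_quot) : prime_quot :=
  if pselect (exists y, y * x = 1) is left e then sval (cid e) else x.

Let mulVq : {in unitq, left_inverse 1 invq *%R}.
Proof. by move=> x /asboolP ex; rewrite /invq; case: pselect => // e; case: cid. Qed.

Let unitqP x y : y * x = 1 -> unitq x.
Proof. by move=> yx; apply/asboolP; exists y. Qed.

Let invq_out : {in [predC unitq], invq =1 id}.
Proof. by move=> x /asboolP Nx; rewrite /invq; case: pselect. Qed.

HB.instance Definition _ :=
  GRing.ComNzRing_hasMulInverse.Build prime_quot mulVq unitqP invq_out.
HB.instance Definition _ :=
  GRing.ComUnitRing_isIntegral.Build prime_quot (@Quotient.rquot_IdomainAxiom R I).

Definition residue_map : {rmorphism R -> {fraction prime_quot}} :=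
  (@FracField.tofrac prime_quot) \o (\pi_(prime_quot)%qT : {rmorphism R -> prime_quot}).

Lemma residue_map_eq0 f : (residue_map f == 0) = (f \in I).
Proof.
by rewrite /= tofrac_eq0 -(rmorph0 (\pi_(prime_quot)%qT : {rmorphism R -> prime_quot}))
  -Quotient.idealrBE subr0.
Qed.

End PrimeQuotient.

(** This turns primes of a polynomial ring into points with coordinates in a field,
    to which the notions of algebraic dependence apply. *)
Lemma prime_ideal_kernel (R : comNzRingType) (q : set R) : is_ideal q -> ~ q 1 ->
  (forall f g, q (f * g) -> q f \/ q g) ->
  exists (Om : fieldType) (phi : {rmorphism R -> Om}), forall f, phi f = 0 <-> q f.
Proof.
move=> idq q1 qM; pose Q : pred R := fun f => `[< q f >].
have Qideal : idealr_closed Q.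
  split=> [||a u v /asboolP qu /asboolP qv].
  - by apply/asboolP; exact: (ideal0 idq).
  - by apply/asboolPn.
  - by apply/asboolP; apply: (idealD idq) => //; exact: (idealM idq).
have Qprime : prime_idealr_closed Q.
  by move=> u v /asboolP/qM[?|?]; apply/orP; [left|right]; apply/asboolP.
pose I1 := isIdealr.Build R Q Qideal.
pose I2 := isPrimeIdealrClosed.Build R Q Qprime.
pose I : prime_idealr R := HB.pack Q I1 I2.
exists {fraction prime_quot I}, (residue_map I) => f.
by rewrite (rwP eqP) residue_map_eq0; split=> /asboolP.
Qed.

Section Specialization.
Variables (K : fieldType) (n : nat).
Local Notation R := {mpoly K[n]}.

Definition sub_vars d (s : 'I_d -> 'I_n) : {mpoly K[d]} -> R :=
  mmap (mpolyC n (R := K)) (fun i => 'X_(s i)).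

Definition independent_mod (q : set R) d (s : 'I_d -> 'I_n) : Prop :=
  forall p : {mpoly K[d]}, q (sub_vars s p) -> p = 0.

Lemma mmap_sub_vars (F : fieldType) (iota : {rmorphism K -> F}) d (s : 'I_d -> 'I_n)
    (x : 'I_n -> F) p : mmap iota x (sub_vars s p) = mmap iota (x \o s) p.
Proof. by rewrite mmap_comp; apply: mmap_ext => i; rewrite mmap_XU. Qed.

(** The transcendence degree drops under a strict specialization: coordinates that
    are independent after specializing are independent before, and were they a
    transcendence basis, the constant coefficient of the equation of least degree
    of an element [f] that specializes to [0] would be a relation between their
    specializations. *)
Lemma specialization (Om : fieldType) (iota : {rmorphism K -> Om}) (xi : 'I_n -> Om)
    (q : set R) f d (s : 'I_d -> 'I_n) :
  is_ideal q -> (forall p, mmap iota xi p = 0 -> q p) -> q f -> mmap iota xi f <> 0 ->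
  independent_mod q s -> exists t : 'I_d.+1 -> 'I_n, alg_independent iota (xi \o t).
Proof.
move=> idq qxi qf fxi indq; apply: contrapT => Nt.
have inds : alg_independent iota (xi \o s).
  by move=> p ps; apply: indq; apply: qxi; rewrite mmap_sub_vars.
have clxi i : cl (range iota `|` range (xi \o s)) (xi i).
  apply: contrapT => Ni; apply: Nt.
  exists (extend s i); apply/alg_independentS.
  have -> : (xi \o extend s i) \o widen_ord (leqnSn d) = xi \o s.
    by apply/funext => k /=; rewrite extendE.
  by split=> //=; rewrite extend_max.
have clf : cl (range iota `|` range (xi \o s)) (mmap iota xi f).
  have sc := cl_subfield (range iota `|` range (xi \o s)).
  elim/mpoly_gen_ind: {qf fxi} f => [c|i|p r IHp IHr|p r IHp IHr].
  - by rewrite mmapC; apply: sub_cl; left; exists c.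
  - by rewrite mmap_XU.
  - by rewrite rmorphD; apply: (subfieldD sc).
  - by rewrite rmorphM; apply: (subfieldM sc).
have [Q0 annQ0] := (clP _ _ _).1 clf.
pose ann (Q : {poly {mpoly K[d]}}) := map_poly (mmap iota (xi \o s)) Q != 0 /\
  root (map_poly (mmap iota (xi \o s)) Q) (mmap iota xi f).
have [Q [[Qn0 Qf] Qmin]] : exists Q, ann Q /\ forall Q', ann Q' -> (size Q <= size Q')%N.
  by apply: exists_min; exists Q0.
(* Otherwise [Q] could be divided by its variable. *)
have Q00 : mmap iota (xi \o s) Q`_0 != 0.
  apply/eqP => Q00; pose Q' := Poly (behead Q).
  have Q'E i : Q'`_i = Q`_i.+1 by rewrite coef_Poly nth_behead.
  have QE : map_poly (mmap iota (xi \o s)) Q = map_poly (mmap iota (xi \o s)) Q' * 'X.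
    apply/polyP => i; rewrite coefMX !coef_map; case: i => [|i] //=.
    by rewrite Q'E.
  have : (size Q <= size Q')%N.
    apply: Qmin; split; first by apply: contraNneq Qn0; rewrite QE => ->; rewrite mul0r.
    move: Qf; rewrite QE rootM => /orP[//|]; rewrite rootX => /eqP //.
  have sQ : (0 < size Q)%N.
    by rewrite lt0n size_poly_eq0; apply: contraNneq Qn0 => ->; rewrite rmorph0.
  apply/negP; rewrite -ltnNge; apply: leq_ltn_trans (size_Poly _) _.
  by rewrite size_behead prednK.
pose Phi := \sum_(i < size Q) sub_vars s Q`_i * f ^+ i.
have qPhi : q Phi.
  apply: qxi; rewrite /Phi rmorph_sum /= -[RHS](rootP Qf).
  rewrite (@horner_coef_wide _ (size Q)) ?size_poly //; apply: eq_bigr => i _.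
  by rewrite rmorphM rmorphXn /= mmap_sub_vars coef_map.
have : Q`_0 = 0.
  apply: indq; have sQ : (0 < size Q)%N.
    by rewrite lt0n size_poly_eq0; apply: contraNneq Qn0 => ->; rewrite rmorph0.
  have -> : sub_vars s Q`_0 =
      Phi - \sum_(i < size Q | i != Ordinal sQ) sub_vars s Q`_i * f ^+ i.
    by rewrite /Phi (bigD1 (Ordinal sQ)) //= expr0 mulr1 addrK.
  apply: (idealB idq) => //; apply: (ideal_sum idq) => i i0.
  have : (0 < i)%N by rewrite lt0n; apply: contraNneq i0 => i0; apply/eqP/val_inj.
  by case: (i : nat) => // k _; rewrite exprSr mulrA; exact: (idealM idq).
by move=> Q00'; move: Q00; rewrite Q00' rmorph0 eqxx.
Qed.

(** Each inclusion of the chain gives one more independent variable, starting from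
    none modulo the largest prime. *)
Lemma prime_chain_independent (q : nat -> set R) e :
  (forall i, (i <= e)%N -> [/\ is_ideal (q i), ~ q i 1 &
     forall f g, q i (f * g) -> q i f \/ q i g]) ->
  (forall i, (i < e)%N -> q i `<` q i.+1) ->
  forall k, (k <= e)%N -> exists s : 'I_k -> 'I_n, independent_mod (q (e - k)%N) s.
Proof.
move=> qprime qlt; elim=> [_|k IHk ke].
  exists (fun i => widen_ord (leq0n n) i) => p; rewrite subn0 [p]nvar0_mpolyC.
  have [idq q1 _] := qprime e (leqnn e).
  rewrite /sub_vars mmapC => qc; have [->|c0] := eqVneq p@_0 0; first by rewrite mpolyC0.
  case: q1; rewrite -(mpolyC1 n K) -(mulVf c0) mpolyCM.
  exact: (idealM idq).
have [s inds] := IHk (ltnW ke).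
have ek : (e - k.+1).+1 = (e - k)%N by rewrite -subSn // subSS.
have [_ q1 qM] := qprime (e - k.+1)%N (leq_subr _ _).
have [idq' _ _] := qprime (e - k)%N (leq_subr _ _).
have [idq _ _] := qprime (e - k.+1)%N (leq_subr _ _).
have := qlt (e - k.+1)%N; rewrite ek leq_subr => /(_ isT)/properEPn[qq' [f [qf Nqf]]].
have [Om [phi phiE]] := prime_ideal_kernel idq q1 qM.
pose iota : {rmorphism K -> Om} := phi \o mpolyC n (R := K).
have phiM p : mmap iota (fun i => phi 'X_i) p = phi p.
  rewrite -[in RHS](mmap_mpolyC_X p); symmetry; exact: (mmap_morph (h := phi)).
have [||t indt] := specialization (iota := iota) (xi := fun i => phi 'X_i) idq' _ qf _ inds.
- by move=> p; rewrite phiM => /phiE/qq'.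
- by rewrite phiM => /phiE.
exists t => p /phiE; rewrite -phiM mmap_sub_vars; exact: indt.
Qed.

End Specialization.

(** Primes of the localization contract to distinct primes of the polynomial ring,
    all of which contain the relations between the coordinates. *)
Lemma localization_chain_independent (K F : fieldType) (iota : {rmorphism K -> F}) n
    (x : 'I_n -> F) (p : set F) d :
  prime_ideal (chart_ring iota x) p -> prime_chain (localization (chart_ring iota x) p) d ->
  exists s : 'I_d -> 'I_n, alg_independent iota (x \o s).
Proof.
move=> pp [P [Pprime Plt]]; pose o := localization (chart_ring iota x) p.
pose q i : set {mpoly K[n]} := [set f | P i (mmap iota x f)].
have A1 : chart_ring iota x 1 by exists 1; rewrite ?rmorph1.
have Np1 : ~ p 1 by exact: prime_ideal_proper pp.
have Ao f : o (mmap iota x f).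
  by exists (mmap iota x f), 1; rewrite divr1; split=> //; exists f.
have [||s inds] := @prime_chain_independent K n q d _ _ d (leqnn d).
- move=> i id; have PP := Pprime i id; split.
  + split; rewrite /q /=.
    * by rewrite rmorph0; exact: prime_ideal0 PP.
    * by move=> f g Pf Pg; rewrite rmorphD; exact: (prime_idealD PP Pf Pg).
    * by move=> f g Pg; rewrite rmorphM; exact: (prime_idealM PP (Ao f) Pg).
  + by rewrite /q /= rmorph1; exact: prime_ideal_proper PP.
  + by move=> f g; rewrite /q /= rmorphM => /(prime_ideal_prime PP (Ao f) (Ao g)).
- move=> i id; have PP := Pprime i (ltnW id); have PP' := Pprime i.+1 id.
  have /properEPn[sub [z [Pz NPz]]] := Plt i id.
  apply/properEPn; split=> [f|]; first exact: sub.
  have [_ [b [[f _ <-] [g _ <-] Nb zE]]] := prime_ideal_sub PP' Pz.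
  have b0 : mmap iota x g != 0.
    by apply/eqP => b0; apply: Nb; rewrite b0; exact: prime_ideal0 pp.
  have fE : mmap iota x f = mmap iota x g * z by rewrite zE mulrC divfK.
  exists f; rewrite /q /=; split; first by rewrite fE; exact: (prime_idealM PP' (Ao g) Pz).
  move=> Pf; apply: NPz; rewrite zE mulrC; apply: (prime_idealM PP) => //.
  by exists 1, (mmap iota x g); rewrite div1r; split=> //; exists g.
exists s => u us; apply: inds; rewrite subnn /q /= mmap_sub_vars us.
exact: prime_ideal0 (Pprime 0%N isT).
Qed.

(** * Formal arcs through a nonsingular point *)

Lemma row_free_complete (K : fieldType) m d (A : 'M[K]_(m, m + d)) : \rank A = m ->
  exists L : 'M[K]_(d, m + d), col_mx A L \in unitmx.
Proof.
move=> rA; have rC : \rank (A^C)%MS = d by rewrite mxrank_compl rA addKn.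
exists (castmx (rC, erefl) (row_base (A^C)%MS)).
rewrite -row_full_unit -sub1mx -addsmxE.
rewrite (submx_trans (_ : 1%:M <= A + A^C)%MS) ?sub1mx ?addsmx_compl_full //.
by rewrite addsmxS // eqmx_cast eq_row_base.
Qed.

Lemma unitmx_col_mx_rank (K : fieldType) m d (A : 'M[K]_(m, m + d)) L :
  col_mx A L \in unitmx -> \rank A = m.
Proof.
rewrite -row_free_unit /row_free => /eqP rAL; apply/eqP.
rewrite eqn_leq rank_leq_row -(leq_add2r d) -[X in (X <= _)%N]rAL -addsmxE.
rewrite (leq_trans (mxrank_adds_leqif _ _)) // leq_add2l; exact: rank_leq_row.
Qed.

(** [D] is the determinant of the Jacobian matrix of [h], completed by constant rows
    that make it invertible at [a]. *)
Lemma jacobian_minor (K : fieldType) m d (h : 'I_m -> {mpoly K[m + d]})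
    (a : 'I_(m + d) -> K) : \rank (jacobian_at h a) = m ->
  exists D : {mpoly K[m + d]}, D.@[a] != 0 /\
    forall (Om : fieldType) (j : {rmorphism K -> Om}) (y : 'I_(m + d) -> Om),
      mmap j y D != 0 -> \rank (\matrix_(k < m, l < m + d) mmap j y (h k)^`M(l)) = m.
Proof.
move=> /row_free_complete[L uL].
pose M : 'M[{mpoly K[m + d]}]_(m + d) :=
  col_mx (\matrix_(k, l) (h k)^`M(l)) (map_mx (mpolyC (m + d) (R := K)) L).
have mapM (Om : fieldType) (j : {rmorphism K -> Om}) (y : 'I_(m + d) -> Om) :
    map_mx (mmap j y) M = col_mx (\matrix_(k < m, l < m + d) mmap j y (h k)^`M(l)) (map_mx j L).
  rewrite map_col_mx; congr col_mx; apply/matrixP => k l; rewrite !mxE //.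
  by rewrite mmapC.
exists (\det M); split=> [|Om j y].
  have -> : (\det M).@[a] = \det (col_mx (jacobian_at h a) L).
    rewrite /meval -det_map_mx mapM; congr (\det (col_mx _ _)).
    by apply/matrixP => k l; rewrite mxE.
  by move: uL; rewrite unitmxE unitfE.
by rewrite -det_map_mx -unitfE -unitmxE mapM; exact: unitmx_col_mx_rank.
Qed.

Section Arcs.
Variables (K : fieldType) (m d : nat).
Local Notation n := (m + d)%N.
Local Notation R := {mpoly K[n]}.
Variables (a : 'I_n -> K) (h : 'I_m -> R) (L : 'M[K]_(d, n)).
Hypothesis ha : forall k, (h k).@[a] = 0.
Hypothesis uL : col_mx (jacobian_at h a) L \in unitmx.

Definition affine_forms e (N : 'M[K]_(e, n)) : 'I_e -> R :=
  fun k => \sum_i (N k i)%:MP * ('X_i - (a i)%:MP).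

Lemma affine_forms_at e (N : 'M[K]_(e, n)) k : (affine_forms N k).@[a] = 0.
Proof.
rewrite /affine_forms raddf_sum big1 // => i _ /=.
by rewrite mevalM mevalB mevalXU !mevalC subrr mulr0.
Qed.

Lemma jacobian_affine e (N : 'M[K]_(e, n)) :
  jacobian_at (stack h (affine_forms N)) a = col_mx (jacobian_at h a) N.
Proof.
apply/matrixP => k l; rewrite mxE; case: (split_ordP k) => {}k ->.
  by rewrite stack_l col_mxEu mxE.
rewrite stack_r col_mxEd /affine_forms (raddf_sum (mderiv l)) raddf_sum /=.
rewrite (bigD1 l) //= big1 ?addr0 => [|i il].
  rewrite mderivM mderivC mul0r add0r mderivB mderivC subr0 mderiv_XU eqxx.
  by rewrite mevalM !mevalC mulr1.
rewrite mderivM mderivC mul0r add0r mderivB mderivC subr0 mderiv_XU (negbTE il).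
by rewrite mevalM !mevalC mulr0.
Qed.

Let l := affine_forms L.

Section Arc.
Variables (Lam : fieldType) (j : {rmorphism K -> Lam}) (c : 'I_d -> Lam).
Local Notation hc := (hconst Lam int).

(** The arc with direction [c] at the point [a] of the variety [h = 0]. *)
Definition is_arc (xi : 'I_n -> hahn Lam int) : Prop :=
  [/\ forall i, ser_ge 1 (xi i - lconst j (a i)),
      forall k, mmap (lconst j) xi (h k) = 0 &
      forall k, mmap (lconst j) xi (l k) = hc (c k) * svar].

Lemma arc_exists : exists xi, is_arc xi.
Proof.
have FV := ser_ge_filtrationK j.
have h0 i : (stack h l i).@[a] = 0.
  by case: (split_ordP i) => k ->; rewrite ?stack_l ?stack_r // affine_forms_at.
pose b (i : 'I_n) : hahn Lam int := match fintype.split i with inl _ => 0 | inr k => hc (c k) * svar end.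
have [||xi [Vxi xiE]] := implicit_function j h0 _ (b := b).
- by rewrite jacobian_affine.
- move=> i; rewrite /b; case: (fintype.split i) => k; first exact: (filt0 FV).
  by apply: (filtMl (ser_ge_filtration Lam)); [exact: (filtC (ser_ge_filtration Lam)) | exact: svar_ge].
exists xi; split=> // k; first by rewrite -(stack_l h l k) xiE /b -[lshift _ _]/(unsplit (inl k)) unsplitK.
by rewrite -(stack_r h l k) xiE /b -[rshift _ _]/(unsplit (inr k)) unsplitK.
Qed.

Variable xi : 'I_n -> hahn Lam int.
Hypothesis arc : is_arc xi.

Lemma arc_point_pow N w : point_pow a N w -> ser_ge N (mmap (lconst j) xi w).
Proof.
have [Vxi _ _] := arc; have FV := ser_ge_filtrationK j.
elim: N w => [|N IHN] w; first by move=> _; exact: (filt_mmap FV w Vxi).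
move=> [r [Vr ->]]; rewrite rmorph_sum; apply: (filt_sum FV) => i _.
rewrite rmorphM rmorphB /= mmap_XU mmapC -addn1.
exact: (filtM FV (IHN _ (Vr i)) (Vxi i)).
Qed.

(** Along the arc the coordinates [l] are the multiples [c] of the parameter. *)
Lemma arc_homog k (u : {mpoly K[d]}) : u \is k.-homog ->
  mmap (lconst j) xi (sub_coords l u) = hc (mmap j c u) * svar ^+ k.
Proof.
have [_ _ lxi] := arc; move=> /dhomogP uk.
rewrite /sub_coords mmap_comp (mmap_ext _ _ lxi).
rewrite /mmap rmorph_sum mulr_suml [LHS]big_seq [RHS]big_seq; apply: eq_bigr => q /uk qk.
have {}qk : mdeg q = k := qk.
rewrite rmorphM /= -mulrA; congr (_ * _); rewrite /mmap1 rmorph_prod -qk mdegE.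
rewrite expr_sum -big_split; apply: eq_bigr => i _ /=.
by rewrite exprMn rmorphXn.
Qed.

Lemma svarX k : (svar ^+ k : hahn Lam int) = hsingle (k%:Z : int) 1.
Proof.
elim: k => [|k IHk]; first by [].
rewrite exprS IHk; apply: hahnP => g.
rewrite [LHS]hmulE (@hsum_supp _ _ _ [fset (1 : int)]%fset).
  rewrite big_seq_fset1 /= mul1r; congr (if _ then _ else _).
  by rewrite subr_eq -PoszD addn1.
by move=> b /= /mulKneq0[]; case: eqP => [-> _|//]; rewrite inE eqxx.
Qed.

(** The coefficients of [f] along the arc are the values at [c] of the homogeneous
    parts of the Taylor expansion of [f], which do not depend on the arc. *)
Lemma arc_coef N f (u : nat -> {mpoly K[d]}) g k : (forall k, u k \is k.-homog) ->
  (exists r : 'I_m -> R, g = \sum_k r k * h k) ->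
  point_pow a N (f - \sum_(k < N) sub_coords l (u k) - g) -> (k < N)%N ->
  mmap (lconst j) xi f k%:Z = mmap j c (u k).
Proof.
have [Vxi hxi _] := arc; move=> uh [r ->] /arc_point_pow; rewrite !rmorphB /=.
have -> : mmap (lconst j) xi (\sum_k r k * h k) = 0.
  by rewrite rmorph_sum big1 // => q _; rewrite rmorphM /= hxi mulr0.
rewrite subr0 => Vf kN; have := Vf k%:Z; rewrite ltz_nat kN hcoefD hcoefN => /(_ isT).
move=> /eqP; rewrite subr_eq0 => /eqP ->; rewrite rmorph_sum /=.
under eq_bigr => q _ do rewrite (arc_homog (uh q)) svarX.
have coef_sum (s : seq 'I_N) (E : 'I_N -> hahn Lam int) :
    (\sum_(q <- s) E q) k%:Z = \sum_(q <- s) E q k%:Z.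
  by apply: (big_morph (fun z : hahn Lam int => z k%:Z)) => [//|]; rewrite hcoef0.
rewrite coef_sum (bigD1 (Ordinal kN)) //= big1 ?addr0.
  by rewrite [LHS]hsingle0_mul /= eqxx mulr1.
move=> q qk; rewrite [LHS]hsingle0_mul /=; case: eqP => [[kq]|_]; last by rewrite mulr0.
by case/eqP: qk; apply: val_inj.
Qed.

Lemma arc_eq0 f : (forall k : nat, mmap (lconst j) xi f k%:Z = 0) -> mmap (lconst j) xi f = 0.
Proof.
have [Vxi _ _] := arc; have V0 := filt_mmap (ser_ge_filtrationK j) f Vxi.
by move=> f0; apply: hahnP => -[g|g]; rewrite hcoef0 ?f0 // V0.
Qed.

Lemma arc_neq0 f : f.@[a] != 0 -> mmap (lconst j) xi f != 0.
Proof.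
have [Vxi _ _] := arc; have := filt_meval (ser_ge_filtrationK j) f Vxi.
move=> /(_ 0) V fa; apply/eqP => f0; move: V; rewrite f0 sub0r hcoefN /=.
by move=> /(_ isT)/eqP; rewrite oppr_eq0 fmorph_eq0 (negbTE fa).
Qed.

End Arc.
End Arcs.

Lemma nonzero_value (K : fieldType) : infinite_set [set: K] ->
  forall d (u : {mpoly K[d]}), u != 0 -> exists c : 'I_d -> K, u.@[c] != 0.
Proof.
move=> Kinf; elim=> [|d IHd] u u0.
  exists (fun=> 0); apply: contraNneq u0; rewrite [u]nvar0_mpolyC mevalC => ->.
  by rewrite mpolyC0.
have : muni u != 0.
  by apply: contraNneq u0 => u0; rewrite -(muniK u) u0 last_horner0.
rewrite -lead_coef_eq0 => /IHd[c lc].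
have pn0 : map_poly (meval c) (muni u) != 0.
  by rewrite -lead_coef_eq0 lead_coef_map_eq // -lead_coef_eq0.
have [z /rootP/eqP Nz] : exists z, ~~ root (map_poly (meval c) (muni u)) z.
  apply: contrapT => no; apply: Kinf; have [rs rsP] := roots_in_seq pn0.
  apply: (sub_finite_set (B := [set` rs])) => [z _|]; last exact: finite_seq.
  by apply: rsP; apply: contrapT => /negP Nz; apply: no; exists z.
by exists (extend c z); rewrite -(muniK u) /meval mmap_last_horner extend_max extend_widen.
Qed.

Lemma annihilator (K : fieldType) d (c : 'I_d -> K) : (exists k, c k != 0) ->
  exists N : 'M[K]_(d.-1, d), \rank N = d.-1 /\ forall i, \sum_k N i k * c k = 0.
Proof.
move=> [k0 ck0]; pose C : 'cV[K]_d := \col_k c k.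
have rC : \rank C = 1%N.
  apply/eqP; rewrite eqn_leq rank_leq_col lt0n mxrank_eq0.
  by apply: contraNneq ck0 => C0; have := congr1 (fun A : 'cV_d => A k0 0) C0; rewrite !mxE => ->.
have rk : \rank (kermx C) = d.-1 by rewrite mxrank_ker rC subn1.
exists (castmx (rk, erefl) (row_base (kermx C))); split.
  by rewrite eqmx_cast eq_row_base.
move=> i; have /sub_kermxP/matrixP/(_ i 0) : (castmx (rk, erefl) (row_base (kermx C)) <= kermx C)%MS.
  by rewrite eqmx_cast eq_row_base.
rewrite mxE [RHS]mxE => e0; rewrite -[RHS]e0; apply: eq_bigr => k _.
by rewrite [C _ _]mxE.
Qed.

Lemma affine_formsM (K : fieldType) m d e (a : 'I_(m + d) -> K) (N : 'M[K]_(e, d))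
    (L : 'M[K]_(d, m + d)) k :
  affine_forms a (N *m L) k = \sum_q (N k q)%:MP * affine_forms a L q.
Proof.
rewrite /affine_forms; under [RHS]eq_bigr => q _ do rewrite mulr_sumr.
rewrite exchange_big /=; apply: eq_bigr => i _; rewrite mxE rmorph_sum mulr_suml.
by apply: eq_bigr => q _; rewrite rmorphM mulrA.
Qed.

Section GeneralArc.
Variables (K F : fieldType) (iota : {rmorphism K -> F}) (m d : nat).
Local Notation n := (m + d)%N.
Local Notation R := {mpoly K[n]}.
Variables (x : 'I_n -> F) (a : 'I_n -> K) (h : 'I_m -> R) (s : 'I_d -> 'I_n).
Hypothesis xa : forall f, mmap iota x f = 0 -> f.@[a] = 0.
Hypothesis hx : forall k, mmap iota x (h k) = 0.
Hypothesis rh : \rank (jacobian_at h a) = m.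
Hypothesis inds : alg_independent iota (x \o s).

Let I : set R := [set f | mmap iota x f = 0].

Let idI : is_ideal I.
Proof.
rewrite /I; split=> /=; first by rewrite rmorph0.
  by move=> f g f0 g0; rewrite rmorphD /= f0 g0 addr0.
by move=> f g g0; rewrite rmorphM /= g0 mulr0.
Qed.

Let ha k : (h k).@[a] = 0. Proof. by apply: xa. Qed.

Section GenericArc.
Variable L : 'M[K]_(d, n).
Hypothesis uL : col_mx (jacobian_at h a) L \in unitmx.
Let l := affine_forms a L.

Let Lam : fieldType := {fraction {mpoly K[d]}}.
Let j : {rmorphism K -> Lam} := (@FracField.tofrac {mpoly K[d]}) \o mpolyC d (R := K).
Let c (k : 'I_d) : Lam := FracField.tofrac 'X_k.

Let genericE u : mmap j c u = FracField.tofrac u.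
Proof.
rewrite -[in RHS](mmap_mpolyC_X u).
by rewrite (mmap_morph (j' := j) (h := @FracField.tofrac {mpoly K[d]})).
Qed.

Variable xi : 'I_n -> hahn Lam int.
Hypothesis arc : is_arc a h L j c xi.

Let uJ : jacobian_at (stack h l) a \in unitmx. Proof. by rewrite jacobian_affine. Qed.

Let taylor f N := taylor_coordinates ha (affine_forms_at a L) uJ f N.

(** The direction of the generic arc consists of variables, at which no nonzero
   form vanishes. *)
Let generic_vanish f N (u : nat -> {mpoly K[d]}) g k : mmap (lconst j) xi f = 0 ->
  (forall k, u k \is k.-homog) -> (exists r : 'I_m -> R, g = \sum_k r k * h k) ->
  point_pow a N (f - \sum_(k < N) sub_coords l (u k) - g) -> (k < N)%N -> u k = 0.
Proof.
move=> f0 uk gh Vf kN; have := arc_coef arc uk gh Vf kN.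
by rewrite f0 hcoef0 genericE => /esym/eqP; rewrite tofrac_eq0 => /eqP.
Qed.

(** The ideal of the generic arc is contained in the ideal of [x] by Krull's
    theorem, and it is not smaller, because the transcendence degree of the
    coordinates of the generic arc is at most [d]. *)
Lemma generic_arc_ideal f : mmap (lconst j) xi f = 0 <-> mmap iota x f = 0.
Proof.
have sub g : mmap (lconst j) xi g = 0 -> mmap iota x g = 0.
  move=> g0; have [|t ta tg] := krull_intersection (a := a) (I := I) (f := g) idI.
    move=> N; have [u uk [e eh Ve]] := taylor g N; exists e.
      by have [r ->] := eh; apply: (ideal_sum idI) => k _; apply: (idealM idI); exact: hx.
    suff <- : g - \sum_(k < N) sub_coords l (u k) - e = g - e by [].
    rewrite big1 ?subr0 // => k _.
    by rewrite (generic_vanish g0 uk eh Ve (ltn_ord k)) /sub_coords rmorph0.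
  have := tg; rewrite /I /= rmorphM /= => /eqP; rewrite mulf_eq0 => /orP[] /eqP // t0.
  by have := xa t0; rewrite ta => /eqP; rewrite oner_eq0.
split=> [|f0]; first exact: sub.
apply: contrapT => fxi.
have [t indt] := specialization idI sub f0 fxi
  (fun p => fun sp => inds (etrans (esym (mmap_sub_vars iota s x p)) sp)).
have [G [ys [Gh ysx rys]]] := jacobian_criterion (lconst j) xi.
have [D [Da DJ]] := jacobian_minor rh.
have rG : (m <= \rank G)%N.
  rewrite -[X in (X <= _)%N](DJ _ (lconst j) xi (arc_neq0 arc Da)).
  apply: mxrankS; apply/row_subP => k; have [_ hxi _] := arc.
  by have := Gh _ (hxi k); congr (_ <= G)%MS; apply/rowP => q; rewrite !mxE.
have := alg_independent_le indt (fun i => ysx (t i)).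
apply/negP; rewrite -leqNgt -(leq_add2l m); apply: leq_trans rys.
by rewrite leq_add2r.
Qed.

Hypothesis Kinf : infinite_set [set: K].
Hypothesis d_gt0 : (0 < d)%N.

(** A direction at which a nonzero homogeneous part of the Taylor expansion of [g]
    does not vanish is enough for [g]; the factor ['X_i0] makes the direction
    nonzero. Relations of [x] vanish on the generic arc, so that their Taylor
    expansions, and hence their values on every arc, are zero. *)
Lemma special_direction g : mmap iota x g <> 0 -> exists b : 'I_d -> K,
  (exists k, b k != 0) /\ forall eta, is_arc a h L idfun b eta ->
    (forall f, mmap iota x f = 0 -> mmap (lconst (idfun : {rmorphism K -> K})) eta f = 0) /\
    mmap (lconst (idfun : {rmorphism K -> K})) eta g <> 0.
Proof.
move=> gx.
have [k gk] : exists k : nat, mmap (lconst j) xi g k%:Z <> 0.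
  apply: contrapT => no; apply: gx; apply/generic_arc_ideal; apply: (arc_eq0 arc) => k.
  by apply: contrapT => gk; apply: no; exists k.
have [u uk [e eh Ve]] := taylor g k.+1.
have uk0 : u k != 0.
  apply: contra_notN gk => /eqP uk0.
  by rewrite (arc_coef arc uk eh Ve (ltnSn k)) uk0 rmorph0.
pose i0 := Ordinal d_gt0.
have [|b] := nonzero_value Kinf (u := 'X_i0 * u k).
  by rewrite mulf_neq0 // -mleadc_eq0 mleadXm mcoeffX eqxx oner_eq0.
rewrite mevalM mevalXU mulf_eq0 negb_or => /andP[bi0 ub].
exists b; split=> [|eta arceta]; first by exists i0.
split=> [f f0|ge]; last first.
  have := arc_coef arceta uk eh Ve (ltnSn k).
  by rewrite ge hcoef0 => /esym/eqP; apply/negP.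
apply: (arc_eq0 arceta) => q; have [v vk [e' eh' Ve']] := taylor f q.+1.
have f0' := (generic_arc_ideal f).2 f0.
by rewrite (arc_coef arceta vk eh' Ve' (ltnSn q)) (generic_vanish f0' vk eh' Ve') // rmorph0.
Qed.

End GenericArc.

(** Among the equations of the curve traced by the arc are, besides [h], the linear
    combinations of the local coordinates that vanish in its direction. *)
Theorem general_arc g : infinite_set [set: K] -> (0 < d)%N -> mmap iota x g <> 0 ->
  exists xi : 'I_n -> hahn K int,
  [/\ forall i, ser_ge 1 (xi i - hconst K int (a i)),
      forall f, mmap iota x f = 0 -> mmap (hconst K int) xi f = 0,
      mmap (hconst K int) xi g <> 0,
      exists i, xi i <> hconst K int (a i) &
      exists e (h' : 'I_e -> R), [/\ e.+1 = n,
        forall k, mmap (hconst K int) xi (h' k) = 0 &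
        \rank (jacobian_at h' a) = e]].
Proof.
move=> Kinf d0 gx; have [L uL] := row_free_complete rh.
have [xig arcg] := arc_exists ha uL ((@FracField.tofrac {mpoly K[d]}) \o mpolyC d (R := K))
  (fun k => FracField.tofrac 'X_k).
have [b [[k0 bk0] bP]] := special_direction uL arcg Kinf d0 gx.
have [xi arcxi] := arc_exists ha uL idfun b; have [Ixi gxi] := bP _ arcxi.
have [Vxi hxi lxi] := arcxi.
exists xi; split=> //.
  apply: contrapT => no; have xiE i : xi i = hconst K int (a i).
    by apply: contrapT => xia; apply: no; exists i.
  have := lxi k0; rewrite (mmap_ext _ (z := fun i => lconst (idfun : {rmorphism K -> K}) (a i))) //.
  rewrite mmap_meval affine_forms_at rmorph0.
  move=> /(congr1 (fun z : hahn K int => z 1)); rewrite hcoef0 [RHS]hsingle0_mul /= mulr1.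
  by move/esym/eqP; apply/negP.
have [N [rN Nb]] := annihilator (ex_intro _ k0 bk0).
exists (m + d.-1)%N, (stack h (affine_forms a (N *m L))); split.
- by rewrite -addnS prednK.
- move=> k; case: (split_ordP k) => q ->; first by rewrite stack_l; exact: hxi.
  rewrite stack_r affine_formsM rmorph_sum.
  transitivity (\sum_i hconst K int (N q i * b i) * (svar : hahn K int)).
    apply: eq_bigr => i _; rewrite rmorphM /= mmapC rmorphM /= -mulrA; congr (_ * _).
    exact: lxi.
  by rewrite -mulr_suml -rmorph_sum Nb rmorph0 mul0r.
- rewrite jacobian_affine.
  have -> : col_mx (jacobian_at h a) (N *m L) =
      block_mx 1%:M 0 0 N *m col_mx (jacobian_at h a) L.
    by rewrite mul_block_col !mul0mx mul1mx addr0 add0r.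
  by rewrite mxrankMfree ?row_free_unit // rank_diag_block_mx mxrank1 rN.
Qed.

End GeneralArc.

(** * Places and algebraic elements *)

Section PlaceTheory.
Variables (L : fieldType) (P : place L).

Lemma place0 : P 0 = Some 0.
Proof.
case e : (P 0) => [c|]; last by have := placeV e; rewrite invr0 e.
have := placeD e e; rewrite addr0 e => -[/esym/eqP].
by rewrite -subr_eq0 addrK => /eqP ->.
Qed.

Lemma placeN x a : P x = Some a -> P (- x) = Some (- a).
Proof.
have [b b1] : exists b, P (-1) = Some b.
  case e : (P (-1)) => [b|]; first by exists b.
  by have := placeV e; rewrite invrN invr1 e.
have bE : b = -1.
  have := placeD (place1 P) b1; rewrite subrr place0 => -[/esym/eqP].
  by rewrite addr_eq0 eq_sym eqr_oppLR => /eqP.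
by move=> xa; have := placeM b1 xa; rewrite bE !mulN1r.
Qed.

Variables (K : fieldType) (iota : {rmorphism K -> L}).

Lemma cl_range z : cl (range iota) z -> exists2 p, p != 0 & root (map_poly iota p) z.
Proof.
have sK : is_subfield (range iota).
  split=> [|_ _ [c _ <-] [d _ <-]|_ _ [c _ <-] [d _ <-]].
  - by exists 1; rewrite ?rmorph1.
  - by exists (c - d); rewrite ?rmorphB.
  - by exists (c / d); rewrite ?fmorph_div.
move=> [q [q0 Kq qz]]; have cE i : exists c, iota c = q`_i.
  by have [c _ cE] := fgen_min sK (@subset_refl _ _) (Kq i); exists c.
have qE : q = map_poly iota (\poly_(i < size q) sval (cid (cE i))).
  apply/polyP => i; rewrite coef_map coef_poly; case: ltnP => iq /=.
    by case: (cid (cE i)) => c /= ->.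
  by rewrite nth_default // rmorph0.
exists (\poly_(i < size q) sval (cid (cE i))); last by rewrite -qE.
by apply: contraNneq q0 => e; rewrite qE e rmorph0.
Qed.

Hypothesis Ptriv : trivial_on iota P.

Lemma place_const c : exists2 b, P (iota c) = Some b & b = 0 -> c = 0.
Proof.
case e : (P (iota c)) (@Ptriv c) => [b|] // _; exists b => // b0.
apply: contrapT => /eqP c0; case e' : (P (iota c^-1)) (@Ptriv c^-1) => [b'|] // _.
have := placeM e e'; rewrite -rmorphM divff // rmorph1 place1 b0 mul0r => -[/eqP].
by rewrite oner_eq0.
Qed.

(** The place maps an equation of least degree of [w] to its constant coefficient,
    which would therefore be [0]. *)
Lemma place_algebraic0 w : P w = Some 0 -> cl (range iota) w -> w = 0.
Proof.
move=> Pw /cl_range[p0 p00 p0w].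
have [p [[pn0 pw] pmin]] : exists p, (p != 0 /\ root (map_poly iota p) w) /\
    forall q, q != 0 /\ root (map_poly iota q) w -> (size p <= size q)%N.
  by apply: (exists_min (fun p : {poly K} => size p)); exists p0.
apply: contrapT => /eqP w0.
have Pq (q : {poly K}) : exists b, P (map_poly iota q).[w] = Some b.
  elim/poly_ind: q => [|q c [b IHq]]; first by exists 0; rewrite rmorph0 horner0 place0.
  have [b' Pc _] := place_const c; exists (b * 0 + b').
  rewrite rmorphD rmorphM /= map_polyX map_polyC hornerMXaddC.
  exact: placeD (placeM IHq Pw) Pc.
elim/poly_ind: p => [|q c _] in pn0 pw pmin *; first by rewrite eqxx in pn0.
have qw : (map_poly iota q).[w] * w + iota c = 0.
  by have := rootP pw; rewrite rmorphD rmorphM /= map_polyX map_polyC hornerMXaddC.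
have c0 : c = 0.
  have [b Pb] := Pq q; have [b' Pc] := place_const c; apply.
  have := placeD (placeM Pb Pw) Pc; rewrite qw place0 mulr0 add0r => -[<-] //.
have qn0 : q != 0 by apply: contraNneq pn0 => ->; rewrite c0 mul0r add0r.
have : (size (q * 'X + c%:P)%R <= size q)%N.
  apply: pmin; split=> //; apply/rootP/(mulIf w0); rewrite mul0r.
  by rewrite -[LHS]addr0 -[X in _ + X](rmorph0 iota) -c0.
by rewrite c0 addr0 size_mulX // ltnn.
Qed.

Lemma place_algebraic z : rational_place iota P -> cl (range iota) z -> exists c, z = iota c.
Proof.
move=> [_ Psurj] clz; have sK := cl_subfield (range iota).
have clK c : cl (range iota) (iota c) by apply: sub_cl; exists c.
case e : (P z) => [b|].
  have [c Pc] := Psurj b; exists c; apply/eqP; rewrite -subr_eq0; apply/eqP.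
  apply: place_algebraic0; first by rewrite (placeD e (placeN Pc)) subrr.
  exact: (subfieldB sK).
have z0 : z^-1 = 0.
  apply: place_algebraic0 (placeV e) _.
  by rewrite -div1r; apply: (subfieldV sK) => //; exact: (subfield1 sK).
by move: e; rewrite -[z]invrK z0 invr0 place0.
Qed.

End PlaceTheory.

(** * The canonical place of a power series field *)

Section HahnPlace.
Variables (K : fieldType) (G : orderedGroupType).
Local Notation H := (hahn K G).

Definition integral_series (z : H) : Prop := forall g, og_lt g 0 -> z g = 0.

Definition hahn_residue (z : H) : option K :=
  if pselect (integral_series z) is left _ then Some (z 0) else None.

Lemma hahn_residue_some z b : hahn_residue z = Some b <-> integral_series z /\ z 0 = b.
Proof.
rewrite /hahn_residue; case: pselect => [iz|niz]; last by split=> // -[].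
by split=> [[<-]|[_ ->]].
Qed.

Lemma hahn_residue_none z : hahn_residue z = None -> ~ integral_series z.
Proof. by rewrite /hahn_residue; case: pselect. Qed.

Lemma hahn_residue1 : hahn_residue 1 = Some 1.
Proof.
apply/hahn_residue_some; split=> [g g0|]; last by rewrite /= eqxx.
by rewrite /= og_lt_eqF.
Qed.

Lemma hahn_residueD x y a b : hahn_residue x = Some a -> hahn_residue y = Some b ->
  hahn_residue (x + y) = Some (a + b).
Proof.
move=> /hahn_residue_some[ix xa] /hahn_residue_some[iy yb]; apply/hahn_residue_some.
by split=> [g g0|]; rewrite hcoefD; [rewrite ix // iy // addr0 | rewrite xa yb].
Qed.

Lemma hahn_residueM x y a b : hahn_residue x = Some a -> hahn_residue y = Some b ->
  hahn_residue (x * y) = Some (a * b).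
Proof.
move=> /hahn_residue_some[ix xa] /hahn_residue_some[iy yb]; apply/hahn_residue_some.
have neg (g c : G) : og_le g 0 -> ~~ og_lt c 0 -> og_lt g 0 || (c != 0) -> og_lt (g - c) 0.
  rewrite -og_leNgt => g0 c0 gc0; rewrite -(og_ltD2rE c) subrK add0r.
  move: gc0; case/orP => [gl|cn]; first by apply: contraNN gl; exact: og_le_trans c0.
  by apply: (og_le_lt_trans g0); rewrite og_lt_neqAle eq_sym cn.
split=> [g g0|].
  rewrite [LHS]hmulE; apply: fsbig1 => c _; have [c0|c0] := boolP (og_lt c 0).
    by rewrite ix ?mul0r.
  by rewrite iy ?mulr0 // neg ?g0 ?og_ltW.
rewrite [LHS]hmulE (@hsum_supp _ _ _ [fset (0 : G)]%fset).
  by rewrite big_seq_fset1 subr0 xa yb.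
move=> c /mulKneq0[xc yc]; rewrite inE; apply/eqP; apply: contrapT => /eqP c0.
have [cl0|cl0] := boolP (og_lt c 0); first by rewrite ix in xc.
by apply: yc; apply: iy; rewrite neg ?og_lexx ?c0 ?orbT.
Qed.

(** The least exponent of [x^-1] is the opposite of that of [x]. *)
Lemma hahn_residueV x : hahn_residue x = None -> hahn_residue x^-1 = Some 0.
Proof.
move=> /hahn_residue_none Nix; have x0 : x != 0.
  by apply/eqP => x0; apply: Nix => g _; rewrite x0 hcoef0.
have [m xm mmin] := hahn_min x0; have m0 : og_lt m 0.
  rewrite /og_lt; apply/negP => m0; apply: Nix => g g0; apply: contrapT => /mmin mg.
  by move: g0; rewrite /og_lt (og_le_trans _ _ _ m0 mg).
have w0 : x^-1 != 0 by rewrite invr_eq0.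
have [m' wm' m'min] := hahn_min w0.
have Nle : ~ og_le m' 0.
  move=> m'0; have := hmul_lead mmin (w := x^-1) (g := m').
  rewrite divff // => e; have : (1 : H) (m + m') <> 0.
    rewrite e => [|b bm']; last by apply: contrapT => /m'min; rewrite og_leNgt bm'.
    by apply/eqP; rewrite mulf_neq0 //; apply/eqP.
  rewrite /=; case: eqP => // mm' _; have : og_lt (m + m') 0.
    by rewrite (@og_le_lt_trans _ (m + 0)) ?og_leD2lE // addr0.
  by rewrite mm' og_ltxx.
have wle g : og_le g 0 -> x^-1 g = 0.
  by move=> g0; apply: contrapT => /m'min m'g; apply: Nle; apply: og_le_trans m'g g0.
by apply/hahn_residue_some; split=> [g /og_ltW/wle|] //; apply: wle; exact: og_lexx.
Qed.

Lemma hahn_residue_const c : hahn_residue (hconst K G c) = Some c.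
Proof.
apply/hahn_residue_some; split=> [g g0|]; last by rewrite /= eqxx.
by rewrite /= og_lt_eqF.
Qed.

Definition hahn_place : place H := @Place H K hahn_residue hahn_residue1
  hahn_residueD hahn_residueM hahn_residueV
  (fun c => ex_intro _ (hconst K G c) (hahn_residue_const c)).

Lemma hahn_place_rational : rational_place (hconst K G) hahn_place.
Proof.
split=> [c|c]; first by rewrite /= hahn_residue_const.
by exists c; exact: hahn_residue_const.
Qed.

End HahnPlace.

(** The canonical place maps [z - a] to [0], so that this difference is [0] if it is
    algebraic. *)
Lemma series_transcendental (K : fieldType) (z : hahn K int) a :
  ser_ge 1 (z - hconst K int a) -> z <> hconst K int a -> ~ cl (range (hconst K int)) z.
Proof.
move=> Vz za clz; apply: za.
have sK := cl_subfield (range (hconst K int)).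
apply/eqP; rewrite -subr_eq0; apply/eqP.
have [Ptriv _] := hahn_place_rational K int.
apply: (place_algebraic0 Ptriv); last first.
  by apply: (subfieldB sK) => //; apply: sub_cl; exists a.
apply/hahn_residue_some; split=> [g g0|]; last exact: (Vz 0).
apply: Vz; move: g0; rewrite /og_lt /og_le /= /int_le -ltNge => g0.
exact: lt_trans g0 _.
Qed.

(** * Rational points of affine models *)

Lemma clear_denominators (K : fieldType) n k (p q : 'I_k -> {mpoly K[n]}) f :
  exists (G : {mpoly K[n]}) N, forall (Om : fieldType) (j : {rmorphism K -> Om}) (z : 'I_n -> Om),
    (forall i, mmap j z (q i) != 0) ->
    mmap j z G = (\prod_i mmap j z (q i)) ^+ N *
                 mmap j (fun i => mmap j z (p i) / mmap j z (q i)) f.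
Proof.
pose Q := \prod_i q i.
have QE (Om : fieldType) (j : {rmorphism K -> Om}) z : mmap j z Q = \prod_i mmap j z (q i).
  by rewrite /Q rmorph_prod.
elim/mpoly_gen_ind: f => [c|i|f g [G [N GE]] [H [M HE]]|f g [G [N GE]] [H [M HE]]].
- by exists c%:MP, 0%N => Om j z _; rewrite expr0 mul1r !mmapC.
- exists (p i * \prod_(l < k | l != i) q l), 1%N => Om j z q0.
  rewrite expr1 mmap_XU rmorphM rmorph_prod /= [in RHS](bigD1 i) //=.
  by field; exact: q0.
- exists (Q ^+ M * G + Q ^+ N * H), (N + M)%N => Om j z q0.
  by rewrite !rmorphD !rmorphM !rmorphXn /= QE GE // HE // exprD; ring.
- exists (G * H), (N + M)%N => Om j z q0.
  by rewrite !rmorphM /= GE // HE // exprD; ring.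
Qed.

Section Localizations.
Variables (K F : fieldType) (iota : {rmorphism K -> F}) (n : nat) (y : 'I_n -> F).
Local Notation A := (chart_ring iota y).

Lemma chart1 : A 1. Proof. by exists 1; rewrite ?rmorph1. Qed.

Lemma chartM u v : A u -> A v -> A (u * v).
Proof. by move=> [f _ <-] [g _ <-]; exists (f * g); rewrite ?rmorphM. Qed.

Variable p : set F.
Hypothesis pp : prime_ideal A p.
Local Notation o := (localization A p).

Lemma prime_neq0 b : ~ p b -> b != 0.
Proof. by move=> Nb; apply/eqP => b0; apply: Nb; rewrite b0; exact: prime_ideal0 pp. Qed.

Lemma chart_local a : A a -> o a.
Proof.
move=> Aa; exists a, 1; rewrite divr1; split=> //; first exact: chart1.
exact: prime_ideal_proper pp.
Qed.

Lemma nonunits_localization z :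
  nonunits o z <-> exists a b, [/\ p a, A b, ~ p b & z = a / b].
Proof.
split=> [[[a [b [Aa Ab Nb zE]]] Nz]|[a [b [pa Ab Nb zE]]]].
  exists a, b; split=> //; apply: contrapT => Na; apply: (Nz (b / a)).
    by exists b, a.
  by rewrite zE; field; rewrite !prime_neq0.
have Aa := prime_ideal_sub pp pa.
split=> [|w [c [e [Ac Ae Ne wE]]] zw]; first by exists a, b.
have be : a * c = b * e.
  move: zw; rewrite zE wE => zw; rewrite -[RHS]mulr1 -zw.
  by field; rewrite !prime_neq0.
have : p (b * e) by rewrite -be mulrC; exact: (prime_idealM pp Ac pa).
by move=> /(prime_ideal_prime pp Ab Ae)[].
Qed.

Lemma nonunits_chart a : A a -> nonunits o a -> p a.
Proof.
move=> Aa /nonunits_localization[c [b [pc Ab Nb aE]]].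
have : p (a * b) by rewrite aE divfK ?prime_neq0.
by move=> /(prime_ideal_prime pp Aa Ab)[].
Qed.

Lemma prime_nonunits a : p a -> nonunits o a.
Proof.
move=> pa; apply/nonunits_localization; exists a, 1; rewrite divr1; split=> //.
  exact: chart1.
exact: prime_ideal_proper pp.
Qed.

Lemma nonunitsD u v : nonunits o u -> nonunits o v -> nonunits o (u + v).
Proof.
move=> /nonunits_localization[a [b [pa Ab Nb ->]]] /nonunits_localization[c [e [pc Ae Ne ->]]].
apply/nonunits_localization; exists (e * a + b * c), (b * e); split.
- by apply: (prime_idealD pp); apply: (prime_idealM pp).
- exact: chartM.
- by move=> /(prime_ideal_prime pp Ab Ae)[].
- by field; rewrite !prime_neq0.
Qed.

Lemma nonunitsM u v : o u -> nonunits o v -> nonunits o (u * v).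
Proof.
move=> [a [b [Aa Ab Nb ->]]] /nonunits_localization[c [e [pc Ae Ne ->]]].
apply/nonunits_localization; exists (a * c), (b * e); split.
- exact: (prime_idealM pp).
- exact: chartM.
- by move=> /(prime_ideal_prime pp Ab Ae)[].
- by field; rewrite !prime_neq0.
Qed.

Lemma nonunits_const c : nonunits o (iota c) -> c = 0.
Proof.
move=> /nonunits_chart pc; apply: contrapT => /eqP c0.
apply: (prime_ideal_proper pp); rewrite -(rmorph1 iota) -(mulVf c0) rmorphM.
have AC e : A (iota e) by exists e%:MP; rewrite ?mmapC.
by apply: (prime_idealM pp) => //; exact: pc.
Qed.

(** The center of a place on an affine chart is determined by the place; this is
    the separatedness of affine schemes. *)
Lemma dominated_prime (P : place F) : dominates P o -> forall z, p z <-> A z /\ P z = Some 0.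
Proof.
move=> [Po Pnu] z; split=> [pz|[Az Pz]].
  split; first exact: (prime_ideal_sub pp); apply: Pnu; exact: prime_nonunits.
apply: contrapT => Nz; have oz : o z^-1.
  by exists 1, z; rewrite div1r; split=> //; exact: chart1.
case e : (P z^-1) (Po _ oz) => [b|] // _; have := placeM Pz e.
by rewrite divff ?prime_neq0 // place1 mul0r => -[/eqP]; rewrite oner_eq0.
Qed.

End Localizations.

Section AffineModel.
Variables (K F : fieldType) (iota : {rmorphism K -> F}) (n : nat) (y : 'I_n -> F).
Hypothesis gy : field_generates iota y.

Lemma affine_separated (P : place F) (i k : 'I_1) o o' :
  chart_points iota y o -> chart_points iota y o' ->
  dominates P o -> dominates P o' -> o = o'.
Proof.
move=> [p pp ->] [p' pp' ->] /(dominated_prime pp) pE /(dominated_prime pp') pE'.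
suff -> : p = p' by [].
by apply/seteqP; split=> z; [move/pE/pE' | move/pE'/pE].
Qed.

Definition affine_model : model iota :=
  @Model K F iota 1 (fun=> n) (fun=> y) isT (fun=> gy) affine_separated.

End AffineModel.

Section RationalPoints.
Variables (K F : fieldType) (iota : {rmorphism K -> F}) (n : nat) (y : 'I_n -> F).
Local Notation A := (chart_ring iota y).

(** [b] is a point with coordinates in [K] of the affine variety [Spec K[y]]. *)
Definition kpoint (b : 'I_n -> K) : Prop := forall f, mmap iota y f = 0 -> f.@[b] = 0.

Definition kpoint_prime (b : 'I_n -> K) : set F :=
  [set z | exists2 f, z = mmap iota y f & f.@[b] = 0].

Lemma kpoint_primeP b f : kpoint b -> kpoint_prime b (mmap iota y f) <-> f.@[b] = 0.
Proof.
move=> kb; split=> [[g fg gb]|fb]; last by exists f.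
have := kb (f - g); rewrite rmorphB /= fg subrr => /(_ erefl).
by rewrite mevalB gb subr0.
Qed.

Lemma kpoint_prime_ideal b : kpoint b -> prime_ideal A (kpoint_prime b).
Proof.
move=> kb; split.
- by move=> z [f -> _]; exists f.
- by exists 0; rewrite ?rmorph0 ?meval0.
- move=> _ _ [f -> fb] [g -> gb]; exists (f + g); first by rewrite rmorphD.
  by rewrite mevalD fb gb addr0.
- move=> _ _ [f _ <-] [g -> gb]; exists (f * g); first by rewrite rmorphM.
  by rewrite mevalM gb mulr0.
- rewrite -(rmorph1 (mmap iota y)) => /(kpoint_primeP _ kb); rewrite meval1.
  by move/eqP; rewrite oner_eq0.
- move=> _ _ [f _ <-] [g _ <-]; rewrite -rmorphM => /(kpoint_primeP _ kb).
  move=> /eqP; rewrite mevalM mulf_eq0 => /orP[] /eqP e; [left|right]; exact/kpoint_primeP.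
Qed.

Lemma kpoint_rational b : kpoint b -> rational_point iota (localization A (kpoint_prime b)).
Proof.
move=> kb z [_ [_ [[f _ <-] [g _ <-] Ng ->]]]; have pp := kpoint_prime_ideal kb.
have gb : g.@[b] != 0 by apply/eqP => gb; apply: Ng; apply/kpoint_primeP.
exists (f.@[b] / g.@[b]); apply/(nonunits_localization pp).
exists (mmap iota y (f - (f.@[b] / g.@[b])%:MP * g)), (mmap iota y g); split=> //.
- by apply/kpoint_primeP; rewrite // mevalB mevalM mevalC divfK // subrr.
- by exists g.
- rewrite rmorphB (rmorphM (mmap iota y)) /= mmapC mulrBl mulfK //.
  exact: (prime_neq0 pp).
Qed.

(** The coordinates of the point are the residues of [y]. *)
Lemma rational_point_kpoint p : prime_ideal A p -> rational_point iota (localization A p) ->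
  exists b, [/\ kpoint b, p = kpoint_prime b &
    forall i, nonunits (localization A p) (y i - iota (b i))].
Proof.
move=> pp rp; have oy i : localization A p (y i).
  by apply: (chart_local pp); exists 'X_i; rewrite ?mmap_XU.
pose b i := sval (cid (rp _ (oy i))).
have bP i : nonunits (localization A p) (y i - iota (b i)) by rewrite /b; case: cid.
have fP f : nonunits (localization A p) (mmap iota y f - iota f.@[b]).
  have p0 : nonunits (localization A p) 0 by apply: (prime_nonunits pp); exact: prime_ideal0 pp.
  have of' f' : localization A p (mmap iota y f') by apply: (chart_local pp); exists f'.
  have oc c : localization A p (iota c) by have := of' c%:MP; rewrite mmapC.
  elim/mpoly_gen_ind: f => [c|i|f g IHf IHg|f g IHf IHg].
  - by rewrite mmapC mevalC subrr.
  - by rewrite mmap_XU mevalXU.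
  - rewrite mevalD !rmorphD /= opprD addrACA; exact: (nonunitsD pp).
  - rewrite mevalM !rmorphM /=.
    have -> : mmap iota y f * mmap iota y g - iota f.@[b] * iota g.@[b] =
      mmap iota y f * (mmap iota y g - iota g.@[b]) + iota g.@[b] * (mmap iota y f - iota f.@[b]) by ring.
    by apply: (nonunitsD pp); apply: (nonunitsM pp).
have oN1 : localization A p (-1).
  by apply: (chart_local pp); exists (-1); rewrite ?rmorphN ?rmorph1.
have kb : kpoint b.
  move=> f f0; apply: (nonunits_const pp (iota := iota)).
  have := nonunitsM pp oN1 (fP f); rewrite f0 sub0r mulN1r opprK; exact.
exists b; split=> //; apply/seteqP; split=> z.
  move=> pz; have [f _ fz] := prime_ideal_sub pp pz.
  exists f => //; apply: (nonunits_const pp (iota := iota)).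
  have -> : iota f.@[b] = z + -1 * (mmap iota y f - iota f.@[b]) by rewrite fz; ring.
  by apply: (nonunitsD pp); [exact: prime_nonunits | exact: (nonunitsM pp)].
move=> [f -> fb]; apply: (nonunits_chart pp); first by exists f.
by have := fP f; rewrite fb rmorph0 subr0.
Qed.

End RationalPoints.

Section Curve.
Variables (K F : fieldType) (iota : {rmorphism K -> F}).

(** On a curve, the zeros of a nonzero function are finite in number: a relation
    between the function [G] and a coordinate, not divisible by [G], becomes an
    equation for the coordinate when [G] vanishes. *)
Lemma curve_zeros n (y : 'I_n -> F) (G : {mpoly K[n]}) i :
  ~ (exists x : 'I_2 -> F, alg_independent iota x) -> mmap iota y G != 0 ->
  exists r : {poly K}, r != 0 /\
    forall b, kpoint iota y b -> G.@[b] = 0 -> root r (b i).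
Proof.
move=> no2 Gy; pose z := extend (fun _ : 'I_1 => y i) (mmap iota y G).
have zw : z \o widen_ord (leqnSn 1) = fun=> y i by exact: extend_widen.
pose ann (P : {poly {mpoly K[1]}}) := P != 0 /\ mmap iota z (last_horner P) = 0.
have [P [[P0 Pz] Pmin]] : exists P, ann P /\ forall Q, ann Q -> (size P <= size Q)%N.
  apply: (exists_min (fun P : {poly {mpoly K[1]}} => size P)).
  apply: contrapT => no; apply: no2; exists z => R Rz.
  apply: contrapT => /eqP R0; apply: no; exists (muni R); split; last by rewrite muniK.
  by apply: contraNneq R0 => e; rewrite -(muniK R) e last_horner0.
have c0 : P`_0 != 0.
  elim/poly_ind: P => [|P c _] in P0 Pz Pmin *; first by rewrite eqxx in P0.
  rewrite coefD coefMX coefC /= add0r; apply/eqP => c0.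
  have Pn0 : P != 0 by apply: contraNneq P0 => ->; rewrite c0 mul0r add0r.
  have : (size (P * 'X + c%:P)%R <= size P)%N.
    apply: Pmin; split=> //; apply: (mulIf Gy); rewrite mul0r -[RHS]Pz.
    rewrite c0 addr0 last_hornerM last_hornerX rmorphM /= mmap_XU.
    by rewrite [z _]extend_max.
  by rewrite c0 addr0 size_mulX // ltnn.
pose tou := mmap (polyC : {rmorphism K -> {poly K}}) (fun _ : 'I_1 => 'X).
exists (tou P`_0); split=> [|b kb Gb].
  apply: contraNneq c0 => tou0.
  have inv q : (map_poly (mpolyC 1 (R := K)) (tou q)).['X_ord0] = q.
    rewrite -[RHS](mmap_mpolyC_X q) /tou.
    rewrite -[LHS]/((horner_eval ('X_ord0 : {mpoly K[1]}) \o map_poly (mpolyC 1 (R := K)))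
       (mmap (polyC : {rmorphism K -> {poly K}}) (fun _ : 'I_1 => 'X) q)).
    rewrite (mmap_morph (j' := mpolyC 1 (R := K))) => [|c /=]; last first.
      by rewrite /horner_eval map_polyC hornerC.
    by apply: mmap_ext => k /=; rewrite /horner_eval map_polyX hornerX; congr 'X__; apply: val_inj; case: k => -[].
  by rewrite -(inv P`_0) tou0 rmorph0 horner0.
pose Phi := mmap (mpolyC n (R := K)) (extend (fun _ : 'I_1 => 'X_i) G) (last_horner P).
have Phib : Phi.@[b] = 0.
  apply: kb; rewrite /Phi mmap_comp -[RHS]Pz; apply: mmap_ext.
  apply: ord_last_ind => [|k]; first by rewrite extend_max [z _]extend_max.
  by rewrite [z _]extendE extendE mmap_XU.
move: Phib; rewrite /meval /Phi mmap_comp mmap_last_horner extend_max -/(meval b G) Gb.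
rewrite horner_coef0 coef_map /= => P0b; apply/rootP; rewrite -[RHS]P0b /tou.
rewrite -[LHS]/(horner_eval (b i) _) (mmap_morph (j' := idfun)) => [|c]; last first.
  by rewrite /= /horner_eval hornerC.
apply: mmap_ext => k /=; rewrite /horner_eval hornerX extendE.
by rewrite mmap_XU.
Qed.

Section SmoothCurve.
Variables (e : nat) (y : 'I_(e + 1) -> F) (h : 'I_e -> {mpoly K[e + 1]}) (D : {mpoly K[e + 1]}).
Hypothesis hy : forall k, mmap iota y (h k) = 0.
Hypothesis DJ : forall (Om : fieldType) (j : {rmorphism K -> Om}) (z : 'I_(e + 1) -> Om),
  mmap j z D != 0 -> \rank (\matrix_(k < e, l < e + 1) mmap j z (h k)^`M(l)) = e.
Hypothesis Dy : mmap iota y D != 0.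

(** The open subset of the curve where the minor [D] of the Jacobian matrix does
   not vanish. *)
Definition principal_open : 'I_(e + 1).+1 -> F := extend y (mmap iota y D)^-1.
Local Notation z := principal_open.
Local Notation widen := (widen_ord (leqnSn (e + 1))).

Lemma principal_open_widen : z \o widen = y.
Proof. exact: extend_widen. Qed.

Lemma principal_open_generates : field_generates iota y -> field_generates iota z.
Proof.
move=> gy u; have [p [q [q0 ->]]] := gy u; exists (mwiden p), (mwiden q).
by rewrite !mmap_mwiden principal_open_widen.
Qed.

(** A relation between the coordinates of the open subset, multiplied by a power of
   [D], is a relation between those of the curve. *)
Lemma principal_open_kpoint b : kpoint iota y b -> D.@[b] != 0 ->
  kpoint iota z (extend b (D.@[b])^-1).
Proof.
move=> kb Db f fz.
pose p : 'I_(e + 1).+1 -> {mpoly K[e + 1]} := extend (fun i => 'X_i) 1.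
pose q : 'I_(e + 1).+1 -> {mpoly K[e + 1]} := extend (fun=> 1) D.
have pq (Om : fieldType) (j : {rmorphism K -> Om}) x :
    (fun i => mmap j x (p i) / mmap j x (q i)) =1 extend x (mmap j x D)^-1.
  apply: ord_last_ind => [|i]; first by rewrite /p /q !extend_max rmorph1 div1r.
  by rewrite /p /q !extendE mmap_XU rmorph1 divr1.
have q0 (Om : fieldType) (j : {rmorphism K -> Om}) x : mmap j x D != 0 ->
    forall i, mmap j x (q i) != 0.
  move=> Dx; apply: ord_last_ind => [|i]; first by rewrite /q extend_max.
  by rewrite /q extendE rmorph1 oner_neq0.
have [G [N GE]] := clear_denominators p q f.
have GE' (Om : fieldType) (j : {rmorphism K -> Om}) x : mmap j x D != 0 ->
    mmap j x G = (\prod_i mmap j x (q i)) ^+ N * mmap j (extend x (mmap j x D)^-1) f.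
  move=> Dx; rewrite (GE _ _ _ (q0 _ _ _ Dx)); congr (_ * _); apply: mmap_ext; exact: pq.
have Gy : mmap iota y G = 0 by rewrite GE' // fz mulr0.
have := kb _ Gy; rewrite /meval GE' // => /eqP.
rewrite mulf_eq0 expf_eq0 => /orP[/andP[_ /prodf_eq0[i _]]|/eqP //].
by rewrite (negbTE (q0 _ _ _ _ i)).
Qed.

(** The equations are those of the curve and [D * X = 1], where [X] is the last
    variable. *)
Lemma principal_open_smooth : smooth_chart iota 1 z.
Proof.
move=> Om j al Ial.
suff main r : r = (e + 1)%N -> exists2 H : 'I_r -> {mpoly K[(e + 1).+1]},
    (forall k, mmap iota z (H k) = 0) &
    \rank (\matrix_(k < r, l < (e + 1).+1) mmap j al (H k)^`M(l)) = r.
  by apply: main; rewrite subn1.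
move=> ->; pose H := stack (fun k => mwiden (h k))
  (fun _ : 'I_1 => mwiden D * 'X_ord_max - 1 : {mpoly K[(e + 1).+1]}).
have Hz k : mmap iota z (H k) = 0.
  case: (split_ordP k) => q ->; rewrite /H; first by rewrite stack_l mmap_mwiden principal_open_widen.
  rewrite stack_r rmorphB rmorphM /= mmap_XU mmap_mwiden principal_open_widen rmorph1.
  by rewrite [z _]extend_max divff ?subrr.
exists H => //; have Dal : mmap j (al \o widen) D * al ord_max = 1.
  have := Ial _ (Hz (rshift e ord0)); rewrite /H stack_r rmorphB rmorphM /= mmap_XU.
  by rewrite mmap_mwiden rmorph1 => /eqP; rewrite subr_eq0 => /eqP.
have Dal0 : mmap j (al \o widen) D != 0.
  by apply: contra_eq_neq Dal => ->; rewrite mul0r eq_sym oner_neq0.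
apply/eqP; apply: inj_row_free => v; rewrite -[v]hsubmxK; set u := lsubmx v; set t := rsubmx v.
move=> /rowP v0; have HmaxE k : mmap j al (H (lshift 1 k))^`M(ord_max) = 0.
  by rewrite /H stack_l mderiv_mwiden_max rmorph0.
have HwE k l : mmap j al (H (lshift 1 k))^`M(widen l) = mmap j (al \o widen) (h k)^`M(l).
  by rewrite /H stack_l mderiv_mwiden mmap_mwiden.
have t0 : t = 0.
  have := v0 ord_max; rewrite !mxE big_split_ord /= big1 => [|k _]; last first.
    by rewrite !mxE HmaxE mulr0.
  rewrite big_ord1 add0r row_mxEr [X in _ * X]mxE {1}/H stack_r mderivB mderivM.
  rewrite mderiv_mwiden_max mul0r add0r mderiv_XU eqxx mulr1 mderivC subr0 mmap_mwiden.
  move=> /eqP; rewrite mulf_eq0 (negbTE Dal0) orbF => /eqP t0.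
  by apply/rowP => k; rewrite ord1 [RHS]mxE.
have u0 : u = 0.
  have := DJ Dal0 => /eqP /row_free_inj inj; apply: inj; rewrite mul0mx.
  apply/rowP => l; have := v0 (widen l); rewrite !mxE big_split_ord /= t0.
  rewrite [X in _ + X]big1 => [|k _]; last by rewrite row_mxEr [X in X * _]mxE mul0r.
  rewrite addr0 => e0; rewrite -[RHS]e0; apply: eq_bigr => k _.
  by rewrite row_mxEl [in RHS]mxE HwE !mxE.
by rewrite u0 t0 row_mx0.
Qed.

End SmoothCurve.

(** The point [a] is nonsingular, but the curve can be singular elsewhere; hence
    largeness is applied to a principal open neighbourhood of [a]. Its infinitely
    many points cannot all be among the finitely many zeros of [g]. *)
Theorem large_curve n e (y : 'I_n -> F) (a : 'I_n -> K) (h : 'I_e -> {mpoly K[n]}) g :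
  large K -> (e + 1)%N = n -> field_generates iota y -> has_trdeg iota 1 ->
  (forall k, mmap iota y (h k) = 0) -> kpoint iota y a ->
  \rank (jacobian_at h a) = e -> mmap iota y g <> 0 ->
  exists b, kpoint iota y b /\ g.@[b] <> 0.
Proof.
move=> Klarge en; subst n => gy tr hy ka rh gy0.
have [D [Da DJ]] := jacobian_minor rh.
have Dy : mmap iota y D != 0 by apply: contra_neq Da; exact: ka.
pose z := principal_open y D; have gz := principal_open_generates D gy.
have smooth_z : smooth 1 (affine_model gz) by move=> i; exact: (principal_open_smooth hy DJ Dy).
have kz := principal_open_kpoint Dy ka Da.
have zw : z \o widen_ord (leqnSn (e + 1)) = y by exact: principal_open_widen.
have /(Klarge _ _ _ tr smooth_z) inf : rational_points (affine_model gz) !=set0.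
  exists (localization (chart_ring iota z) (kpoint_prime iota z (extend a (D.@[a])^-1))).
  split; last exact: kpoint_rational.
  by exists ord0; exists (kpoint_prime iota z (extend a (D.@[a])^-1)) => //; exact: kpoint_prime_ideal.
apply: contrapT => no; apply: inf.
have vanish b : kpoint iota z b -> (mwiden g).@[b] = 0.
  move=> kb; apply: contrapT => gb; apply: no.
  exists (b \o widen_ord (leqnSn (e + 1))); split; last by rewrite /meval -mmap_mwiden.
  by move=> f fy; rewrite /meval -mmap_mwiden; apply: kb; rewrite mmap_mwiden zw.
have gz0 : mmap iota z (mwiden g) != 0 by rewrite mmap_mwiden zw; apply/eqP.
have rootsP i : exists S : seq K, forall b, kpoint iota z b -> b i \in S.
  have [r [r0 rP]] := curve_zeros i tr.2 gz0; have [S SP] := roots_in_seq r0.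
  by exists S => b kb; apply/SP/rP => //; exact: vanish.
pose S := flatten [seq sval (cid (rootsP i)) | i <- enum 'I_(e + 1).+1].
have SP b i : kpoint iota z b -> b i \in S.
  move=> kb; apply/flattenP; exists (sval (cid (rootsP i))).
    by apply/mapP; exists i; rewrite ?mem_enum.
  by case: (cid _) => T /= TP; exact: TP.
apply: (@sub_finite_set _ _ ((fun b : {ffun 'I_(e + 1).+1 -> seq_sub S} =>
  localization (chart_ring iota z) (kpoint_prime iota z (fun i => ssval (b i)))) @` setT)).
  move=> o [[i [p pp ->]] rp]; have [b [kb pE _]] := rational_point_kpoint pp rp.
  exists [ffun i => SeqSub (SP b i kb)] => //=; rewrite pE; congr localization.
  by congr kpoint_prime; apply/funext => k; rewrite ffunE.
by apply: finite_image; exact: finite_finset.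
Qed.

End Curve.

(** * Finitely generated subfields *)

Section Corestriction.
Variables (K F : fieldType) (iota : {rmorphism K -> F}) (B : set F) (sB : is_subfield B).
Hypothesis iB : forall c, B (iota c).

Definition corestrict (c : K) : subfield_type sB :=
  @SubfieldElt F B sB (iota c) (introT (asboolP _) (iB c)).

Lemma corestrict_zmod : zmod_morphism corestrict.
Proof. by move=> c d; apply: val_inj; rewrite /= rmorphB. Qed.

Lemma corestrict_monoid : monoid_morphism corestrict.
Proof. by split=> [|c d]; apply: val_inj; rewrite /= ?rmorph1 ?rmorphM. Qed.

HB.instance Definition _ :=
  GRing.isZmodMorphism.Build K (subfield_type sB) corestrict corestrict_zmod.
HB.instance Definition _ :=
  GRing.isMonoidMorphism.Build K (subfield_type sB) corestrict corestrict_monoid.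

End Corestriction.

Lemma generated_subfield (K F : fieldType) (iota : {rmorphism K -> F}) n (x : 'I_n -> F) :
  exists (E : fieldType) (j : {rmorphism K -> E}) (incl : {rmorphism E -> F}) (y : 'I_n -> E),
    [/\ forall c, incl (j c) = iota c, forall i, incl (y i) = x i & field_generates j y].
Proof.
have sB := fgen_subfield (range iota `|` range x).
have iB c : fgen (range iota `|` range x) (iota c) by apply: sub_fgen; left; exists c.
have xB i : fgen (range iota `|` range x) (x i) by apply: sub_fgen; right; exists i.
exists (subfield_type sB), (corestrict sB iB), (subfield_incl sB).
pose y i := @SubfieldElt F _ sB (x i) (introT (asboolP _) (xB i)); exists y; split=> // z.
have inclE p : subfield_incl sB (mmap (corestrict sB iB) y p) = mmap iota x p.
  by rewrite (mmap_morph (j' := iota)).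
have [p [q [q0 zE]]] := (fgen_range _ _ _).1 (asboolP _ (valP z)).
exists p, q; split; first by move=> e; apply: q0; rewrite -inclE e rmorph0.
by apply: val_inj; rewrite -[LHS]/(subfield_val z) zE -!inclE -fmorph_div.
Qed.

Section SubfieldTransfer.
Variables (K E F : fieldType) (j : {rmorphism K -> E}) (iota : {rmorphism K -> F}).
Variables (incl : {rmorphism E -> F}).
Hypothesis inclj : forall c, incl (j c) = iota c.

Lemma mmap_incl n (y : 'I_n -> E) p : incl (mmap j y p) = mmap iota (incl \o y) p.
Proof. exact: mmap_morph. Qed.

Lemma mmap_incl0 n (y : 'I_n -> E) p : mmap j y p = 0 <-> mmap iota (incl \o y) p = 0.
Proof.
rewrite -mmap_incl; split=> [->|/eqP]; first by rewrite rmorph0.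
by rewrite fmorph_eq0 => /eqP.
Qed.

Lemma alg_independent_incl n (y : 'I_n -> E) :
  alg_independent j y <-> alg_independent iota (incl \o y).
Proof. by split=> iy p /mmap_incl0 => [/iy|/iy]. Qed.

End SubfieldTransfer.

Lemma alg_independent1 (K F : fieldType) (iota : {rmorphism K -> F}) (x : 'I_1 -> F) :
  ~ cl (range iota) (x ord0) -> alg_independent iota x.
Proof.
move=> Nx; apply/alg_independent_free.
have -> : enum 'I_1 = [:: ord0].
  by apply: (inj_map val_inj); rewrite val_enum_ord.
by split.
Qed.

Lemma generated_algebraic (K F : fieldType) (iota : {rmorphism K -> F}) n (x : 'I_n -> F) t z :
  (forall i, cl (range iota `|` t) (x i)) -> fgen (range iota `|` range x) z ->
  cl (range iota `|` t) z.
Proof.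
move=> xt; apply: fgen_min; first exact: cl_subfield.
by move=> u [uK|[i _ <-]] //; apply: sub_cl; left.
Qed.

Lemma cl_nil (K F : fieldType) (iota : {rmorphism K -> F}) z :
  cl (range iota) z -> cl (range iota `|` [set` ([::] : seq F)]) z.
Proof. by apply: cl_mono; left. Qed.

(** * Large fields and formal arcs *)

(** The arc spans a field [K(xi)] of transcendence degree [1]: at most [1] by the
    Jacobian criterion, and at least [1] because the arc is not constant. Over this
    field, [xi] is a curve that is nonsingular at [a]. *)
Theorem large_arc (K : fieldType) n e (xi : 'I_n -> hahn K int) (a : 'I_n -> K)
    (h : 'I_e -> {mpoly K[n]}) g :
  large K -> (e + 1)%N = n ->
  (forall i, ser_ge 1 (xi i - hconst K int (a i))) -> (exists i, xi i <> hconst K int (a i)) ->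
  (forall k, mmap (hconst K int) xi (h k) = 0) -> \rank (jacobian_at h a) = e ->
  mmap (hconst K int) xi g <> 0 ->
  exists b, kpoint (hconst K int) xi b /\ g.@[b] <> 0.
Proof.
move=> Klarge en Vxi [i0 xia] hxi rh gxi.
have [E [j [incl [y [inclj incly gy]]]]] := generated_subfield (hconst K int) xi.
have xiE : incl \o y = xi by apply/funext.
have y0 p : mmap j y p = 0 <-> mmap (hconst K int) xi p = 0.
  by rewrite -xiE; exact: mmap_incl0.
have ka : kpoint j y a.
  move=> f /y0 fxi; have := filt_meval (ser_ge_filtration K) f Vxi.
  move=> /(_ 0) V; move: V; rewrite fxi sub0r hcoefN /= => /(_ isT)/eqP.
  by rewrite oppr_eq0 => /eqP.
have tr : has_trdeg j 1.
  split.
    exists (fun=> y i0); apply/(alg_independent_incl inclj); apply: alg_independent1.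
    by rewrite /= incly; exact: series_transcendental (Vxi i0) xia.
  move=> [x /(alg_independent_incl inclj) ix].
  have [G [t [Gh tx rt]]] := jacobian_criterion (hconst K int) xi.
  have rG : (e <= \rank G)%N.
    subst n; have [D [Da DJ]] := jacobian_minor rh.
    have Dxi : mmap (hconst K int) xi D != 0.
      by apply: contra_neq Da => /y0/ka.
    rewrite -[X in (X <= _)%N](DJ _ _ _ Dxi); apply: mxrankS; apply/row_subP => k.
    by have := Gh _ (hxi k); congr (_ <= G)%MS; apply/rowP => q; rewrite !mxE.
  have : (2 <= size t)%N.
    apply: (alg_independent_le ix) => i; apply: (generated_algebraic (x := xi)) tx _.
    have [p [q [q0 xE]]] := gy (x i); apply/fgen_range; exists p, q.
    by split=> [/y0//|]; rewrite /= xE fmorph_div !(mmap_incl inclj) xiE.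
  apply/negP; rewrite -ltnNge ltnS -(leq_add2l e) en; apply: leq_trans rt.
  by rewrite leq_add2r.
have [||b [kb gb]] := large_curve (g := g) Klarge en gy tr _ ka rh _.
- by move=> k; apply/y0.
- by move=> /y0.
by exists b; split=> // f /y0; exact: kb.
Qed.

(** If [K] were finite, some polynomial vanishing on [K] would not vanish at the
    transcendental element [svar]. *)
Lemma infinite_of_series_points (K : fieldType) :
  (forall g : {mpoly K[1]}, mmap (hconst K int) (fun=> svar) g <> 0 -> exists b, g.@[b] <> 0) ->
  infinite_set [set: K].
Proof.
move=> H /finite_seqP[S SE]; pose g : {mpoly K[1]} := \prod_(c <- S) ('X_ord0 - c%:MP).
have [|b] := H g.
  apply/eqP; rewrite /g rmorph_prod prodf_seq_neq0; apply/allP => c _ /=.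
  rewrite rmorphB /= mmap_XU mmapC subr_eq0; apply/eqP => sc.
  have := congr1 (fun z : hahn K int => z 1) sc; rewrite /= => /eqP.
  by rewrite oner_eq0.
have bS : b ord0 \in S by have : [set: K] (b ord0) by []; rewrite SE.
apply; apply/eqP; rewrite /g rmorph_prod /= prodf_seq_eq0; apply/hasP; exists (b ord0) => //=.
by rewrite mevalB mevalXU mevalC subrr.
Qed.

(** Largeness is applied to the affine line. *)
Lemma large_infinite (K : fieldType) : large K -> infinite_set [set: K].
Proof.
move=> Klarge; apply: infinite_of_series_points => g gs.
have [|||||b [_ gb]] := large_arc (n := 1) (e := 0) (a := fun=> 0) (h := fun _ => 0) Klarge _ _ _ _ _ gs.
- by [].
- by move=> i; rewrite rmorph0 subr0; exact: svar_ge.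
- exists ord0; rewrite rmorph0 => /(congr1 (fun z : hahn K int => z 1)) /=.
  by move/eqP; rewrite oner_eq0.
- by case.
- by rewrite [jacobian_at _ _]flatmx0 mxrank0.
by exists b.
Qed.

(** * Regular local rings and the Jacobian matrix *)

Section RegularPoint.
Variables (K F : fieldType) (iota : {rmorphism K -> F}) (n : nat) (x : 'I_n -> F).
Variables (a : 'I_n -> K).
Hypothesis ka : kpoint iota x a.
Local Notation A := (chart_ring iota x).
Local Notation p := (kpoint_prime iota x a).
Local Notation o := (localization A p).

(** If [d] elements generate the maximal ideal, then the coordinates are
    combinations of [d] functions, up to their values at the point; clearing
    denominators gives [n] equations whose Jacobian matrix is an invertible
    diagonal matrix minus a matrix of rank at most [d]. *)
Lemma regular_equations d (t : 'I_d -> F) :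
  (forall k, nonunits o (t k)) ->
  (forall z, nonunits o z -> exists2 c : 'I_d -> F, (forall k, o (c k)) & z = \sum_k c k * t k) ->
  (forall i, nonunits o (x i - iota (a i))) ->
  exists h : 'I_(n - d) -> {mpoly K[n]},
    (forall k, mmap iota x (h k) = 0) /\ \rank (jacobian_at h a) = (n - d)%N.
Proof.
move=> tn tgen xa; have pp := kpoint_prime_ideal ka.
have frac z : o z -> exists uv : {mpoly K[n]} * {mpoly K[n]},
    uv.2.@[a] != 0 /\ z = mmap iota x uv.1 / mmap iota x uv.2.
  move=> [_ [_ [[u _ <-] [v _ <-] Nv ->]]]; exists (u, v); split=> //=.
  by apply/eqP => va; apply: Nv; apply/(kpoint_primeP _ ka).
have val0 v : v.@[a] != 0 -> mmap iota x v != 0.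
  by move=> va; apply: contra_neq va; exact: ka.
have tfrac k : exists uv : {mpoly K[n]} * {mpoly K[n]},
    [/\ uv.1.@[a] = 0, uv.2.@[a] != 0 & t k = mmap iota x uv.1 / mmap iota x uv.2].
  have /(nonunits_localization pp)[_ [_ [[u -> ua] [v _ <-] Nv ->]]] := tn k.
  exists (u, v); split=> //=.
  by apply/eqP => va; apply: Nv; apply/(kpoint_primeP _ ka).
pose al k := (sval (cid (tfrac k))).1; pose be k := (sval (cid (tfrac k))).2.
have tE k : [/\ (al k).@[a] = 0, (be k).@[a] != 0 & t k = mmap iota x (al k) / mmap iota x (be k)].
  by rewrite /al /be; case: cid.
have exf i : exists f (q : K) (w : 'I_d -> K), [/\ mmap iota x f = 0, q != 0 &
    forall l, (f^`M(l)).@[a] = q * (i == l)%:R - \sum_k w k * ((al k)^`M(l)).@[a]].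
  have [c oc xE] := tgen _ (xa i).
  pose u k := (sval (cid (frac _ (oc k)))).1; pose v k := (sval (cid (frac _ (oc k)))).2.
  have cE k : (v k).@[a] != 0 /\ c k = mmap iota x (u k) / mmap iota x (v k).
    by rewrite /u /v; case: cid.
  pose Q := \prod_k (v k * be k).
  pose W k := u k * \prod_(l < d | l != k) (v l * be l).
  exists (Q * ('X_i - (a i)%:MP) - \sum_k W k * al k), Q.@[a], (fun k => (W k).@[a]); split.
  - rewrite rmorphB rmorphM rmorphB /= mmap_XU mmapC xE mulr_sumr rmorph_sum -sumrB.
    apply: big1 => k _; rewrite /Q (bigD1 k) //= /W !rmorphM /=.
    have [va ->] := cE k; have [_ ba ->] := tE k.
    by field; rewrite !val0.
  - rewrite /Q rmorph_prod /=; apply/prodf_neq0 => k _; rewrite mevalM mulf_neq0 //.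
      by case: (cE k).
    by case: (tE k).
  - move=> l; rewrite mderivB mderivM mevalB mevalD !mevalM mevalB mevalXU mevalC subrr mulr0 add0r.
    rewrite mderivB mderivC subr0 mderiv_XU mevalC; congr (_ - _).
    rewrite (raddf_sum (mderiv l)) raddf_sum /=; apply: eq_bigr => k _.
    rewrite mderivM mevalD !mevalM.
    by have [-> _ _] := tE k; rewrite mulr0 add0r.
pose f i := sval (cid (exf i)).
have fP i : exists (q : K) (w : 'I_d -> K), [/\ mmap iota x (f i) = 0, q != 0 &
    forall l, ((f i)^`M(l)).@[a] = q * (i == l)%:R - \sum_k w k * ((al k)^`M(l)).@[a]].
  by rewrite /f; case: cid.
pose q i := sval (cid (fP i)).
have qP i : exists (w : 'I_d -> K), [/\ mmap iota x (f i) = 0, q i != 0 &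
    forall l, ((f i)^`M(l)).@[a] = q i * (i == l)%:R - \sum_k w k * ((al k)^`M(l)).@[a]].
  by rewrite /q; case: cid.
pose w i := sval (cid (qP i)).
have wP i : [/\ mmap iota x (f i) = 0, q i != 0 &
    forall l, ((f i)^`M(l)).@[a] = q i * (i == l)%:R - \sum_k w i k * ((al k)^`M(l)).@[a]].
  by rewrite /w; case: cid.
have JE : jacobian_at f a = diag_mx (\row_i q i) - (\matrix_(i, k) w i k) *m jacobian_at al a.
  apply/matrixP => i l; have [_ _ fl] := wP i; rewrite !mxE fl mulr_natr.
  by congr (_ - _); apply: eq_bigr => k _; rewrite !mxE.
have rD : \rank (diag_mx (\row_i q i)) = n.
  apply/eqP; rewrite -/(row_free _) row_free_unit unitmxE det_diag unitfE.
  by apply/prodf_neq0 => i _; rewrite mxE; case: (wP i).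
have rJ : (n - d <= \rank (jacobian_at f a))%N.
  have dE : diag_mx (\row_i q i) = jacobian_at f a + (\matrix_(i, k) w i k) *m jacobian_at al a.
    by rewrite JE subrK.
  rewrite leq_subLR addnC -[X in (X <= _)%N]rD {1}dE.
  apply: leq_trans (mxrank_add _ _) _; rewrite leq_add2l.
  by apply: leq_trans (mxrankM_maxr _ _) _; exact: rank_leq_row.
pose C : 'M[K]_(n - d, n) := pid_mx (n - d) *m invmx (col_ebase (jacobian_at f a)).
have rC : \rank (C *m jacobian_at f a) = (n - d)%N.
  rewrite -[jacobian_at f a]mulmx_ebase /C !mulmxA mulmxKV ?col_ebase_unit //.
  rewrite mxrankMfree ?row_free_unit ?row_ebase_unit //.
  by rewrite mul_pid_mx (minn_idPl rJ) (minn_idPr (leq_subr _ _)) rank_pid_mx ?leq_subr.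
exists (fun k => \sum_i (C k i)%:MP * f i); split=> [k|].
  by rewrite rmorph_sum big1 // => i _; rewrite rmorphM /=; case: (wP i) => -> _ _; rewrite mulr0.
rewrite -[RHS]rC; congr (\rank _); apply/matrixP => k l; rewrite mxE [RHS]mxE.
rewrite (raddf_sum (mderiv l)) raddf_sum; apply: eq_bigr => i _ /=.
by rewrite mderiv_mulC mevalM mevalC [X in _ = _ * X]mxE.
Qed.

End RegularPoint.

Lemma formal_arc (K F : fieldType) (iota : {rmorphism K -> F}) n m d (x : 'I_n -> F)
    (a : 'I_n -> K) (h : 'I_m -> {mpoly K[n]}) (s : 'I_d -> 'I_n) g :
  (m + d)%N = n -> infinite_set [set: K] -> (0 < d)%N -> kpoint iota x a ->
  (forall k, mmap iota x (h k) = 0) -> \rank (jacobian_at h a) = m ->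
  alg_independent iota (x \o s) -> mmap iota x g <> 0 ->
  exists xi : 'I_n -> hahn K int,
  [/\ forall i, ser_ge 1 (xi i - hconst K int (a i)),
      forall f, mmap iota x f = 0 -> mmap (hconst K int) xi f = 0,
      mmap (hconst K int) xi g <> 0,
      exists i, xi i <> hconst K int (a i) &
      exists e (h' : 'I_e -> {mpoly K[n]}), [/\ (e + 1)%N = n,
        forall k, mmap (hconst K int) xi (h' k) = 0 &
        \rank (jacobian_at h' a) = e]].
Proof.
move=> en; subst n => Kinf d0 ka hx rh inds gx.
have [xi [Vxi Ixi gxi xia [e [h' [eE hxi rh']]]]] := general_arc ka hx rh inds Kinf d0 gx.
by exists xi; split=> //; exists e, h'; rewrite addn1.
Qed.

(** * The equivalences *)

(** The given zero [z] consists of rational functions on the chart on which the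
    place is centered. A formal arc through the center, on which the denominators
    and [g] do not vanish, traces a curve, and largeness gives a point of this curve
    where they do not vanish either. *)
Theorem large_RP_EC (K : fieldType) :
  (forall (F : fieldType) (iota : {rmorphism K -> F}), function_field iota ->
     forall P : place F, rational_place iota P -> admits_local_uniformization iota P) ->
  large K -> RP_EC K.
Proof.
move=> LU Klarge F iota ff [P ratP] k r f g [z [fz gz]].
have [M [o [[[i [p pp oE]] ro] _ [d [chain _] [t tn tgen]]]]] := LU F iota ff P ratP.
subst o; move: tgen tn chain ro pp (model_function_field (m := M) i).
move: (@chart K F iota M i) p; set n := @chart_dim K F iota M i => x p tgen tn chain ro pp gx.
have [a [ka pE xa]] := rational_point_kpoint pp ro; subst p.
have [s inds] := localization_chain_independent pp chain.
have dn : (d <= n)%N.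
  rewrite -(card_ord d) -(card_ord n); apply: leq_card (alg_independent_inj inds).
have d0 : (0 < d)%N.
  rewrite lt0n; apply/eqP => d0; subst d; have [_ [e e0 [[y iy] _]]] := ff.
  have xK j : x j = iota (a j).
    have [c _ e1] := tgen _ (xa j); apply/eqP; rewrite -subr_eq0 e1.
    by rewrite big_ord0.
  have : (e <= size ([::] : seq F))%N.
    apply: (alg_independent_le iy) => j; apply: (generated_algebraic (x := x)).
      by move=> l; apply: sub_cl; left; exists (a l); rewrite ?xK.
    by have /field_generatesP -> := gx.
  by rewrite leqn0 => /eqP e00; rewrite e00 in e0.
have [h [hx rh]] := regular_equations ka tn tgen xa.
have exz j : exists pq : {mpoly K[n]} * {mpoly K[n]},
    mmap iota x pq.2 != 0 /\ z j = mmap iota x pq.1 / mmap iota x pq.2.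
  by have [u [v [/eqP v0 zE]]] := gx (z j); exists (u, v).
pose pz j := (sval (cid (exz j))).1; pose qz j := (sval (cid (exz j))).2.
have qz0 j : mmap iota x (qz j) != 0 by rewrite /qz; case: cid => ? [].
have zE : (fun j => mmap iota x (pz j) / mmap iota x (qz j)) =1 z.
  by move=> j; rewrite /pz /qz; case: cid => ? [].
have [G [N GE]] := clear_denominators pz qz g.
pose g0 := G * \prod_j qz j.
have g0x : mmap iota x g0 <> 0.
  apply/eqP; rewrite rmorphM rmorph_prod /= mulf_neq0 //; last exact/prodf_neq0.
  rewrite GE // (mmap_ext _ _ zE) mulf_neq0 ?expf_neq0 //; last exact/eqP.
  exact/prodf_neq0.
have [xi [Vxi Ixi gxi xia [e [h' [eE hxi rh']]]]] :=
  formal_arc (subnK dn) (large_infinite Klarge) d0 ka hx rh inds g0x.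
have [b [kb gb]] := large_arc Klarge eE Vxi xia hxi rh' gxi.
have kxb : kpoint iota x b by move=> u /Ixi/kb.
move/eqP: gb; rewrite mevalM mulf_eq0 negb_or rmorph_prod => /andP[Gb /prodf_neq0 qb].
have qb0 j : mmap idfun b (qz j) != 0 by exact: qb.
exists (fun j => (pz j).@[b] / (qz j).@[b]); split=> [l|gy]; last first.
  by move: Gb; rewrite /meval GE // -/(meval _ g) [X in _ * X]gy mulr0 eqxx.
have [H [N' HE]] := clear_denominators pz qz (f l).
have Hx : mmap iota x H = 0 by rewrite HE // (mmap_ext _ _ zE) fz mulr0.
have := kxb _ Hx; rewrite /meval HE // => /eqP; rewrite mulf_eq0 expf_eq0.
by move=> /orP[/andP[_ /prodf_eq0[j _]]|/eqP //]; rewrite (negbTE (qb0 j)).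
Qed.

Section RestrictedPlace.
Variables (K E L : fieldType) (j : {rmorphism K -> E}) (iota : {rmorphism K -> L}).
Variables (incl : {rmorphism E -> L}) (P : place L).
Hypotheses (inclj : forall c, incl (j c) = iota c) (ratP : rational_place iota P).

Lemma restricted_place : exists Q : place E, rational_place j Q.
Proof.
pose q z := P (incl z).
have q1 : q 1 = Some 1 by rewrite /q rmorph1 place1.
have qD u v b c : q u = Some b -> q v = Some c -> q (u + v) = Some (b + c).
  by rewrite /q rmorphD; exact: placeD.
have qM u v b c : q u = Some b -> q v = Some c -> q (u * v) = Some (b * c).
  by rewrite /q rmorphM; exact: placeM.
have qV u : q u = None -> q u^-1 = Some 0 by rewrite /q fmorphV; exact: placeV.
have [Ptriv Psurj] := ratP.
have qs b : exists u, q u = Some b.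
  by have [c Pc] := Psurj b; exists (j c); rewrite /q inclj.
exists (Place q1 qD qM qV qs); split=> [c|b] /=; first by rewrite /q inclj.
by have [c Pc] := Psurj b; exists c; rewrite /q inclj.
Qed.

End RestrictedPlace.

(** Only the field generated by the given zero [z] matters. It is a function field,
    unless all coordinates of [z] are algebraic, and then they are in [K]. *)
Theorem RP_EC_rational_place (K : fieldType) : RP_EC K -> EC_if_rational_place K.
Proof.
move=> RE L iota [P ratP] m n f g [z [fz gz]].
have [algz|/existsNP[i0 Nalg]] := pselect (forall i, cl (range iota) (z i)).
  have zK i : exists c, z i = iota c.
    by apply: place_algebraic (algz i); [exact: ratP.1 | exact: ratP].
  pose y i := sval (cid (zK i)).
  have zE p : mmap iota z p = iota p.@[y].
    rewrite -mmap_meval; apply: mmap_ext => i; exact: svalP (cid (zK i)).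
  exists y; split=> [i|gy]; last by apply: gz; rewrite zE gy rmorph0.
  by have /eqP := fz i; rewrite zE fmorph_eq0 => /eqP.
have [E [j [incl [y [inclj incly gy]]]]] := generated_subfield iota z.
have zE : incl \o y = z by apply/funext.
have yz p : mmap j y p = 0 <-> mmap iota z p = 0 by rewrite -zE; exact: mmap_incl0.
have bound d : (exists x : 'I_d -> E, alg_independent j x) -> (d <= m)%N.
  move=> [x ix]; rewrite -(size_enum_ord m) -(size_map y).
  apply: (alg_independent_le ix) => i; apply: (generated_algebraic (x := y)).
    by move=> k; apply: sub_cl; right; apply/mapP; exists k; rewrite ?mem_enum.
  by have /field_generatesP -> := gy.
have ff : function_field j.
  split; first by exists m, y.
  have ex : exists d, `[< exists x : 'I_d -> E, alg_independent j x >].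
    exists 0%N; apply/asboolP; exists (fun i => y (widen_ord (leq0n m) i)) => p.
    by rewrite [p]nvar0_mpolyC mmapC => /eqP; rewrite fmorph_eq0 => /eqP ->; rewrite mpolyC0.
  have bd d : `[< exists x : 'I_d -> E, alg_independent j x >] -> (d <= m)%N.
    by move=> /asboolP; exact: bound.
  case: (ex_maxnP ex bd) => d /asboolP dx dmax; exists d.
    apply: (dmax 1%N); apply/asboolP; exists (fun=> y i0).
    apply/(alg_independent_incl inclj); apply: alg_independent1.
    by rewrite /= incly.
  by split=> // /asboolP/dmax; rewrite ltnn.
apply: (RE E j ff (restricted_place inclj ratP)).
by exists y; split=> [i|]; [apply/yz | move=> /yz].
Qed.

Theorem rational_place_EC_series (K : fieldType) :
  EC_if_rational_place K -> EC_in_power_series_fields K.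
Proof.
by move=> H G; apply: H; exists (hahn_place K G); exact: hahn_place_rational.
Qed.

(** A smooth rational point of a curve is the origin of a formal arc on which a
    nonconstant coordinate [x l] takes none of finitely many given values in [K].
    As the ideal of the curve is finitely generated, existential closedness gives a
    rational point with the same property. *)
Theorem EC_series_large (K : fieldType) : EC_in_power_series_fields K -> large K.
Proof.
move=> EC; have Kinf : infinite_set [set: K].
  apply: infinite_of_series_points => g gs.
  have [|b [_ gb]] := EC int 1%N 0%N (fun _ => 0) g; last by exists b.
  by exists (fun=> svar); split=> // -[].
move=> F iota C tr sm [o [[i [p pp oE]] ro]].
subst o; move: ro pp (sm i) (model_function_field (m := C) i).
have pts o' : chart_points iota (@chart K F iota C i) o' -> points C o' by exists i.
move: (@chart K F iota C i) pts p; set n := @chart_dim K F iota C i => x pts p ro pp smx gx.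
have [a [ka pE xa]] := rational_point_kpoint pp ro.
have [h hx rh] := smx K idfun a ka.
have [l Nl] : exists l, ~ cl (range iota) (x l).
  apply: contrapT => no; have [[y iy] _] := tr.
  have : (1 <= size ([::] : seq F))%N by
    apply: (alg_independent_le iy) => j; apply: (generated_algebraic (x := x));
    [move=> l; apply: cl_nil; apply: contrapT => Nl; apply: no; exists l
    |have /field_generatesP -> := gx].
  by [].
have inds : alg_independent iota (x \o (fun _ : 'I_1 => l)) by exact: alg_independent1.
have n1 : (n - 1 + 1)%N = n by rewrite subnK //; exact: leq_trans (ltn_ord l).
move=> /finite_seqP[S SE].
pose c (o : set F) := if pselect (exists c, nonunits o (x l - iota c)) is left e
  then sval (cid e) else 0.
pose g : {mpoly K[n]} := \prod_(o <- S) ('X_l - (c o)%:MP).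
have gx0 : mmap iota x g <> 0.
  apply/eqP; rewrite /g rmorph_prod prodf_seq_neq0; apply/allP => o _ /=.
  rewrite rmorphB /= mmap_XU mmapC subr_eq0; apply/eqP => xc; apply: Nl.
  by rewrite xc; apply: sub_cl; exists (c o).
have [xi [Vxi Ixi gxi _ _]] := formal_arc n1 Kinf (ltn0Sn 0) ka hx rh inds gx0.
have idI : is_ideal [set f | mmap iota x f = 0].
  split=> /=; first by rewrite rmorph0.
    by move=> f f' f0 f0'; rewrite rmorphD /= f0 f0' addr0.
  by move=> f f' f0'; rewrite rmorphM /= f0' mulr0.
have [N [B [BI genB]]] := hilbert_basis idI.
have [|b [Bb gb]] := EC int n N (fun k => B k) g.
  by exists xi; split=> // k; apply: Ixi; exact: BI.
have kb : kpoint iota x b.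
  move=> f /genB[q ->]; rewrite raddf_sum big1 // => k _.
  by rewrite /= mevalM Bb mulr0.
have pb := kpoint_prime_ideal kb.
pose ob := localization (chart_ring iota x) (kpoint_prime iota x b).
have obS : ob \in S.
  have : rational_points C ob.
    by split; [apply: pts; exists (kpoint_prime iota x b) | exact: kpoint_rational].
  by rewrite SE.
have nb : nonunits ob (x l - iota (b l)).
  apply: (prime_nonunits pb); exists ('X_l - (b l)%:MP); first by rewrite rmorphB /= mmap_XU mmapC.
  by rewrite mevalB mevalXU mevalC subrr.
have cb : c ob = b l.
  rewrite /c; case: pselect => [e|no]; last by case: no; exists (b l).
  case: (cid e) => c' /= nc'; apply/eqP; rewrite -subr_eq0; apply/eqP.
  apply: (nonunits_const pb (iota := iota)); rewrite rmorphB.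
  have -> : iota c' - iota (b l) = (x l - iota (b l)) + -1 * (x l - iota c') by ring.
  apply: (nonunitsD pb) => //; apply: (nonunitsM pb) => //; apply: (chart_local pb).
  by exists (-1); rewrite ?rmorphN ?rmorph1.
apply: gb; apply/eqP; rewrite /g rmorph_prod /= prodf_seq_eq0; apply/hasP; exists ob => //=.
by rewrite mevalB mevalXU mevalC cb subrr.
Qed.

Theorem theorem20 :
  (forall (K F : fieldType) (iota : {rmorphism K -> F}),
     function_field iota ->
     forall P : place F, rational_place iota P ->
       admits_local_uniformization iota P) ->
  (forall K : fieldType, large K -> RP_EC K) /\
  (forall K : fieldType,
     (large K <-> EC_in_power_series_fields K) /\
     (EC_in_power_series_fields K <-> EC_if_rational_place K)).
Proof.
move=> LU; have l_rp (K : fieldType) : large K -> RP_EC K by exact/large_RP_EC/LU.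
have l_ec (K : fieldType) : large K -> EC_if_rational_place K.
  by move=> /l_rp/RP_EC_rational_place.
split=> // K; split; split.
- by move=> /l_ec/rational_place_EC_series.
- exact: EC_series_large.
- by move=> /EC_series_large/l_ec.
- exact: rational_place_EC_series.
Qed.
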